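(* Let $N\ge 1$ and $m\ge 1$ be integers, and let $\gamma,\gamma_1,\dots,\gamma_m$ be positive real numbers. There exist two positive constants $c_1$ and $c_2$, depending only on $N$, $\gamma$, $m$ and $\gamma_1,\dots,\gamma_m$, such that the following holds. Let $(\omega_k)_{k\in K}$ be a family of vectors in $\mathbb R^N$ with $$\inf_{k\ne n}|\omega_k-\omega_n|=\gamma>0,$$ and let $K=K_1\cup\cdots\cup K_m$ be a finite partition of $K$ with $$\inf\{|\omega_k-\omega_n| : k,n\in K_j,\ k\ne n\}=\gamma_j,\qquad j=1,\dots,m.$$ Set $R_j:=2\sqrt{\mu}/\gamma_j$ for $j=1,\dots,m$ and $R_0:=R_1+\cdots+R_m$, where $\mu$ is the first eigenvalue of $-\Delta$ in $H_0^1(B_1)$. If $R_0<R\le 2R_0$, then $$c_1 (R-R_0)^{5m-4+2N}\sum_{k\in K}|x_k|^2\le \int_{B_R}\Bigl|\sum_{k\in K}x_k e^{i\omega_k\cdot t}\Bigr|^2\,dt\le c_2\sum_{k\in K}|x_k|^2$$ for every square summable family $(x_k)_{k\in K}$ of complex numbers.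
   Context: $|\cdot|$ is the Euclidean norm on $\mathbb R^N$ and $\omega\cdot t$ the Euclidean inner product. $B_R$ denotes the open ball of radius $R$ in $\mathbb R^N$ centered at the origin. The number $\mu$ is the first (smallest) eigenvalue of the Dirichlet Laplacian $-\Delta$ in the Sobolev space $H_0^1(B_1)$ on the unit ball. The sets $K_1,\dots,K_m$ are pairwise disjoint, and each has at least two elements, so that each $\gamma_j$ is a positive real number. When $K$ is infinite, the sum $\sum_{k\in K}x_k e^{i\omega_k\cdot t}$ is understood as the limit in $L^2(B_R)$ of its finite partial sums. *)

(* Defs.v *)
From HB Require Import structures.
From mathcomp Require Import all_boot all_order all_algebra.
From mathcomp Require Import finmap.
From mathcomp Require Import complex.
From mathcomp Require Import all_classical all_reals all_analysis.

Set Implicit Arguments.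
Unset Strict Implicit.
Unset Printing Implicit Defensive.

Import Order.TTheory GRing.Theory Num.Theory.
Import numFieldNormedType.Exports.

Local Open Scope classical_set_scope.
Local Open Scope ring_scope.
Local Open Scope complex_scope.

(* R^N is 'rV[R]_N.  Its sigma-algebra is generated by the N coordinates, i.e.
   it is the Borel sigma-algebra. *)
Definition rV_display : measure_display -> measure_display.
Proof. exact. Qed.

Section rV_measurable.
Variables (R : realType) (n : nat).

Let coord (i : 'I_n) (v : 'rV[R]_n) : R := v ord0 i.

Let rV_set0 : g_sigma_preimage coord set0.
Proof. exact: sigma_algebra0. Qed.

Let rV_setC A : g_sigma_preimage coord A -> g_sigma_preimage coord (~` A).
Proof. exact: sigma_algebraC. Qed.

Let rV_bigcup (F : (set 'rV[R]_n)^nat) :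
  (forall i, g_sigma_preimage coord (F i)) ->
  g_sigma_preimage coord (\bigcup_i (F i)).
Proof. exact: sigma_algebra_bigcup. Qed.

HB.instance Definition _ := @isMeasurable.Build
  (rV_display default_measure_display) 'rV[R]_n (g_sigma_preimage coord)
  rV_set0 rV_setC rV_bigcup.

End rV_measurable.

Lemma measurable_coord (R : realType) n (i : 'I_n) :
  measurable_fun [set: 'rV[R]_n] (fun v : 'rV[R]_n => v ord0 i).
Proof.
move=> _ Y mY; rewrite setTI; apply: sub_sigma_algebra => /=.
rewrite -bigcup_seq/=; exists i => /=; first by rewrite mem_index_enum.
by exists Y => //; rewrite setTI.
Qed.

Lemma measurable_rVP d (T : measurableType d) (R : realType) n
    (f : T -> 'rV[R]_n) :
  (forall i, measurable_fun [set: T] (fun x => f x ord0 i)) ->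
  measurable_fun [set: T] f.
Proof.
move=> mf _ A mA; rewrite setTI.
suff: preimage_set_system [set: T] f measurable `<=` measurable.
  by apply; exists A => //; rewrite setTI.
rewrite [X in X `<=` _](_ : _ =
  g_sigma_preimage (fun i => (fun v : 'rV[R]_n => v ord0 i) \o f)); last first.
  by rewrite g_sigma_preimage_comp.
apply: smallest_sub; first exact: sigma_algebra_measurable.
case: n f mf A mA => [|n] f mf A mA; first by rewrite big_ord0.
rewrite -bigcup_mkord_ord; apply: bigcup_sub => i Ii.
by move=> B [C mC <-]; exact: mf.
Qed.

(* The library proves this as an instance on \x, which its later instance for
   products of subprobabilities masks. *)
Lemma sigma_finite_prod d1 d2 (T1 : measurableType d1) (T2 : measurableType d2)
    (R : realType) (m1 : {sigma_finite_measure set T1 -> \bar R})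
    (m2 : {sigma_finite_measure set T2 -> \bar R}) :
  sigma_finite [set: T1 * T2] (m1 \x m2)%E.
Proof.
have /sigma_finiteP[F [TF ndF Foo]] := sigma_finiteT m1.
have /sigma_finiteP[G [TG ndG Goo]] := sigma_finiteT m2.
exists (fun n => F n `*` G n).
  rewrite -setXTT TF TG predeqE => -[x y]; split.
    move=> [/= [n _ Fnx] [k _ Gky]]; exists (maxn n k) => //; split.
    - by move: x Fnx; exact/subsetPset/ndF/leq_maxl.
    - by move: y Gky; exact/subsetPset/ndG/leq_maxr.
  by move=> [n _ []/= ? ?]; split; exists n.
move=> k; have [? ?] := Foo k; have [? ?] := Goo k.
split; first exact: measurableX.
by rewrite product_measure1E// lte_mul_pinfty// ge0_fin_numE.
Qed.

Section lebesgue_rV.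
Variable R : realType.

Definition rV_cons n (p : measurableTypeR R * 'rV[R]_n) : 'rV[R]_n.+1 :=
  row_mx (const_mx p.1 : 'rV[R]_1) p.2.

Definition rV_uncons n (v : 'rV[R]_n.+1) : measurableTypeR R * 'rV[R]_n :=
  (v ord0 ord0, \row_i v ord0 (lift ord0 i)).

Lemma rV_cons0 n p : @rV_cons n p ord0 ord0 = p.1.
Proof. by rewrite /rV_cons mxE; case: splitP => // j _; rewrite mxE. Qed.

Lemma rV_consS n p i : @rV_cons n p ord0 (lift ord0 i) = p.2 ord0 i.
Proof.
rewrite /rV_cons mxE; case: splitP => [[j j1]/=|j /= /eqP].
  by rewrite /bump leq0n => ij; move: j1; rewrite -ij.
by rewrite /bump leq0n eqSS => /eqP/val_inj ->.
Qed.

Lemma rV_consK n : cancel (@rV_cons n) (@rV_uncons n).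
Proof.
move=> [x v]; rewrite /rV_uncons rV_cons0; congr pair.
by apply/rowP => i; rewrite mxE rV_consS.
Qed.

Lemma measurable_rV_cons n : measurable_fun [set: _] (@rV_cons n).
Proof.
apply: measurable_rVP => i.
case: (unliftP ord0 i) => [j|] ->.
  rewrite (_ : (fun _ => _) = (fun v : 'rV[R]_n => v ord0 j) \o snd).
    exact: measurableT_comp (@measurable_coord R n j) measurable_snd.
  by apply/funext => p /=; rewrite rV_consS.
rewrite (_ : (fun _ => _) = fst); first exact: measurable_fst.
by apply/funext => p /=; rewrite rV_cons0.
Qed.

Lemma measurable_rV_uncons n : measurable_fun [set: _] (@rV_uncons n).
Proof.
apply/measurable_fun_pairP; split => /=; first exact: measurable_coord.
apply: measurable_rVP => i.
rewrite (_ : (fun _ => _) =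
  fun v : 'rV[R]_n.+1 => v ord0 (lift ord0 i)); first exact: measurable_coord.
by apply/funext => v /=; rewrite mxE.
Qed.

Section lebesgue_rV_step.
Local Open Scope ereal_scope.
Variables (n : nat) (mu : {sigma_finite_measure set 'rV[R]_n -> \bar R}).

Definition lebesgue_rV_step : set 'rV[R]_n.+1 -> \bar R :=
  pushforward (lebesgue_measure \x mu) (@rV_cons n).

Let preimage_cons A : measurable A -> measurable (@rV_cons n @^-1` A).
Proof. by move=> mA; rewrite -[X in measurable X]setTI; exact: measurable_rV_cons. Qed.

Let step0 : lebesgue_rV_step set0 = 0.
Proof. by rewrite /lebesgue_rV_step /pushforward preimage_set0 measure0. Qed.

Let step_ge0 A : 0 <= lebesgue_rV_step A.
Proof. by rewrite /lebesgue_rV_step /pushforward; exact: measure_ge0. Qed.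

Let step_sigma_additive : semi_sigma_additive lebesgue_rV_step.
Proof.
move=> F mF tF mUF; rewrite /lebesgue_rV_step /pushforward preimage_bigcup.
apply: measure_semi_sigma_additive.
- by move=> k; exact: preimage_cons.
- apply/trivIsetP => /= i j _ _ ij; rewrite -preimage_setI.
  by move/trivIsetP : tF => /(_ _ _ _ _ ij) ->//; rewrite preimage_set0.
- by rewrite -preimage_bigcup; exact: preimage_cons.
Qed.

HB.instance Definition _ := isMeasure.Build _ _ _ lebesgue_rV_step
  step0 step_ge0 step_sigma_additive.

Let step_sigma_finite : sigma_finite setT lebesgue_rV_step.
Proof.
have [F FT Foo] : sigma_finite setT (lebesgue_measure \x mu).
  exact: sigma_finite_prod.
exists (fun k => @rV_uncons n @^-1` F k).
  by rewrite -preimage_bigcup -FT preimage_setT.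
move=> k; have [mFk Fkoo] := Foo k; split.
  by rewrite -[X in measurable X]setTI; exact: measurable_rV_uncons.
rewrite /lebesgue_rV_step /pushforward -comp_preimage.
rewrite (_ : _ \o _ = id) ?preimage_id//.
by apply/funext => p /=; rewrite rV_consK.
Qed.

HB.instance Definition _ := Measure_isSigmaFinite.Build _ _ _ lebesgue_rV_step
  step_sigma_finite.

End lebesgue_rV_step.

(* The only point of R^0 has measure 1; the (n+1)-dimensional measure is the
   product of the 1-dimensional one and the n-dimensional one. *)
Fixpoint lebesgue_rV n : {sigma_finite_measure set 'rV[R]_n -> \bar R} :=
  match n with
  | 0 => (\d_(0 : 'rV[R]_0))
  | n'.+1 => lebesgue_rV_step (lebesgue_rV n')
  end.

End lebesgue_rV.
Arguments lebesgue_rV {R} n.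

Section euclidean.
Variables (R : realType) (N : nat).
Implicit Types (u v : 'rV[R]_N) (r : R).

Definition dotr u v : R := \sum_i u ord0 i * v ord0 i.

(* The norm `|v| of the library on 'rV[R]_N is the sup norm. *)
Definition enorm v : R := Num.sqrt (dotr v v).

Definition eball r : set 'rV[R]_N := [set v | enorm v < r].

End euclidean.
Arguments eball {R N} r.

Section sobolev.
Variables (R : realType) (N : nat).
Local Notation E := 'rV[R]_N.
Local Notation leb := (@lebesgue_rV R N).
Implicit Types (U : set E) (u v phi : E -> R) (g h : 'I_N -> E -> R).

Definition partial (i : 'I_N) u : E -> R := 'D_(delta_mx ord0 i) u.

Definition partials (s : seq 'I_N) u : E -> R := foldr partial u s.

Definition smooth u := forall s : seq 'I_N,
  continuous (partials s u) /\
  forall i x, derivable (partials s u) x (delta_mx ord0 i).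

Definition test_function U phi :=
  [/\ smooth phi, compact (closure [set x | phi x != 0]) &
      closure [set x | phi x != 0] `<=` U].

Definition L2 U u :=
  measurable_fun U u /\ leb.-integrable U (fun x => ((u x) ^+ 2)%:E).

Definition L2_dist2 U u v : \bar R :=
  (\int[leb]_(x in U) ((u x - v x) ^+ 2)%:E)%E.

Definition weak_gradient U u g := forall i phi, test_function U phi ->
  \int[leb]_(x in U) (u x * partial i phi x) =
  - \int[leb]_(x in U) (g i x * phi x).

Definition H1 U u g :=
  [/\ L2 U u, forall i, L2 U (g i) & weak_gradient U u g].

(* u belongs to H^1_0(U), the closure in H^1(U) of the test functions,
   and g is its weak gradient. *)
Definition H10 U u g := H1 U u g /\
  exists phi : nat -> E -> R,
    [/\ forall k, test_function U (phi k),
        (fun k => L2_dist2 U (phi k) u) @ \oo --> 0%E &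
        forall i, (fun k => L2_dist2 U (partial i (phi k)) (g i)) @ \oo --> 0%E].

Definition dirichlet_eigenvalue U (lambda : R) := exists u g,
  [/\ H10 U u g, ~ {ae leb, forall x, U x -> u x = 0} &
      forall v h, H10 U v h ->
        \int[leb]_(x in U) (\sum_i g i x * h i x) =
        lambda * \int[leb]_(x in U) (u x * v x)].

Definition first_dirichlet_eigenvalue U (lambda : R) :=
  dirichlet_eigenvalue U lambda /\
  forall l, dirichlet_eigenvalue U l -> lambda <= l.

End sobolev.

Section exponential_sums.
Variables (R : realType) (N : nat) (K : choiceType).
Variable omega : K -> 'rV[R]_N.
Implicit Types (A : set K) (x : K -> R[i]) (r : R) (t : 'rV[R]_N).

(* inf set0 = 0, so separation A = c with c > 0 forces A to have at least two
   elements. *)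
Definition separation A : R :=
  inf [set d | exists k n, [/\ A k, A n, k <> n & d = enorm (omega k - omega n)]].

Definition cexpi (a : R) : R[i] := cos a +i* sin a.

Definition sqnormc (z : R[i]) : R := Normc.normc z ^+ 2.

Definition exp_sum x (F : {fset K}) t : R[i] :=
  \sum_(k <- F) x k * cexpi (dotr (omega k) t).

Definition sq_sum x : \bar R := (\esum_(k in [set: K]) (sqnormc (x k))%:E)%E.

Definition sq_int r (f : 'rV[R]_N -> R[i]) : \bar R :=
  (\int[lebesgue_rV N]_(t in eball r) (sqnormc (f t))%:E)%E.

(* f is the limit in L^2(B_r) of the net of the finite partial sums; such an f
   is automatically square integrable on B_r. *)
Definition exp_series r x (f : 'rV[R]_N -> R[i]) :=
  [/\ measurable_fun (eball r) (fun t => complex.Re (f t)),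
      measurable_fun (eball r) (fun t => complex.Im (f t)) &
      forall e : R, 0 < e -> exists F0 : {fset K}, forall F : {fset K},
        (F0 `<=` F)%fset ->
        (sq_int r (fun t => (f t - exp_sum x F t)%R) <= e%:E)%E].

End exponential_sums.

(* Main.v *)
Require Import Defs.
From HB Require Import structures.
From mathcomp Require Import all_boot all_order all_algebra.
From mathcomp Require Import finmap.
From mathcomp Require Import complex.
From mathcomp Require Import all_classical all_reals all_analysis.
From mathcomp Require Import measurable_realfun.
From mathcomp Require Import zify ring lra.

Set Implicit Arguments.
Unset Strict Implicit.
Unset Printing Implicit Defensive.

Import Order.TTheory GRing.Theory Num.Theory.
Import numFieldNormedType.Exports.

Local Open Scope classical_set_scope.
Local Open Scope ring_scope.

(** An exponential sum is compared with its coefficients one family at a time,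
    and the families are then joined.

    A single family. Let H be a continuous function supported in the unit ball.
    Its autocorrelation vanishes off the ball of radius 2 and is the Fourier
    transform of |H^|^2. Hence, if the frequencies are 2-separated, the weight
    |H^|^2, spread over the whole space by a positive summability kernel, makes
    the characters orthogonal in the limit: the weighted integrals of the squared
    modulus of the sum tend to a multiple of |H|^2 sum_k |a_k|^2
    (cvg_kern_epow). If H >= 0 is not 0, the weight is bounded below on the unit
    ball, and this gives the upper estimate (upper_gap). For a test function phi the
    same limit holds with the weight (r^2 - |t|^2) |phi^(t)|^2, because |t|^2
    |phi^(t)|^2 belongs to the gradient of phi; the factor in the limit is
    r^2 |phi|^2 - |grad phi|^2, and the weight is nonpositive off the ball of
    radius r. So the lower estimate holds on this ball as soon as r^2 exceeds
    the Rayleigh quotient of phi, which can be brought arbitrarily close to mu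
    (lower_gap). A dilation turns separation 2 into separation gamma_j, and the
    critical radius sqrt mu into R_j.

    Several families. Say that a radius isolates the frequency m from a set P
    when the coefficient of m is controlled by the sum on the ball of that
    radius, for all sums with frequencies in P and m. If m belongs to K_j, then
    R_j + e isolates m from K_j with a loss 1 / e. If not, subtracting from the
    sum a translate by a vector s, with the phase that suits m, removes m and
    multiplies the other coefficients by factors 1 - exp (i theta_k(s)); the
    average over the s of size e of their squares is at least of order e^2,
    and R_j + e still isolates m, with a loss 1 / e^3 (isolates_foreign). Radii
    add up under unions (isolates_union): isolation from P is a bounded linear
    functional, thus an integral against a sum alpha over P and m on the ball,
    and convolving with alpha removes P from any sum while keeping the
    coefficient of m. Finally, once every m is isolated, all the coefficients
    are controlled together by smoothing the sum over a ball of radius e and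
    using the upper estimate in its dual form (sum_isolates). With e a fixed
    fraction of R - R_0 the total loss is e^-(3M - 2 + 2N), where M is the number
    of sets and 3M - 2 + 2N <= 5M - 4 + 2N.

    All this is done for finite sums with real coefficients; the real and
    imaginary parts of complex coefficients do not interact, because balls are
    symmetric. The limit f of an infinite sum is built from partial sums with
    geometrically small tails (exp_series_exists), and both estimates pass to
    the limit, up to a factor 2. *)

(** * Real-valued integrals *)

Notation intble m f := (m.-integrable setT (EFin \o f)).

Section real_integrals.
Context d (T : measurableType d) (R : realType) (m : {measure set T -> \bar R}).
Implicit Types f g : T -> R.

Lemma intble_meas f : intble m f -> measurable_fun setT f.
Proof. by move=> /integrableP[/measurable_EFinP]. Qed.

Lemma intble_dom f g : measurable_fun setT f -> (forall x, `|f x| <= g x) ->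
  intble m g -> intble m f.
Proof.
move=> mf fg; apply: le_integrable => //; first exact/measurable_EFinP.
move=> x _ /=; rewrite lee_fin; apply: le_trans (fg x) _.
exact: ler_norm.
Qed.

Lemma intbleD f g : intble m f -> intble m g -> intble m (fun x => f x + g x).
Proof.
move=> fi gi; have := integrableD measurableT fi gi.
by apply: eq_integrable => // x _ /=; rewrite EFinD.
Qed.

Lemma intbleB f g : intble m f -> intble m g -> intble m (fun x => f x - g x).
Proof.
move=> fi gi; have := integrableB measurableT fi gi.
by apply: eq_integrable => // x _ /=; rewrite EFinB.
Qed.

Lemma intbleZ c f : intble m f -> intble m (fun x => c * f x).
Proof.
move=> fi; have := integrableZl measurableT c fi.
by apply: eq_integrable => // x _ /=; rewrite EFinM.
Qed.

Lemma intble0 : intble m (fun=> 0).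
Proof. exact: integrable0. Qed.

Lemma intble_sum (I : Type) (s : seq I) (P : pred I) (F : I -> T -> R) :
  (forall i, P i -> intble m (F i)) ->
  intble m (fun x => \sum_(i <- s | P i) F i x).
Proof.
move=> Fi; elim: s => [|i s IHs].
  by under eq_fun do rewrite big_nil; exact: intble0.
case Pi: (P i); under eq_fun do rewrite big_cons Pi; last exact: IHs.
by apply: intbleD => //; exact: Fi.
Qed.

Lemma Rint_D f g : intble m f -> intble m g ->
  \int[m]_x (f x + g x) = \int[m]_x f x + \int[m]_x g x.
Proof. by move=> *; rewrite RintegralD. Qed.

Lemma Rint_B f g : intble m f -> intble m g ->
  \int[m]_x (f x - g x) = \int[m]_x f x - \int[m]_x g x.
Proof. by move=> *; rewrite RintegralB. Qed.

Lemma Rint_Z c f : intble m f -> \int[m]_x (c * f x) = c * \int[m]_x f x.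
Proof. by move=> *; rewrite RintegralZl. Qed.

Lemma Rint_0 : \int[m]_x (0 : R) = 0.
Proof. by rewrite /Rintegral integral0. Qed.

Lemma Rint_sum (I : Type) (s : seq I) (P : pred I) (F : I -> T -> R) :
  (forall i, P i -> intble m (F i)) ->
  \int[m]_x (\sum_(i <- s | P i) F i x) = \sum_(i <- s | P i) \int[m]_x F i x.
Proof.
move=> Fi; elim: s => [|i s IHs].
  by under eq_Rintegral do rewrite big_nil; rewrite Rint_0 big_nil.
rewrite big_cons; case: ifPn => Pi; under eq_Rintegral do rewrite big_cons.
  rewrite Pi Rint_D ?IHs//; first exact: Fi.
  exact: intble_sum.
by rewrite (negbTE Pi) IHs.
Qed.

Lemma Rint_le f g : intble m f -> intble m g -> (forall x, f x <= g x) ->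
  \int[m]_x f x <= \int[m]_x g x.
Proof. by move=> *; exact: le_Rintegral. Qed.

Lemma Rint_norm f g : intble m f -> intble m g -> (forall x, `|f x| <= g x) ->
  `|\int[m]_x f x| <= \int[m]_x g x.
Proof.
move=> fi gi fg; apply: le_trans (le_normr_Rintegral measurableT fi) _.
by apply: Rint_le => //; exact: integrable_norm.
Qed.

Lemma Rint_E f : intble m f -> (\int[m]_x (f x))%:E = (\int[m]_x (f x)%:E)%E.
Proof. by move=> fi; rewrite fineK// integrable_fin_num. Qed.

Lemma Rint_cvg (F : (T -> R)^nat) f g : (forall n, measurable_fun setT (F n)) ->
  (forall x, F ^~ x @ \oo --> f x) -> intble m g ->
  (forall n x, `|F n x| <= g x) ->
  [/\ intble m f, forall n, intble m (F n) &
    (fun n => \int[m]_x F n x) @ \oo --> \int[m]_x f x].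
Proof.
move=> mF Ff gi Fg.
have mf : measurable_fun setT f by apply: measurable_fun_cvg => // x _; exact: Ff.
have Fi n : intble m (F n) by exact: intble_dom (Fg n) gi.
have [|||||fi _ cv] := @dominated_convergence _ _ _ m setT measurableT
    (fun n => EFin \o F n) (EFin \o f) (EFin \o g).
- by move=> n; exact/measurable_EFinP.
- exact/measurable_EFinP.
- by apply: aeW => x _ /=; apply: cvg_EFin; [exact: nearW|exact: Ff].
- exact: gi.
- by apply: aeW => x n _ /=; rewrite lee_fin.
split => //; apply: fine_cvg => /=.
by rewrite Rint_E.
Qed.

End real_integrals.

(** The oscillating double integrals below have integrands dominated by products,
    which makes the integrability conditions of Fubini's theorem automatic. *)
Section fubini_tensor.
Context d1 d2 (T1 : measurableType d1) (T2 : measurableType d2) (R : realType).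
Variables (m1 : {sigma_finite_measure set T1 -> \bar R})
          (m2 : {sigma_finite_measure set T2 -> \bar R}).
Variables (f : T1 -> T2 -> R) (g : T1 -> R) (h : T2 -> R).
Hypothesis mf : measurable_fun setT (fun p : T1 * T2 => f p.1 p.2).
Hypothesis fgh : forall x y, `|f x y| <= g x * h y.
Hypothesis gi : intble m1 g.
Hypothesis hi : intble m2 h.

Let mf1 x : measurable_fun setT (f x).
Proof. exact: (measurableT_comp mf (pair1_measurable x)). Qed.

Let mf2 y : measurable_fun setT (f ^~ y).
Proof. exact: (measurableT_comp mf (pair2_measurable y)). Qed.

Lemma tensor_intble1 x : intble m2 (f x).
Proof. by apply: (intble_dom (mf1 x) (fgh x)); exact: intbleZ. Qed.

Lemma tensor_intble2 y : intble m1 (f ^~ y).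
Proof.
apply: (intble_dom (mf2 y) (fun x => fgh x y)).
by under eq_fun do rewrite mulrC; exact: intbleZ.
Qed.

Lemma tensor_intble : intble (m1 \x m2)%E (fun p => f p.1 p.2).
Proof.
apply/integrable12ltyP; first exact/measurable_EFinP.
apply: (@le_lt_trans _ _ (\int[m1]_x (`|g x| * \int[m2]_y `|h y|)%:E)%E).
  apply: ge0_le_integral => //.
  - by move=> x _; exact: integral_ge0.
  - apply: (@measurable_fun_fubini_tonelli_F _ _ _ _ _ m2
       (fun p : T1 * T2 => `|(f p.1 p.2)%:E|%E)) => //.
    by apply: measurableT_comp => //; exact/measurable_EFinP.
  - apply/measurable_EFinP; apply: measurable_funM => //.
    by apply: measurableT_comp => //; exact: intble_meas gi.
  - move=> x _ /=.
    rewrite EFinM Rint_E; last exact: integrable_norm.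
    rewrite -integralZl//; last exact: integrable_norm.
    apply: ge0_le_integral => //.
    + by apply/measurable_EFinP; apply: measurableT_comp.
    + apply/measurable_EFinP; apply: measurable_funM => //.
      by apply: measurableT_comp => //; exact: intble_meas hi.
    + move=> y _; rewrite -EFinM lee_fin (le_trans (fgh x y))//.
      by rewrite -normrM ler_norm.
rewrite -Rint_E ?ltry//.
under eq_fun do rewrite mulrC.
by apply: intbleZ; exact: integrable_norm.
Qed.

Lemma tensor_intble_F : intble m1 (fun x => \int[m2]_y f x y).
Proof.
have := integrable_fubini_F tensor_intble.
apply: eq_integrable => // x _ /=.
by rewrite /fubini_F Rint_E//; exact: tensor_intble1.
Qed.

Lemma tensor_intble_G : intble m2 (fun y => \int[m1]_x f x y).
Proof.
have Fy : measurable_fun setT (fun y => \int[m1]_x f x y).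
  have := measurable_fubini_G tensor_intble.
  rewrite (_ : fubini_G _ _ = EFin \o (fun y => \int[m1]_x f x y)).
    by move=> /measurable_EFinP.
  by apply/funext => y; rewrite /fubini_G /= Rint_E//; exact: tensor_intble2.
apply: (@intble_dom _ _ _ _ _ (fun y => (\int[m1]_x g x) * h y)) => //; last exact: intbleZ.
move=> y; rewrite mulrC -Rint_Z//; apply: Rint_norm.
- exact: tensor_intble2.
- exact: intbleZ.
- by move=> x; rewrite mulrC.
Qed.

Lemma tensor_fubini :
  \int[m1]_x \int[m2]_y f x y = \int[m2]_y \int[m1]_x f x y.
Proof.
have := Fubini tensor_intble; rewrite /= => E.
apply: EFin_inj; rewrite !Rint_E; last 2 first.
- exact: tensor_intble_G.
- exact: tensor_intble_F.
transitivity (\int[m1]_x \int[m2]_y (f x y)%:E)%E.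
  by apply: eq_integral => x _; rewrite Rint_E//; exact: tensor_intble1.
rewrite E; apply: eq_integral => y _; rewrite Rint_E//; exact: tensor_intble2.
Qed.

Lemma tensor_prod :
  \int[(m1 \x m2)%E]_p f p.1 p.2 = \int[m1]_x \int[m2]_y f x y.
Proof.
apply: EFin_inj; rewrite !Rint_E; last 2 first.
- exact: tensor_intble_F.
- exact: tensor_intble.
rewrite -(integral12_prod_meas1 tensor_intble).
by apply: eq_integral => x _; rewrite /fubini_F Rint_E//; exact: tensor_intble1.
Qed.

End fubini_tensor.

(** * Change of variables *)

(** A change of variables known for nonnegative functions holds for
    integrable ones, by splitting into positive and negative parts. *)
Section transfer.
Context d1 d2 (T1 : measurableType d1) (T2 : measurableType d2) (R : realType).
Variables (m1 : {measure set T1 -> \bar R}) (m2 : {measure set T2 -> \bar R}).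
Variables (k : R) (phi : T1 -> T2).
Hypothesis k0 : 0 < k.
Hypothesis mphi : measurable_fun setT phi.
Hypothesis ge0_transfer : forall f : T2 -> \bar R,
  measurable_fun setT f -> (forall y, 0 <= f y)%E ->
  (\int[m2]_y f y = k%:E * \int[m1]_x f (phi x))%E.

Lemma intble_transfer (f : T2 -> R) : measurable_fun setT f ->
  intble m2 f <-> intble m1 (fun x => f (phi x)).
Proof.
move=> mf; have mf' := measurableT_comp mf mphi.
have E : (\int[m2]_y `|(f y)%:E| = k%:E * \int[m1]_x `|(f (phi x))%:E|)%E.
  rewrite (@ge0_transfer (fun v => `|(f v)%:E|%E))//.
  by apply: measurableT_comp => //; exact/measurable_EFinP.
split=> /integrableP[_ H]; apply/integrableP; split.
- exact/measurable_EFinP.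
- move: H; rewrite E => H; rewrite ltNge leye_eq; apply/negP => /eqP /= E'.
  by move: H; rewrite E' gt0_muley ?lte_fin// ltxx.
- exact/measurable_EFinP.
- by rewrite /= E lte_mul_pinfty// lee_fin ltW.
Qed.

Lemma Rint_transfer (f : T2 -> R) : intble m2 f ->
  \int[m2]_y f y = k * \int[m1]_x f (phi x).
Proof.
move=> fi; have mf := intble_meas fi; have fi' := (intble_transfer mf).1 fi.
apply: EFin_inj; rewrite EFinM !Rint_E// [in LHS]integralE [in RHS]integralE.
have mfE : measurable_fun setT (EFin \o f) by exact/measurable_EFinP.
rewrite ge0_transfer//; last exact: measurable_funepos.
rewrite [X in (_ - X)%E]ge0_transfer//; last exact: measurable_funeneg.
rewrite [RHS]muleBr; last 2 first.
- by [].
- by apply: fin_num_adde_defl; rewrite fin_numN; exact: integrable_neg_fin_num fi'.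
by congr (_ * _ - _ * _)%E; apply: eq_integral => v _; rewrite !(funeposE, funenegE).
Qed.

End transfer.

Section affine_line.
Variable R : realType.
Local Notation leb1 := (@lebesgue_measure R).
Local Open Scope ereal_scope.

Let affine (c b x : R) : measurableTypeR R := (c * x + b)%R.

Let measurable_affine c b : measurable_fun [set: R] (affine c b).
Proof. by apply: measurable_funD => //; exact: measurable_funM. Qed.

(** A measure on the line is determined by its values on half-open intervals. *)
Let lebesgue_measure_affine (c b : R) (c0 : (0 < c)%R) A : measurable A ->
  leb1 A = c%:E * pushforward leb1 (affine c b) A.
Proof.
move=> mA.
pose cn : {nonneg R} := NngNum (ltW c0).
have E := @lebesgue_measure_unique R (mscale cn (pushforward leb1 (affine c b))).
rewrite E//=; first exact: measurable_affine.
move=> mf _ [[a d]] _ <-; rewrite /mscale /=.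
rewrite (_ : pushforward leb1 (affine c b) _ =
  leb1 [set` `](((a - b) / c)%R), (((d - b) / c)%R)]]); last first.
  congr (leb1 _); apply/seteqP; split => x /=; rewrite !in_itv/= ltr_pdivrMr// ler_pdivlMr//;
  by rewrite ltrBlDr lerBrDr (mulrC x).
rewrite !lebesgue_measure_itv/= !lte_fin ltr_pM2r ?invr_gt0// ltrD2r.
case: ifP => _; last by rewrite mule0.
by rewrite -!EFinB -EFinM; congr (_%:E); field; rewrite gt_eqF.
Qed.

Let affine_pos (c b : R) (f : R -> \bar R) : (0 < c)%R ->
  measurable_fun [set: R] f -> (forall x, 0 <= f x) ->
  \int[leb1]_x f x = c%:E * \int[leb1]_x f (c * x + b)%R.
Proof.
move=> c0 mf f0; pose cn : {nonneg R} := NngNum (ltW c0).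
have mA := measurable_affine c b.
pose pm : {measure set _ -> \bar R} := pushforward leb1 (affine c b).
transitivity (\int[mscale cn (pm mA)]_x f x).
  by apply: eq_measure_integral => A mAA _; exact: (lebesgue_measure_affine b c0 mAA).
rewrite ge0_integral_mscale//; congr (_ * _).
by rewrite ge0_integral_pushforward.
Qed.

Lemma ge0_integral_affine (c b : R) (f : R -> \bar R) : c != 0%R ->
  measurable_fun [set: R] f -> (forall x, 0 <= f x) ->
  \int[leb1]_x f x = `|c|%:E * \int[leb1]_x f (c * x + b)%R.
Proof.
move=> c0 mf f0; have [cp|] := ltP 0%R c; first by rewrite gtr0_norm// -affine_pos.
rewrite le_eqVlt (negbTE c0)/= => cn.
rewrite ltr0_norm// (@affine_pos (- c) b f) ?oppr_gt0//; congr (_ * _).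
have mg : measurable_fun [set: R] (fun x => f (- c * x + b)%R).
  exact: (measurableT_comp mf (measurable_affine (- c) b)).
transitivity (\int[pushforward leb1 (-%R : _ -> measurableTypeR R)]_x f (- c * x + b)%R).
  by apply: eq_measure_integral => //= A mA _; exact/esym/lebesgue_measureN.
rewrite ge0_integral_pushforward//; apply: eq_integral => x _ /=.
by rewrite mulrNN.
Qed.

End affine_line.

Section integrals_on_rV.
Variable R : realType.
Local Notation leb := (@lebesgue_rV R).

Lemma ge0_integral_rV_cons n (f : 'rV[R]_n.+1 -> \bar R) :
  measurable_fun setT f -> (forall v, 0 <= f v)%E ->
  (\int[leb n.+1]_v f v =
   \int[@lebesgue_measure R]_x \int[leb n]_w f (rV_cons (x, w)))%E.
Proof.
move=> mf f0.
rewrite [LHS](@ge0_integral_pushforward _ _ _ _ _ _ (@measurable_rV_cons R n)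
  (lebesgue_measure \x leb n)%E setT f)//.
rewrite preimage_setT fubini_tonelli1//; last by move=> p; exact: f0.
exact: (measurableT_comp mf (@measurable_rV_cons R n)).
Qed.

Lemma integral_rV0 (f : 'rV[R]_0 -> \bar R) : measurable_fun setT f ->
  (\int[leb 0]_v f v = f 0%R)%E.
Proof. by move=> mf; rewrite integral_dirac// diracT mul1e. Qed.

Lemma rV_cons_affine n (c : R) (b : 'rV[R]_n.+1) (p : measurableTypeR R * 'rV[R]_n) :
  c *: rV_cons p + b = rV_cons (c * p.1 + (rV_uncons b).1, c *: p.2 + (rV_uncons b).2).
Proof.
apply/rowP => i; rewrite !mxE; case: splitP => j /= E; rewrite !mxE/=.
  by congr (_ + b ord0 _); apply: val_inj; rewrite /= E ord1.
by congr (_ + b ord0 _); apply: val_inj; rewrite /= E.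
Qed.

Lemma measurable_affine_rV n (c : R) (b : 'rV[R]_n) :
  measurable_fun setT (fun v : 'rV[R]_n => c *: v + b).
Proof.
apply: measurable_rVP => i; under eq_fun do rewrite !mxE.
apply: measurable_funD => //; apply: measurable_funM => //.
exact: measurable_coord.
Qed.

(** By induction on the dimension, splitting off the first coordinate. *)
Lemma ge0_integral_affine_rV n (c : R) (b : 'rV[R]_n) (f : 'rV[R]_n -> \bar R) :
  c != 0 -> measurable_fun setT f -> (forall v, 0 <= f v)%E ->
  (\int[leb n]_v f v = (`|c| ^+ n)%:E * \int[leb n]_v f (c *: v + b)%R)%E.
Proof.
move=> c0; elim: n b f => [|n IHn] b f mf f0.
  have f0E v : f v = f 0 by rewrite thinmx0.
  rewrite expr0 mul1e !integral_rV0 ?f0E//.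
  exact: (measurableT_comp mf (measurable_affine_rV c b)).
have mfa := measurableT_comp mf (measurable_affine_rV c b).
rewrite !ge0_integral_rV_cons//.
pose F x := (\int[leb n]_w f (rV_cons (x, w)))%E.
have mF : measurable_fun setT F.
  apply: (@measurable_fun_fubini_tonelli_F _ _ _ _ _ (leb n) (f \o @rV_cons R n)).
    exact: (measurableT_comp mf (@measurable_rV_cons R n)).
  by move=> p; exact: f0.
have F0 x : (0 <= F x)%E by apply: integral_ge0 => *; exact: f0.
rewrite (ge0_integral_affine (rV_uncons b).1 c0 mF F0) exprS EFinM -muleA; congr (_ * _)%E.
rewrite -ge0_integralZl//; last 2 first.
- apply: (@measurable_fun_fubini_tonelli_F _ _ _ _ _ (leb n)
      ((fun v => f (c *: v + b)) \o @rV_cons R n)).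
    exact: (measurableT_comp mfa (@measurable_rV_cons R n)).
  by move=> p; exact: f0.
- by move=> x _; apply: integral_ge0 => *; exact: f0.
apply: eq_integral => x _; rewrite /F.
rewrite (IHn (rV_uncons b).2)//; last first.
  exact: (measurableT_comp (measurableT_comp mf (@measurable_rV_cons R n)) (pair1_measurable _)).
by congr (_ * _)%E; apply: eq_integral => w _; rewrite rV_cons_affine.
Qed.

Lemma intble_affine_rV n (c : R) (b : 'rV[R]_n) (f : 'rV[R]_n -> R) :
  c != 0 -> intble (leb n) f -> intble (leb n) (fun v => f (c *: v + b)).
Proof.
move=> c0 fi; have k0 : 0 < `|c| ^+ n by rewrite exprn_gt0// normr_gt0.
have T := fun g mg g0 => @ge0_integral_affine_rV n c b g c0 mg g0.
have [H _] := intble_transfer (m1 := leb n) k0 (measurable_affine_rV c b) T (intble_meas fi).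
exact: H fi.
Qed.

Lemma Rint_affine_rV n (c : R) (b : 'rV[R]_n) (f : 'rV[R]_n -> R) :
  c != 0 -> intble (leb n) f ->
  \int[leb n]_v f v = `|c| ^+ n * \int[leb n]_v f (c *: v + b).
Proof.
move=> c0 fi; have k0 : 0 < `|c| ^+ n by rewrite exprn_gt0// normr_gt0.
have T := fun g mg g0 => @ge0_integral_affine_rV n c b g c0 mg g0.
exact: (Rint_transfer (m1 := leb n) k0 (measurable_affine_rV c b) T fi).
Qed.

Lemma Rint_odd n (f : 'rV[R]_n -> R) : intble (leb n) f -> (forall t, f (- t) = - f t) ->
  \int[leb n]_t f t = 0.
Proof.
move=> fi odd; have N1 : -1 != 0 :> R by rewrite oppr_eq0 oner_neq0.
set J := (LHS); suff : J = - J by move=> h; lra.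
rewrite {1}/J (Rint_affine_rV 0 N1 fi) normrN1 expr1n mul1r.
under eq_Rintegral do rewrite addr0 scaleN1r odd -mulN1r.
by rewrite Rint_Z// mulN1r.
Qed.

Lemma Rint_rV0 (f : 'rV[R]_0 -> R) : measurable_fun setT f ->
  intble (leb 0) f /\ \int[leb 0]_v f v = f 0.
Proof.
move=> mf; split; last by rewrite /Rintegral integral_rV0//; exact/measurable_EFinP.
apply/integrableP; split; first exact/measurable_EFinP.
rewrite integral_rV0 ?ltry//.
by apply: measurableT_comp => //; exact/measurable_EFinP.
Qed.

Lemma Rint_rV_cons n (f : 'rV[R]_n.+1 -> R) (g : R -> R) (h : 'rV[R]_n -> R) :
  measurable_fun setT f -> (forall x w, `|f (rV_cons (x, w))| <= g x * h w) ->
  intble (@lebesgue_measure R) g -> intble (leb n) h ->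
  intble (leb n.+1) f /\
  \int[leb n.+1]_v f v =
    \int[@lebesgue_measure R]_x \int[leb n]_w f (rV_cons (x, w)).
Proof.
move=> mf fgh gi hi.
have mfc : measurable_fun setT
    (fun p : measurableTypeR R * 'rV[R]_n => f (rV_cons (p.1, p.2))).
  rewrite (_ : (fun _ => _) = f \o @rV_cons R n); last by apply/funext => -[].
  exact: (measurableT_comp mf (@measurable_rV_cons R n)).
have T : forall g : 'rV[R]_n.+1 -> \bar R,
   measurable_fun setT g -> (forall y, 0 <= g y)%E ->
   (\int[leb n.+1]_y g y =
     1%:E * \int[(lebesgue_measure \x leb n)%E]_x g (rV_cons x))%E.
  move=> u mu u0; rewrite mul1e.
  by rewrite [LHS](@ge0_integral_pushforward _ _ _ _ _ _ (@measurable_rV_cons R n)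
    (lebesgue_measure \x leb n)%E setT u).
have fi : intble (lebesgue_measure \x leb n)%E (fun p => f (rV_cons p)).
  have := @tensor_intble _ _ _ _ R (@lebesgue_measure R) (leb n)
    (fun x w => f (rV_cons (x, w))) g h mfc fgh gi hi.
  by apply: eq_integrable => // -[].
split; first exact/(intble_transfer ltr01 (@measurable_rV_cons R n) T mf).
rewrite (Rint_transfer ltr01 (@measurable_rV_cons R n) T); last first.
  exact/(intble_transfer ltr01 (@measurable_rV_cons R n) T mf).
rewrite mul1r -(@tensor_prod _ _ _ _ R (@lebesgue_measure R) (leb n)
    (fun x w => f (rV_cons (x, w))) g h mfc fgh gi hi).
by apply: eq_Rintegral => -[].
Qed.

End integrals_on_rV.

(** * Measurability on R^n *)

Section measurability_rV.
Variable R : realType.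

Let box n (q : 'rV[rat]_n * nat) : set 'rV[R]_n :=
  [set v | forall i, `|v ord0 i - ratr (q.1 ord0 i)| < q.2.+1%:R^-1].

Let measurable_box n (q : 'rV[rat]_n * nat) : measurable (box q).
Proof.
rewrite (_ : box q = \bigcap_(i in [set: 'I_n])
  [set v : 'rV[R]_n | `|v ord0 i - ratr (q.1 ord0 i)| < q.2.+1%:R^-1]); last first.
  by apply/seteqP; split => v H i; [move=> _; exact: H|exact: (H i I)].
apply: fin_bigcap_measurable => // i _; rewrite -[X in measurable X]setTI.
apply: (@measurable_fun_ltr _ _ _ _ (fun v : 'rV[R]_n => `|v ord0 i - ratr (q.1 ord0 i)|)
  (fun=> q.2.+1%:R^-1)) => //.
apply: measurableT_comp => //; apply: measurable_funB => //.
exact: measurable_coord.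
Qed.

(** The sigma-algebra generated by the coordinates contains the open sets,
    because an open set is the union of the rational boxes that it contains. *)
Lemma open_measurable_rV n (A : set 'rV[R]_n) : open A -> measurable A.
Proof.
move=> oA.
rewrite (_ : A = \bigcup_(q in [set: 'rV[rat]_n * nat])
  (if `[< box q `<=` A >] then box q else set0)).
  apply: countable_bigcupT_measurable => [|q]; first exact: countableP.
  by case: ifP => _; [exact: measurable_box|exact: measurable0].
apply/seteqP; split => [v Av|v [q _]]; last by case: asboolP => // qA; exact: qA.
have /nbhs_ballP[e /= e0 eA] : nbhs v A by exact: open_nbhs_nbhs.
have [k ke] : exists k : nat, k.+1%:R^-1 < e / 2.
  have /ltr_add_invr[k] : 0 < e / 2 by rewrite divr_gt0.
  by rewrite add0r; exists k.
have k0 : 0 < k.+1%:R^-1 :> R by rewrite invr_gt0.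
pose d : R := k.+1%:R^-1; rewrite -/d in ke k0.
have /choice[q qv] : forall i, exists r : rat, `|v ord0 i - ratr r| < d.
  move=> i; have : v ord0 i - d < v ord0 i + d by lra.
  move=> /rat_in_itvoo[r]; rewrite in_itv/= => /andP[r1 r2]; exists r.
  by rewrite ltr_norml; apply/andP; split; lra.
exists (\row_i q i, k) => //; rewrite asboolT => [i|w /= bw]; first by rewrite mxE.
apply: eA; split => // i j; rewrite ord1 /ball/=.
have := bw j; have := qv j; rewrite -/d mxE !ltr_norml => /andP[? ?] /andP[? ?].
by apply/andP; split; lra.
Qed.

Lemma continuous_measurable_rV n (f : 'rV[R]_n -> R) :
  continuous f -> measurable_fun setT f.
Proof.
move=> cf; apply: (measurability _ (RGenOpens.measurableE R)).
move=> _ [_ [a [b ->]] <-]; rewrite setTI; apply: open_measurable_rV.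
by apply: open_comp => //; exact: interval_open.
Qed.

Lemma measurable_dotr n :
  measurable_fun setT (fun p : 'rV[R]_n * 'rV[R]_n => dotr p.1 p.2).
Proof.
apply: measurable_sum => i; apply: measurable_funM.
  exact: (measurableT_comp (@measurable_coord R n i) measurable_fst).
exact: (measurableT_comp (@measurable_coord R n i) measurable_snd).
Qed.

Lemma measurable_dotrr n (z : 'rV[R]_n) : measurable_fun setT (dotr z).
Proof. exact: (measurableT_comp (@measurable_dotr n) (pair1_measurable z)). Qed.

Lemma measurable_cos : measurable_fun setT (@cos R).
Proof. by apply: continuous_measurable_fun; exact: continuous_cos. Qed.

Lemma measurable_sin : measurable_fun setT (@sin R).
Proof. by apply: continuous_measurable_fun; exact: continuous_sin. Qed.

Lemma measurable_enorm n : measurable_fun setT (@enorm R n).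
Proof.
have ms : measurable_fun setT (@Num.sqrt R).
  by apply: continuous_measurable_fun; exact: sqrt_continuous.
apply: (measurableT_comp ms); apply: measurable_sum => i.
by apply: measurable_funM; exact: measurable_coord.
Qed.

Lemma measurable_eball n (r : R) : measurable (@eball R n r).
Proof.
rewrite -[X in measurable X]setTI.
by apply: (@measurable_fun_ltr _ _ _ _ (@enorm R n) (fun=> r)) => //; exact: measurable_enorm.
Qed.

End measurability_rV.

(** * The Euclidean inner product *)

(** A quadratic polynomial that is nonnegative everywhere has a nonpositive
    discriminant; every Cauchy-Schwarz inequality below comes from it. *)
Lemma discriminant_le (R : realFieldType) (a b c : R) : 0 <= c ->
  (forall t, 0 <= a + 2 * b * t + c * t ^+ 2) -> b ^+ 2 <= a * c.
Proof.
move=> c0 H; have [c00|cn0] := eqVneq c 0.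
  have [->|bn0] := eqVneq b 0; first by rewrite c00 mulr0 expr0n.
  have := H (- (a + 1) / (2 * b)); rewrite c00 mul0r addr0.
  rewrite mulrCA divff ?mulf_neq0// mulr1; lra.
have cp : 0 < c by rewrite lt_def cn0.
have := mulr_ge0 c0 (H (- b / c)).
suff -> : c * (a + 2 * b * (- b / c) + c * (- b / c) ^+ 2) = a * c - b ^+ 2 by rewrite subr_ge0.
by field.
Qed.

Section euclidean_theory.
Variables (R : realType) (n : nat).
Implicit Types (u v w : 'rV[R]_n) (c : R).

Lemma dotrC u v : dotr u v = dotr v u.
Proof. by apply: eq_bigr => i _; rewrite mulrC. Qed.

Lemma dotrDl u v w : dotr (u + v) w = dotr u w + dotr v w.
Proof. by rewrite -big_split; apply: eq_bigr => i _ /=; rewrite mxE mulrDl. Qed.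

Lemma dotrZl c u v : dotr (c *: u) v = c * dotr u v.
Proof. by rewrite mulr_sumr; apply: eq_bigr => i _; rewrite mxE mulrA. Qed.

Lemma dotrNl u v : dotr (- u) v = - dotr u v.
Proof. by rewrite -scaleN1r dotrZl mulN1r. Qed.

Lemma dotrBl u v w : dotr (u - v) w = dotr u w - dotr v w.
Proof. by rewrite dotrDl dotrNl. Qed.

Lemma dotrDr u v w : dotr w (u + v) = dotr w u + dotr w v.
Proof. by rewrite dotrC dotrDl !(dotrC w). Qed.

Lemma dotrZr c u v : dotr u (c *: v) = c * dotr u v.
Proof. by rewrite dotrC dotrZl dotrC. Qed.

Lemma dotrNr u v : dotr u (- v) = - dotr u v.
Proof. by rewrite dotrC dotrNl dotrC. Qed.

Lemma dotr0 u : dotr u 0 = 0.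
Proof. by rewrite -(scale0r 0) dotrZr mul0r. Qed.

Lemma dotr_ge0 u : 0 <= dotr u u.
Proof. by apply: sumr_ge0 => i _; rewrite -expr2 sqr_ge0. Qed.

Lemma dotr_CS u v : dotr u v ^+ 2 <= dotr u u * dotr v v.
Proof.
apply: discriminant_le; first exact: dotr_ge0.
move=> t; have := dotr_ge0 (u + t *: v).
by rewrite dotrDl !dotrDr !dotrZl !dotrZr (dotrC v u); nra.
Qed.

Lemma sqr_enorm u : enorm u ^+ 2 = dotr u u.
Proof. by rewrite sqr_sqrtr// dotr_ge0. Qed.

Lemma enorm_ge0 u : 0 <= enorm u.
Proof. exact: sqrtr_ge0. Qed.

Lemma dotr_le u v : `|dotr u v| <= enorm u * enorm v.
Proof.
rewrite -ler_sqr ?nnegrE ?mulr_ge0 ?enorm_ge0//.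
by rewrite exprMn !sqr_enorm real_normK ?num_real// dotr_CS.
Qed.

Lemma enormD u v : enorm (u + v) <= enorm u + enorm v.
Proof.
rewrite -ler_sqr ?nnegrE ?addr_ge0 ?enorm_ge0//.
rewrite sqr_enorm dotrDl !dotrDr (dotrC v u) sqrrD !sqr_enorm.
by have := dotr_le u v; rewrite ler_norml => /andP[_]; rewrite mulr2n; lra.
Qed.

Lemma enormZ c u : enorm (c *: u) = `|c| * enorm u.
Proof.
by rewrite /enorm dotrZl dotrZr mulrA -expr2 sqrtrM ?sqr_ge0// sqrtr_sqr.
Qed.

Lemma enormN u : enorm (- u) = enorm u.
Proof. by rewrite -scaleN1r enormZ normrN1 mul1r. Qed.

Lemma enormB u v : enorm (u - v) <= enorm u + enorm v.
Proof. by rewrite (le_trans (enormD _ _))// enormN. Qed.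

Lemma enorm0 : enorm (0 : 'rV[R]_n) = 0.
Proof. by rewrite /enorm dotr0 sqrtr0. Qed.

Lemma coord_le_enorm u i : `|u ord0 i| <= enorm u.
Proof.
rewrite -ler_sqr ?nnegrE ?enorm_ge0// sqr_enorm real_normK ?num_real//.
rewrite /dotr (bigD1 i)//= -expr2 lerDl.
by apply: sumr_ge0 => j _; rewrite -expr2 sqr_ge0.
Qed.

Lemma indic_eballN (r : R) u : \1_(eball r) (- u) = \1_(eball r) u :> R.
Proof.
rewrite !indicE; congr (nat_of_bool _)%:R.
by apply/idP/idP => /set_mem H; apply/mem_set; move: H; rewrite /eball/= enormN.
Qed.

End euclidean_theory.

Lemma intble_Mcos d (T : measurableType d) (R : realType)
    (m : {measure set T -> \bar R}) (f g : T -> R) :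
  intble m f -> measurable_fun setT g -> intble m (fun x => f x * cos (g x)).
Proof.
move=> fi mg; apply: (intble_dom _ _ (integrable_norm fi)).
  apply: measurable_funM; first exact: intble_meas fi.
  exact: (measurableT_comp (@measurable_cos R)).
by move=> x /=; rewrite normrM ler_piMr ?cos_max.
Qed.

(** * Products of functions of one variable *)

Section product_functions.
Variable R : realType.
Local Notation leb1 := (@lebesgue_measure R).
Local Notation leb := (@lebesgue_rV R).
Implicit Types phi kappa : R -> R.

Definition prodf phi n (v : 'rV[R]_n) : R := \prod_i phi (v ord0 i).

Lemma prodf_cons phi n x (w : 'rV[R]_n) :
  prodf phi (rV_cons (x, w)) = phi x * prodf phi w.
Proof.
rewrite /prodf big_ord_recl rV_cons0; congr (_ * _).
by apply: eq_bigr => i _; rewrite rV_consS.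
Qed.

Lemma dotr_cons n (z : 'rV[R]_n.+1) x (w : 'rV[R]_n) :
  dotr z (rV_cons (x, w)) = (rV_uncons z).1 * x + dotr (rV_uncons z).2 w.
Proof.
rewrite /dotr big_ord_recl rV_cons0; congr (_ + _).
by apply: eq_bigr => i _; rewrite rV_consS mxE.
Qed.

Lemma measurable_prodf phi n : measurable_fun setT phi ->
  measurable_fun setT (@prodf phi n).
Proof.
move=> mphi; apply: measurable_prod => i _.
exact: (measurableT_comp mphi (@measurable_coord R n i)).
Qed.

Lemma Rint_prodf phi n : intble leb1 phi ->
  intble (leb n) (@prodf phi n) /\
  \int[leb n]_v prodf phi v = (\int[leb1]_x phi x) ^+ n.
Proof.
move=> phii; have mphi := intble_meas phii.
elim: n => [|n [IHi IHJ]].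
  have [H1 H2] := Rint_rV0 (@measurable_prodf phi 0 mphi); split => //.
  by rewrite H2 /prodf big_ord0.
have [] := @Rint_rV_cons R n (@prodf phi n.+1) (fun x => `|phi x|) (fun w => `|prodf phi w|).
- exact: measurable_prodf.
- by move=> x w; rewrite prodf_cons normrM.
- exact: integrable_norm.
- exact: integrable_norm.
move=> H1 ->; split => //; rewrite exprSr -IHJ -Rint_Z//.
by apply: eq_Rintegral => x _; under eq_Rintegral do rewrite prodf_cons; rewrite Rint_Z// mulrC.
Qed.

(** The phase makes the induction on the dimension work: integrating over all the
    coordinates but the first leaves a cosine of the first one with a new phase. *)
Lemma Rint_prodf_cos phi kappa : intble leb1 phi ->
  (forall z theta, \int[leb1]_t (phi t * cos (z * t + theta)) = kappa z * cos theta) ->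
  forall n (z : 'rV[R]_n) theta,
  \int[leb n]_t (prodf phi t * cos (dotr z t + theta)) = prodf kappa z * cos theta.
Proof.
move=> phii Hk; have mphi := intble_meas phii.
have mc n (z : 'rV[R]_n) theta :
    measurable_fun setT (fun t => prodf phi t * cos (dotr z t + theta)).
  apply: measurable_funM; first exact: measurable_prodf.
  apply: (measurableT_comp (@measurable_cos R)).
  by apply: measurable_funD => //; exact: measurable_dotrr.
elim=> [|n IHn] z theta.
  have [_ ->] := Rint_rV0 (mc 0 z theta).
  by rewrite dotr0 add0r /prodf !big_ord0.
have [pi _] := Rint_prodf n phii.
have [] := @Rint_rV_cons R n (fun t => prodf phi t * cos (dotr z t + theta))
  (fun x => `|phi x|) (fun w => `|prodf phi w|).
- exact: mc.
- move=> x w; rewrite prodf_cons normrM normrM ler_piMr// ?cos_max//.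
- exact: integrable_norm.
- exact: integrable_norm.
move=> _ ->; set z0 := (rV_uncons z).1; set z' := (rV_uncons z).2.
transitivity (\int[leb1]_x (prodf kappa z' * (phi x * cos (z0 * x + theta)))).
  apply: eq_Rintegral => x _.
  under eq_Rintegral => w _.
    rewrite prodf_cons dotr_cons -/z0 -/z' -mulrA (addrC (z0 * x)) -addrA.
    over.
  rewrite Rint_Z ?IHn; first by rewrite mulrCA.
  apply: intble_Mcos => //.
  by apply: measurable_funD => //; exact: measurable_dotrr.
rewrite Rint_Z ?Hk; last first.
  apply: (intble_Mcos (m := leb1)) => //.
  by apply: measurable_funD => //; exact: measurable_funM.
rewrite mulrA; congr (_ * _).
by rewrite /prodf [RHS]big_ord_recl mulrC; congr (_ * _); apply: eq_bigr => i _; rewrite mxE.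
Qed.

(** A ball is contained in a cube, whose indicator is a product. *)
Lemma intble_eball n r : intble (leb n) (\1_(eball r)).
Proof.
have i1 : intble leb1 (\1_(`[- r, r]) : R -> R).
  exact: integrable_indic_itv.
have [i2 _] := Rint_prodf n i1.
apply: (intble_dom _ _ i2); first by apply: measurable_indic; exact: measurable_eball.
move=> v; rewrite !indicE; case: (boolP (v \in eball r)) => vr; last first.
  by rewrite normr0; apply: prodr_ge0.
rewrite normr1 /prodf big1// => i _; rewrite indicE mem_set//=.
move: vr; rewrite inE /eball/= => vr; rewrite in_itv/=.
by have := le_lt_trans (coord_le_enorm v i) vr; rewrite ltr_norml => /andP[/ltW-> /ltW].
Qed.

End product_functions.

(** * Integrals depending on a parameter *)

(** Adding the dominating function makes the integrand nonnegative, and Tonelli's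
    theorem gives the measurability of its integral. *)
Lemma measurable_param d1 d2 (T1 : measurableType d1) (T2 : measurableType d2)
    (R : realType) (m : {sigma_finite_measure set T2 -> \bar R})
    (f : T1 -> T2 -> R) (g : T2 -> R) :
  measurable_fun setT (fun p : T1 * T2 => f p.1 p.2) ->
  (forall x y, `|f x y| <= g y) -> intble m g ->
  measurable_fun setT (fun x => \int[m]_y f x y).
Proof.
move=> mf fg gi.
have mfx x : measurable_fun setT (f x).
  exact: (measurableT_comp mf (pair1_measurable x)).
have fi x : intble m (f x) by exact: (intble_dom (mfx x) (fg x)).
have mg : measurable_fun setT (fun p : T1 * T2 => g p.2).
  exact: (measurableT_comp (intble_meas gi) measurable_snd).
have mh : measurable_fun setT (fun p : T1 * T2 => (f p.1 p.2 + g p.2)%:E).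
  by apply/measurable_EFinP; exact: measurable_funD.
have h0 (p : T1 * T2) : (0 <= (f p.1 p.2 + g p.2)%:E)%E.
  rewrite lee_fin; have := fg p.1 p.2; rewrite ler_norml => /andP[]; lra.
have := measurable_fun_fubini_tonelli_F (m2 := m) _ mh h0.
rewrite (_ : fubini_F _ _ = EFin \o (fun x => \int[m]_y f x y + \int[m]_y g y)).
  move=> /measurable_EFinP H.
  rewrite (_ : (fun x => _) = (fun x => (\int[m]_y f x y + \int[m]_y g y) - \int[m]_y g y)).
    by apply: measurable_funB.
  by apply/funext => x; rewrite addrK.
by apply/funext => x; rewrite /fubini_F /= -Rint_D// Rint_E//; exact: intbleD.
Qed.

(** * The cardinal sine *)

Section cardinal_sine.
Variable R : realType.
Local Notation leb1 := (@lebesgue_measure R).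

(** Since cos decreases on [0, 1], its value at 1 is a positive constant for the
    crude lower bounds that are needed. *)
Lemma sin_ge (y : R) : 0 <= y <= 1 -> y * cos 1 <= sin y.
Proof.
move=> /andP[]; rewrite le_eqVlt => /predU1P[<-|y0 y1]; first by rewrite mul0r sin0.
have [|c] := @MVT R (@sin R) (@cos R) 0 y y0 (fun x _ => is_derive_sin x).
  by apply: continuous_subspaceT => x; exact: continuous_sin.
rewrite in_itv/= => /andP[c0 cy]; rewrite sin0 !subr0 => ->.
rewrite mulrC ler_pM2r//; apply/ltW; rewrite ltr_cos ?in_itv/=; first by lra.
- by apply/andP; split; have := @pi_ge2 R; lra.
- by apply/andP; split; have := @pi_ge2 R; lra.
Qed.

Lemma cos_ge (y : R) : `|y| <= 1 -> cos 1 <= cos y.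
Proof.
rewrite -(cos_norm y); move: (normr_ge0 y); move: `|y| => a a0.
rewrite le_eqVlt => /predU1P[->//|a1].
have p2 := @pi_ge2 R.
by apply/ltW; rewrite ltr_cos// in_itv/=; apply/andP; split; lra.
Qed.

Definition unit_box : R -> R := \1_`[- (2^-1), 2^-1]%classic.

Lemma unit_box_ge0 t : 0 <= unit_box t. Proof. by rewrite /unit_box indicE ler0n. Qed.

Lemma intble_unit_box : intble leb1 unit_box.
Proof. exact: integrable_indic_itv. Qed.

(** The Fourier transform of the indicator of an interval of length 1. *)
Definition sinc (z : R) : R := if z == 0 then 1 else 2 * sin (z / 2) / z.

Lemma Rint_itv_cos (a b z theta : R) : a < b -> z != 0 ->
  \int[leb1]_(t in `[a, b]) cos (z * t + theta) =
  (sin (z * b + theta) - sin (z * a + theta)) / z.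
Proof.
move=> ab z0; have dF (x : R) :
    is_derive x 1 (fun t => z^-1 * sin (z * t + theta)) (cos (z * x + theta)).
  by apply: is_derive_eq; rewrite /GRing.scale/=; field.
rewrite /Rintegral (@continuous_FTC2 _ _ (fun t => z^-1 * sin (z * t + theta)))//.
- by rewrite /=; field.
- apply: continuous_subspaceT => x; apply: continuous_comp; last exact: continuous_cos.
  by apply: cvgD; [apply: cvgM => //; exact: cvg_cst|exact: cvg_cst].
- have cF x : {for x, continuous (fun t => z^-1 * sin (z * t + theta))}.
    by apply: differentiable_continuous; apply/derivable1_diffP; exact: ex_derive.
  split => [x _||]; first exact: ex_derive.
    by apply: cvg_at_right_filter; exact: cF.
  by apply: cvg_at_left_filter; exact: cF.
- by move=> x _; rewrite derive1E; exact: derive_val.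
Qed.

Lemma Rint_unit_box_cos (z theta : R) :
  \int[leb1]_t (unit_box t * cos (z * t + theta)) = sinc z * cos theta.
Proof.
transitivity (\int[leb1]_(t in `[- 2^-1, 2^-1]) cos (z * t + theta)).
  rewrite [RHS]Rintegral_mkcond; apply: eq_Rintegral => t _.
  by rewrite /unit_box indicE patchE; case: ifP => _; rewrite ?mul1r ?mul0r.
rewrite /sinc; case: eqVneq => [->|z0].
  under eq_Rintegral do rewrite mul0r add0r.
  rewrite [LHS](@Rintegral_cst _ _ _ leb1 `[- 2^-1, 2^-1]%classic)//.
  rewrite mulrC; congr (_ * _).
  have := @lebesgue_measure_itv R `[- 2^-1, 2^-1]; rewrite /= lte_fin ifT; last by lra.
  by move=> ->; rewrite /= opprK; lra.
rewrite Rint_itv_cos//; last by lra.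
rewrite mulrN [X in _ - sin X]addrC sinB sinD; field.
exact: z0.
Qed.

Lemma Rint_unit_box : \int[leb1]_t unit_box t = 1.
Proof.
have := Rint_unit_box_cos 0 0; rewrite cos0 mulr1 /sinc eqxx => <-.
by apply: eq_Rintegral => t _; rewrite mul0r addr0 cos0 mulr1.
Qed.

Lemma measurable_sinc : measurable_fun setT sinc.
Proof.
rewrite (_ : sinc = (fun z => \int[leb1]_t (unit_box t * cos (z * t + 0)))); last first.
  by apply/funext => z; rewrite Rint_unit_box_cos cos0 mulr1.
apply: (@measurable_param _ _ _ _ R leb1 _ unit_box); last exact: intble_unit_box.
- apply: measurable_funM.
    exact: (measurableT_comp (intble_meas intble_unit_box) measurable_snd).
  apply: (measurableT_comp (@measurable_cos R)).
  by apply: measurable_funD => //; apply: measurable_funM;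
    [exact: measurable_fst|exact: measurable_snd].
- by move=> z t; rewrite normrM (ger0_norm (unit_box_ge0 t)) ler_piMr ?unit_box_ge0 ?cos_max.
Qed.

(** A majorant whose primitive, an arctangent, is bounded. *)
Lemma sqr_sinc_le (z : R) : sinc z ^+ 2 <= 8 * (1 + z ^+ 2)^-1.
Proof.
have s1 : sinc z ^+ 2 <= 1.
  have : `|sinc z| <= 1.
    have /= -> : sinc z = \int[leb1]_t (unit_box t * cos (z * t + 0)).
      by rewrite Rint_unit_box_cos cos0 mulr1.
    rewrite -[leRHS]Rint_unit_box; apply: (Rint_norm (m := leb1)).
    - apply: (intble_Mcos (m := leb1)); first exact: intble_unit_box.
      by apply: measurable_funD => //; exact: measurable_funM.
    - exact: intble_unit_box.
    - by move=> t; rewrite normrM (ger0_norm (unit_box_ge0 t)) ler_piMr ?unit_box_ge0 ?cos_max.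
  by move=> H; rewrite -real_normK ?num_real// expr_le1.
rewrite ler_pdivlMr; last by have := sqr_ge0 z; lra.
rewrite mulrDr mulr1.
suff : sinc z ^+ 2 * z ^+ 2 <= 4 by lra.
rewrite -exprMn /sinc; case: eqVneq => [->|z0]; first by rewrite mulr0 expr0n/=; lra.
rewrite divfK// exprMn.
have : sin (z / 2) ^+ 2 <= 1 by rewrite sin2cos2; have := sqr_ge0 (cos (z / 2)); lra.
lra.
Qed.

Lemma intble_oneDsqrV : intble leb1 (fun z : R => (1 + z ^+ 2)^-1).
Proof.
apply/integrableP; split.
  apply/measurable_EFinP; apply: continuous_measurable_fun; exact: continuous_oneDsqrV.
under eq_integral do rewrite gee0_abs ?lee_fin ?invr_ge0 ?addr_ge0 ?sqr_ge0//.
rewrite ge0_symfun_integralT.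
- rewrite -set_itvcy integral0y_oneDsqr -EFinM; exact: ltry.
- by move=> x; rewrite invr_ge0 addr_ge0 ?sqr_ge0.
- exact: continuous_oneDsqrV.
- by move=> x /=; rewrite sqrrN.
Qed.

Lemma intble_sqr_sinc : intble leb1 (fun z => sinc z ^+ 2).
Proof.
apply: (@intble_dom _ _ _ leb1 (fun z => sinc z ^+ 2) (fun z : R => 8 * (1 + z ^+ 2)^-1)).
- by apply: measurable_funX; exact: measurable_sinc.
- by move=> z; rewrite ger0_norm ?sqr_ge0// sqr_sinc_le.
- exact: (intbleZ (m := leb1) 8 intble_oneDsqrV).
Qed.

Let sinc_ge (z : R) : 0 < z <= 1 -> cos 1 <= sinc z.
Proof.
move=> /andP[z0 z1]; rewrite /sinc gt_eqF// ler_pdivlMr//.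
have : z / 2 * cos 1 <= sin (z / 2) by apply: sin_ge; apply/andP; split; lra.
lra.
Qed.

Lemma Rint_sqr_sinc_gt0 : 0 < \int[leb1]_z (sinc z ^+ 2).
Proof.
have c1 := @cos1_gt0 R.
apply: (@lt_le_trans _ _ (\int[leb1]_z (cos 1 ^+ 2 * \1_(`]0, 1]) z : R))).
  rewrite (Rint_Z (m := leb1)); last exact: integrable_indic_itv.
  rewrite mulr_gt0 ?exprn_gt0//.
  suff -> : \int[leb1]_x (\1_(`]0, 1]) x : R) = 1 by [].
  apply: EFin_inj; rewrite (Rint_E (m := leb1)); last exact: integrable_indic_itv.
  transitivity (leb1 `]0, 1]); first by rewrite integral_indic// setIT.
  by rewrite lebesgue_measure_itv/= lte_fin ltr01 oppr0 adde0.
apply: (Rint_le (m := leb1)).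
- by apply: (intbleZ (m := leb1)); exact: integrable_indic_itv.
- exact: intble_sqr_sinc.
move=> z; rewrite indicE; case: (boolP (z \in _)) => [|_]; last by rewrite mulr0 sqr_ge0.
rewrite inE/= in_itv/= => zP; rewrite mulr1.
by rewrite ler_sqr ?nnegrE ?sinc_ge// ?(le_trans (ltW c1)) ?sinc_ge// ltW.
Qed.

End cardinal_sine.

(** * Autocorrelations and their Fourier transforms *)

Section autocorrelation.
Variables (R : realType) (n : nat).
Local Notation V := 'rV[R]_n.
Local Notation leb := (@lebesgue_rV R n).
Implicit Types (H : V -> R) (t u v w xi : V) (theta r M : R).

(** The bound by a multiple of an indicator is the form in which dominated
    convergence and Fubini's theorem use a bounded support. *)
Definition compsupp H := measurable_fun setT H /\
  exists M r, 0 <= M /\ forall xi, `|H xi| <= M * \1_(eball r) xi.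

Lemma intble_compsupp H : compsupp H -> intble leb H.
Proof.
move=> [mH [M [r [M0 HM]]]]; apply: (intble_dom mH HM).
by apply: intbleZ; exact: intble_eball.
Qed.

Definition autocorr H w : R := \int[leb]_xi (H xi * H (xi + w)).

Lemma autocorr0 H : autocorr H 0 = \int[leb]_xi (H xi ^+ 2).
Proof. by apply: eq_Rintegral => xi _; rewrite addr0 expr2. Qed.

Definition fcos H t : R := \int[leb]_xi (H xi * cos (dotr t xi)).

Definition fsin H t : R := \int[leb]_xi (H xi * sin (dotr t xi)).

(** The square of the modulus of the Fourier transform. *)
Definition power H t : R := fcos H t ^+ 2 + fsin H t ^+ 2.

Lemma power_ge0 H t : 0 <= power H t.
Proof. by rewrite addr_ge0 ?sqr_ge0. Qed.

Lemma intble_Msin (H g : V -> R) :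
  intble leb H -> measurable_fun setT g -> intble leb (fun x => H x * sin (g x)).
Proof.
move=> fi mg; apply: (intble_dom _ _ (integrable_norm fi)).
  apply: measurable_funM; first exact: intble_meas fi.
  exact: (measurableT_comp (@measurable_sin R)).
by move=> x /=; rewrite normrM ler_piMr ?sin_max.
Qed.

Lemma Rint_cos_phase H t theta : intble leb H ->
  \int[leb]_xi (H xi * cos (dotr t xi + theta)) =
  cos theta * fcos H t - sin theta * fsin H t.
Proof.
move=> Hi.
have ic : intble leb (fun xi => H xi * cos (dotr t xi)).
  by apply: intble_Mcos => //; exact: measurable_dotrr.
have is_ : intble leb (fun xi => H xi * sin (dotr t xi)).
  by apply: intble_Msin => //; exact: measurable_dotrr.
rewrite -!Rint_Z// -Rint_B; last 2 first.
- exact: intbleZ.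
- exact: intbleZ.
by apply: eq_Rintegral => xi _; rewrite cosD; ring.
Qed.

Let measurable_add : measurable_fun setT (fun p : V * V => p.1 + p.2).
Proof.
apply: measurable_rVP => i; under eq_fun do rewrite mxE.
apply: measurable_funD.
  exact: (measurableT_comp (@measurable_coord R n i) measurable_fst).
exact: (measurableT_comp (@measurable_coord R n i) measurable_snd).
Qed.

Section fixed.
Variable H : V -> R.
Hypothesis cH : compsupp H.

Let mH : measurable_fun setT H. Proof. exact: cH.1. Qed.

Let autocorr_dom : exists M r, 0 <= M /\
  (forall xi, `|H xi| <= M * \1_(eball r) xi) /\
  forall xi w, `|H xi * H (xi + w)| <= (M * \1_(eball r) xi) * (M * \1_(eball (r + r)) w).
Proof.
have [M [r [M0 HM]]] := cH.2; exists M, r; split => //; split => // xi w.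
rewrite normrM.
have := HM xi; have := HM (xi + w); rewrite !indicE.
case: (boolP (xi \in eball r)) => xr; last first.
  by rewrite mulr0 normr_le0 => _ /eqP->; rewrite normr0 !mul0r.
case: (boolP (xi + w \in eball r)) => xwr; last first.
  by rewrite mulr0 normr_le0 => /eqP-> _; rewrite normr0 mulr0 !mulr_ge0.
rewrite mem_set => [|/=]; first by rewrite !mulr1 => *; exact: ler_pM.
move: xr xwr; rewrite !inE /eball/= => x1 x2.
have -> : w = (xi + w) - xi by rewrite addrC addKr.
by rewrite (le_lt_trans (enormB _ _))// ltrD.
Qed.

Let measurable_joint t theta : measurable_fun setT
  (fun p : V * V => H p.1 * H (p.1 + p.2) * cos (dotr t p.2 + theta)).
Proof.
apply: measurable_funM; first apply: measurable_funM.
- exact: (measurableT_comp mH measurable_fst).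
- exact: (measurableT_comp mH measurable_add).
apply: (measurableT_comp (@measurable_cos R)); apply: measurable_funD => //.
exact: (measurableT_comp (measurable_dotrr t) measurable_snd).
Qed.

Lemma compsupp_shift_intble w : intble leb (fun xi => H xi * H (xi + w)).
Proof.
have [M [r [M0 [HM HHM]]]] := autocorr_dom.
apply: (intble_dom _ (fun xi => HHM xi w)).
  apply: measurable_funM => //.
  exact: (measurableT_comp mH (measurableT_comp measurable_add (pair2_measurable w))).
under eq_fun do rewrite mulrC.
by apply: intbleZ; apply: intbleZ; exact: intble_eball.
Qed.

Lemma compsupp_autocorr : compsupp (autocorr H).
Proof.
have [M [r [M0 [HM HHM]]]] := autocorr_dom; split.
  apply: (@measurable_param _ _ _ _ R leb (fun w xi => H xi * H (xi + w))
    (fun xi => M * \1_(eball r) xi * M)).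
  - apply: measurable_funM; first exact: (measurableT_comp mH measurable_snd).
    under eq_fun do rewrite addrC.
    exact: (measurableT_comp mH measurable_add).
  - move=> w xi; apply: (le_trans (HHM xi w)).
    rewrite ler_wpM2l ?mulr_ge0 ?indicE ?ler0n//.
    by rewrite ler_piMr// lern1 leq_b1.
  - under eq_fun do rewrite mulrC.
    by apply: intbleZ; apply: intbleZ; exact: intble_eball.
have i1 := @intble_eball R n r.
exists (M * M * \int[leb]_xi \1_(eball r) xi), (r + r); split.
  by rewrite !mulr_ge0// Rintegral_ge0// => xi _; rewrite indicE ler0n.
move=> w; rewrite mulrAC -Rint_Z//; apply: Rint_norm.
- exact: compsupp_shift_intble.
- exact: intbleZ.
move=> xi; apply: (le_trans (HHM xi w)); rewrite le_eqVlt; apply/orP; left.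
by apply/eqP; ring.
Qed.

(** The Fourier transform of an autocorrelation is the squared modulus of the
    Fourier transform, by the substitution eta = xi + w. *)
Lemma autocorr_power t theta :
  \int[leb]_w (autocorr H w * cos (dotr t w + theta)) = power H t * cos theta.
Proof.
have [M [r [M0 [HM HHM]]]] := autocorr_dom.
have Hi := intble_compsupp cH.
have dom xi w : `|H xi * H (xi + w) * cos (dotr t w + theta)| <=
    (M * \1_(eball r) xi) * (M * \1_(eball (r + r)) w).
  by rewrite normrM (le_trans _ (HHM xi w))// ler_piMr ?cos_max.
have ig : intble leb (fun xi => M * \1_(eball r) xi) by apply: intbleZ; exact: intble_eball.
have ih : intble leb (fun xi => M * \1_(eball (r + r)) xi).
  by apply: intbleZ; exact: intble_eball.
transitivity (\int[leb]_w \int[leb]_xi (H xi * H (xi + w) * cos (dotr t w + theta))).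
  apply: eq_Rintegral => w _; rewrite mulrC -Rint_Z; last exact: compsupp_shift_intble.
  by apply: eq_Rintegral => xi _; rewrite mulrC.
rewrite -(tensor_fubini (measurable_joint t theta) dom ig ih).
transitivity (\int[leb]_xi (H xi *
    (cos (theta - dotr t xi) * fcos H t - sin (theta - dotr t xi) * fsin H t))).
  apply: eq_Rintegral => xi _.
  rewrite -Rint_cos_phase//.
  have i1 : intble leb (fun eta => H eta * cos (dotr t eta + (theta - dotr t xi))).
    by apply: intble_Mcos => //; apply: measurable_funD => //; exact: measurable_dotrr.
  rewrite (Rint_affine_rV xi (oner_neq0 _) i1) normr1 expr1n mul1r.
  rewrite -Rint_Z; last exact: (intble_affine_rV xi (oner_neq0 _) i1).
  apply: eq_Rintegral => w _; rewrite scale1r (addrC w) dotrDr mulrA.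
  by congr (_ * cos _); rewrite addrC; ring.
transitivity (\int[leb]_xi (
    (cos theta * fcos H t - sin theta * fsin H t) * (H xi * cos (dotr t xi)) +
    (sin theta * fcos H t + cos theta * fsin H t) * (H xi * sin (dotr t xi)))).
  by apply: eq_Rintegral => xi _; rewrite cosB sinB; ring.
have ic : intble leb (fun xi => H xi * cos (dotr t xi)).
  by apply: intble_Mcos => //; exact: measurable_dotrr.
have is_ : intble leb (fun xi => H xi * sin (dotr t xi)).
  by apply: intble_Msin => //; exact: measurable_dotrr.
rewrite Rint_D; last 2 first.
- exact: intbleZ.
- exact: intbleZ.
rewrite !Rint_Z// -/(fcos H t) -/(fsin H t) /power; ring.
Qed.

Lemma autocorr_cvg (w_ : nat -> V) w : continuous H -> w_ @ \oo --> w ->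
  autocorr H \o w_ @ \oo --> autocorr H w.
Proof.
move=> contH cw.
have [M [r [M0 HM]]] := cH.2.
have HM' xi : `|H xi| <= M.
  by rewrite (le_trans (HM xi))// ler_piMr// indicE lern1 leq_b1.
have [] := @Rint_cvg _ _ R leb (fun k xi => H xi * H (xi + w_ k))
  (fun xi => H xi * H (xi + w)) (fun xi => M * \1_(eball r) xi * M) => //.
- by move=> k; exact: intble_meas (compsupp_shift_intble (w_ k)).
- move=> xi; apply: cvgM; first exact: cvg_cst.
  by apply: (continuous_cvg _ (contH _)); apply: cvgD => //; exact: cvg_cst.
- under eq_fun do rewrite mulrC.
  by apply: intbleZ; apply: intbleZ; exact: intble_eball.
- by move=> k xi; rewrite normrM ler_pM.
Qed.

End fixed.
End autocorrelation.

(** * A summability kernel *)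

Section kernel.
Variables (R : realType) (n : nat).
Local Notation V := 'rV[R]_n.
Local Notation leb1 := (@lebesgue_measure R).
Local Notation leb := (@lebesgue_rV R n).
Implicit Types (H : V -> R) (t u v w omega xi : V) (theta r M e : R).

(** The indicator of the unit cube. *)
Let Q : V -> R := @prodf R (@unit_box R) n.

Let Q_ge0 xi : 0 <= Q xi. Proof. by apply: prodr_ge0 => i _; exact: unit_box_ge0. Qed.

Let Q_le1 xi : Q xi <= 1.
Proof.
suff : 0 <= Q xi <= 1 by case/andP.
rewrite /Q /prodf; elim/big_ind : _ => [|x y /andP[x0 x1] /andP[y0 y1]|i _].
- by rewrite ler01 lexx.
- by rewrite mulr_ge0//= mulr_ile1.
- by rewrite unit_box_ge0/= /unit_box indicE lern1 leq_b1.
Qed.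

Let compsupp_Q : compsupp Q.
Proof.
split; first by apply: measurable_prodf; exact: intble_meas (@intble_unit_box R).
exists 1, (n%:R + 1); split => // xi; rewrite mul1r ger0_norm// indicE.
case: (boolP (xi \in _)) => [_|]; first exact: Q_le1.
rewrite notin_setE /eball/= => /negP; rewrite -leNgt => Hn.
have [i xi2] : exists i, 2^-1 < `|xi ord0 i|.
  apply: contrapT => /forallNP H.
  have : enorm xi ^+ 2 <= n%:R.
    rewrite sqr_enorm /dotr.
    apply: (@le_trans _ _ (\sum_(i < n) 1)); last by rewrite sumr_const card_ord.
    apply: ler_sum => i _; rewrite -expr2 -real_normK ?num_real//.
    have := H i => /negP; rewrite -leNgt => h.
    by rewrite expr_le1// (le_trans h)//; lra.
  have n0 : 0 <= n%:R :> R by [].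
  nra.
rewrite /Q /prodf (bigD1 i)//= /unit_box indicE memNset ?mul0r//=.
by move: xi2; rewrite in_itv/= -ler_norml leNgt => -> /=.
Qed.

(** A weight between 0 and 1 with bounded support whose Fourier transform is
    nonnegative and integrable; an indicator lacks the latter. *)
Definition kern : V -> R := autocorr Q.

Lemma compsupp_kern : compsupp kern. Proof. exact: compsupp_autocorr. Qed.

Lemma kern_ge0 t : 0 <= kern t.
Proof. by apply: Rintegral_ge0 => xi _; rewrite mulr_ge0 ?Q_ge0. Qed.

Lemma kern_le1 t : kern t <= 1.
Proof.
have [Qi JQ] := Rint_prodf n (@intble_unit_box R).
have -> : 1 = \int[leb]_xi Q xi.
  by rewrite /Q JQ Rint_unit_box expr1n.
apply: Rint_le => //; first exact: compsupp_shift_intble.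
by move=> xi; rewrite ler_piMr ?Q_ge0 ?Q_le1.
Qed.

(** The volume of a cube of side 1/2. *)
Definition kern_low : R := (2^-1) ^+ n.

Lemma kern_low_gt0 : 0 < kern_low. Proof. by rewrite exprn_gt0. Qed.

(** A cube of side 1/2 stays inside the unit cube under small translations. *)
Lemma kern_ge t : enorm t <= 4^-1 -> kern_low <= kern t.
Proof.
move=> t4; pose q : R -> R := \1_`[- (4^-1), 4^-1]%classic.
have qi : intble leb1 q by exact: integrable_indic_itv.
have [Pi JP] := Rint_prodf n qi.
have -> : kern_low = \int[leb]_xi prodf q xi.
  rewrite JP; congr (_ ^+ _); apply: EFin_inj; rewrite (Rint_E (m := leb1))//.
  transitivity (leb1 `[- (4^-1), 4^-1]%classic); last by rewrite integral_indic// setIT.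
  rewrite lebesgue_measure_itv/= lte_fin ifT; last by lra.
  by rewrite -EFinB; congr (_%:E); lra.
apply: Rint_le => //; first exact: compsupp_shift_intble.
move=> xi; rewrite /Q /prodf -big_split/=.
apply: ler_prod => i _; rewrite /q !indicE ler0n/=.
case: (boolP (xi ord0 i \in _)) => [|_]; last by rewrite mulr_ge0// unit_box_ge0.
rewrite inE/= in_itv/= => /andP[x1 x2].
have := le_trans (coord_le_enorm t i) t4; rewrite ler_norml => /andP[t1 t2].
rewrite /unit_box !indicE !mem_set ?mulr1//= in_itv/= ?mxE; apply/andP; split; lra.
Qed.

Lemma Rint_kern_cos v theta :
  \int[leb]_t (kern t * cos (dotr v t + theta)) =
  prodf (fun z => sinc z ^+ 2) v * cos theta.
Proof.
rewrite autocorr_power//; congr (_ * _).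
rewrite /power.
have fcE th : \int[leb]_xi (Q xi * cos (dotr v xi + th)) = prodf (@sinc R) v * cos th.
  exact: (Rint_prodf_cos (@intble_unit_box R) (@Rint_unit_box_cos R)).
have -> : fcos Q v = prodf (@sinc R) v.
  have := fcE 0; rewrite cos0 mulr1 => <-.
  by apply: eq_Rintegral => xi _; rewrite addr0.
have -> : fsin Q v = 0.
  have := fcE (- (pi / 2)); rewrite cosN cos_pihalf mulr0 => <-.
  by apply: eq_Rintegral => xi _; rewrite cosBpihalf.
by rewrite expr0n/= addr0 /prodf prodrXl.
Qed.

Let kap (v : V) : R := prodf (fun z => sinc z ^+ 2) v.

Let kap_intble : intble leb kap.
Proof. exact: (Rint_prodf n (@intble_sqr_sinc R)).1. Qed.

(** The integral of the Fourier transform of the kernel. *)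
Definition kern_mass : R := (\int[leb1]_z (@sinc R z ^+ 2)) ^+ n.

Lemma kern_mass_gt0 : 0 < kern_mass.
Proof. by rewrite exprn_gt0// Rint_sqr_sinc_gt0. Qed.

Section fixed.
Variable H : V -> R.
Hypothesis cH : compsupp H.

Let g e omega theta t w : R :=
  kern (e *: t) * (autocorr H w * cos (dotr t w + (dotr omega t + theta))).

Let mg e omega theta : measurable_fun setT (fun p : V * V => g e omega theta p.1 p.2).
Proof.
apply: measurable_funM; last apply: measurable_funM.
- under eq_fun do rewrite -[_ *: _]addr0.
  exact: (measurableT_comp compsupp_kern.1
    (measurableT_comp (measurable_affine_rV e 0) measurable_fst)).
- exact: (measurableT_comp (compsupp_autocorr cH).1 measurable_snd).
- apply: (measurableT_comp (@measurable_cos R)); apply: measurable_funD.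
    exact: measurable_dotr.
  apply: measurable_funD => //.
  exact: (measurableT_comp (measurable_dotrr omega) measurable_fst).
Qed.

Let domg e omega theta t w : `|g e omega theta t w| <= kern (e *: t) * `|autocorr H w|.
Proof.
rewrite normrM ger0_norm ?kern_ge0// ler_wpM2l ?kern_ge0//.
by rewrite normrM ler_piMr ?cos_max.
Qed.

Lemma intble_kern_scale e : e != 0 -> intble leb (fun t => kern (e *: t)).
Proof.
move=> e0; have := intble_affine_rV 0 e0 (intble_compsupp compsupp_kern).
by under eq_fun do rewrite addr0.
Qed.

Let iA : intble leb (fun w => `|autocorr H w|).
Proof. by apply: integrable_norm => //; exact: intble_compsupp (compsupp_autocorr cH). Qed.

Let gE e omega theta t : kern (e *: t) * (power H t * cos (dotr omega t + theta)) =
  \int[leb]_w g e omega theta t w.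
Proof.
rewrite -autocorr_power// Rint_Z//.
apply: intble_Mcos; first exact: intble_compsupp (compsupp_autocorr cH).
by apply: measurable_funD => //; exact: measurable_dotrr.
Qed.

Lemma intble_kern_power e omega theta : e != 0 ->
  intble leb (fun t => kern (e *: t) * (power H t * cos (dotr omega t + theta))).
Proof.
move=> e0; under eq_fun do rewrite gE.
exact: (tensor_intble_F (mg e omega theta) (domg e omega theta) (intble_kern_scale e0) iA).
Qed.

(** Express the power spectrum as the transform of the autocorrelation and
    exchange the two integrals: the inner one is the transform of the kernel. *)
Lemma Rint_kern_power e omega theta : 0 < e ->
  \int[leb]_t (kern (e *: t) * (power H t * cos (dotr omega t + theta))) =
  cos theta * \int[leb]_v (autocorr H (e *: v - omega) * kap v).
Proof.
move=> e0; have en0 : e != 0 by rewrite gt_eqF.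
have ei0 : e^-1 != 0 by rewrite invr_neq0.
under eq_Rintegral do rewrite gE.
rewrite (tensor_fubini (mg e omega theta) (domg e omega theta) (intble_kern_scale en0) iA).
have inner w : \int[leb]_t g e omega theta t w =
    autocorr H w * (e^-1 ^+ n * (kap (e^-1 *: (w + omega)) * cos theta)).
  rewrite /kap -Rint_kern_cos.
  set v := e^-1 *: (w + omega).
  have i1 : intble leb (fun t => kern t * cos (dotr v t + theta)).
    apply: intble_Mcos; first exact: intble_compsupp compsupp_kern.
    by apply: measurable_funD => //; exact: measurable_dotrr.
  rewrite (Rint_affine_rV 0 en0 i1) gtr0_norm//.
  have E : e^-1 ^+ n * e ^+ n = 1 by rewrite -exprMn mulVf// expr1n.
  rewrite [e^-1 ^+ n * _]mulrA E mul1r.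
  rewrite -Rint_Z; last exact: (intble_affine_rV 0 en0 i1).
  apply: eq_Rintegral => t _; rewrite addr0 /g mulrCA; congr (_ * (_ * cos _)).
  rewrite dotrZr /v dotrZl mulrA divff// mul1r dotrDl (dotrC w).
  ring.
under eq_Rintegral do rewrite inner.
have [MA [rA [MA0 HA]]] := (compsupp_autocorr cH).2.
have i2 : intble leb (fun v => autocorr H (e *: v - omega) * kap v).
  apply: (@intble_dom _ _ _ leb _ (fun v => MA * kap v)); last exact: intbleZ.
    apply: measurable_funM; last exact: intble_meas kap_intble.
    exact: (measurableT_comp (compsupp_autocorr cH).1 (measurable_affine_rV e (- omega))).
  move=> v; rewrite normrM ler_pM//; last first.
    by rewrite ger0_norm// prodr_ge0// => i _; exact: sqr_ge0.
  by rewrite (le_trans (HA _))// ler_piMr// indicE lern1 leq_b1.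
rewrite (Rint_affine_rV (e^-1 *: omega) ei0 i2) gtr0_norm ?invr_gt0//.
rewrite mulrA -Rint_Z; last exact: (intble_affine_rV (e^-1 *: omega) ei0 i2).
apply: eq_Rintegral => w _; rewrite -scalerDr scalerA divff// scale1r addrK.
ring.
Qed.

(** As the kernel spreads out, the weighted integral of a character against
    the power spectrum recovers the value of the autocorrelation. *)
Lemma cvg_kern_power omega theta : continuous H ->
  (fun k => \int[leb]_t (kern (k.+1%:R^-1 *: t) * (power H t * cos (dotr omega t + theta))))
  @ \oo --> kern_mass * (autocorr H (- omega) * cos theta).
Proof.
move=> contH.
have [MA [rA [MA0 HA]]] := (compsupp_autocorr cH).2.
have e0 (k : nat) : 0 < k.+1%:R^-1 :> R by rewrite invr_gt0.
under eq_fun do rewrite Rint_kern_power//.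
have -> : kern_mass * (autocorr H (- omega) * cos theta) =
    cos theta * \int[leb]_v (autocorr H (- omega) * kap v).
  rewrite Rint_Z// /kap (Rint_prodf n (@intble_sqr_sinc R)).2 /kern_mass; ring.
apply: cvgM; first exact: cvg_cst.
have [] := @Rint_cvg _ _ R leb (fun k v => autocorr H (k.+1%:R^-1 *: v - omega) * kap v)
  (fun v => autocorr H (- omega) * kap v) (fun v => MA * kap v) => //.
- move=> k; apply: measurable_funM; last exact: intble_meas kap_intble.
  exact: (measurableT_comp (compsupp_autocorr cH).1 (measurable_affine_rV _ (- omega))).
- move=> v; apply: cvgM; last exact: cvg_cst.
  apply: (autocorr_cvg cH contH (w_ := fun k => k.+1%:R^-1 *: v - omega)).
  rewrite -[X in _ --> X]add0r; apply: cvgD; last exact: cvg_cst.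
  by rewrite -(scale0r v); apply: cvgZr_tmp; exact: cvg_harmonic.
- exact: intbleZ.
- move=> k v; rewrite normrM ler_pM//; last first.
    by rewrite ger0_norm// prodr_ge0// => i _; exact: sqr_ge0.
  by rewrite (le_trans (HA _))// ler_piMr// indicE lern1 leq_b1.
Qed.

End fixed.
End kernel.

(** * Exponential sums with real coefficients *)

Lemma cvg_sum_seq (R : realType) (I : Type) (s : seq I) (F : I -> nat -> R) (l : I -> R) :
  (forall i, F i @ \oo --> l i) ->
  (fun k => \sum_(i <- s) F i k) @ \oo --> \sum_(i <- s) l i.
Proof.
move=> Fl; elim: s => [|i s IHs].
  by rewrite big_nil; under eq_fun do rewrite big_nil; exact: cvg_cst.
by rewrite big_cons; under eq_fun do rewrite big_cons; exact: cvgD.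
Qed.

Lemma Rint_CS d (T : measurableType d) (R : realType) (m : {measure set T -> \bar R})
    (f g : T -> R) :
  intble m (fun x => f x ^+ 2) -> intble m (fun x => g x ^+ 2) ->
  intble m (fun x => f x * g x) ->
  (\int[m]_x (f x * g x)) ^+ 2 <= \int[m]_x (f x ^+ 2) * \int[m]_x (g x ^+ 2).
Proof.
move=> fi gi fgi; apply: discriminant_le.
  by apply: Rintegral_ge0 => x _; exact: sqr_ge0.
move=> t.
have -> : \int[m]_x (f x ^+ 2) + 2 * \int[m]_x (f x * g x) * t + \int[m]_x (g x ^+ 2) * t ^+ 2
  = \int[m]_x (f x ^+ 2 + (2 * t) * (f x * g x) + t ^+ 2 * g x ^+ 2).
  rewrite !Rint_D ?Rint_Z//; last 3 first.
  - exact: intbleZ.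
  - by apply: intbleD => //; exact: intbleZ.
  - exact: intbleZ.
  ring.
apply: Rintegral_ge0 => x _.
by rewrite (_ : _ + _ = (f x + t * g x) ^+ 2) ?sqr_ge0//; ring.
Qed.

Section exponential_sums.
Variables (R : realType) (n : nat).
Local Notation V := 'rV[R]_n.
Local Notation leb := (@lebesgue_rV R n).

Section sums.
Variables (I : finType) (om : I -> V).
Implicit Types (a : I -> R) (t : V) (r : R).

Definition ecos a t : R := \sum_k a k * cos (dotr (om k) t).
Definition esin a t : R := \sum_k a k * sin (dotr (om k) t).

(** The square of the modulus of the exponential sum. *)
Definition epow a t : R := ecos a t ^+ 2 + esin a t ^+ 2.

(** Only the frequencies with a nonzero coefficient count, so that passing to a
    subfamily means replacing coefficients by 0. *)
Definition separated_on (d : R) a : Prop :=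
  forall k l, k != l -> a k != 0 -> a l != 0 -> d <= enorm (om k - om l).

Definition qform r a : R := \int[leb]_t (\1_(eball r) t * epow a t).

Lemma epow_ge0 a t : 0 <= epow a t.
Proof. by rewrite addr_ge0 ?sqr_ge0. Qed.

Lemma qform_ge0 r a : 0 <= qform r a.
Proof. by apply: Rintegral_ge0 => t _; rewrite mulr_ge0 ?epow_ge0// indicE ler0n. Qed.

Lemma measurable_ecos a : measurable_fun setT (ecos a).
Proof.
apply: measurable_sum => k; apply: measurable_funM => //.
exact: (measurableT_comp (@measurable_cos R) (measurable_dotrr _)).
Qed.

Lemma measurable_esin a : measurable_fun setT (esin a).
Proof.
apply: measurable_sum => k; apply: measurable_funM => //.
exact: (measurableT_comp (@measurable_sin R) (measurable_dotrr _)).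
Qed.

Lemma measurable_epow a : measurable_fun setT (epow a).
Proof.
apply: measurable_funD; apply: measurable_funX.
  exact: measurable_ecos.
exact: measurable_esin.
Qed.

Lemma epowE a t : epow a t = \sum_k \sum_l a k * a l * cos (dotr (om k - om l) t).
Proof.
rewrite /epow !expr2 /ecos /esin !big_distrlr -big_split/=; apply: eq_bigr => k _.
rewrite -big_split; apply: eq_bigr => l _ /=.
by rewrite dotrBl cosB; ring.
Qed.

Lemma ecos_le a t : `|ecos a t| <= \sum_k `|a k|.
Proof.
apply: le_trans (ler_norm_sum _ _ _) _; apply: ler_sum => k _.
by rewrite normrM ler_piMr ?cos_max.
Qed.

Lemma esin_le a t : `|esin a t| <= \sum_k `|a k|.
Proof.
apply: le_trans (ler_norm_sum _ _ _) _; apply: ler_sum => k _.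
by rewrite normrM ler_piMr ?sin_max.
Qed.

Lemma epow_le a : exists2 M, 0 <= M & forall t, epow a t <= M.
Proof.
have A0 : 0 <= \sum_k `|a k| by apply: sumr_ge0.
exists ((\sum_k `|a k|) ^+ 2 + (\sum_k `|a k|) ^+ 2); first by rewrite addr_ge0 ?sqr_ge0.
move=> t; apply: lerD; rewrite -[X in X <= _]real_normK ?num_real// ler_sqr ?nnegrE//.
  exact: ecos_le.
exact: esin_le.
Qed.

Lemma intble_ball r (f : V -> R) (M : R) : measurable_fun setT f -> (forall t, `|f t| <= M) ->
  intble leb (fun t => \1_(eball r) t * f t).
Proof.
move=> mf fM; apply: (@intble_dom _ _ _ _ _ (fun t => M * \1_(eball r) t)).
- apply: measurable_funM => //; apply: measurable_indic; exact: measurable_eball.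
- by move=> t; rewrite normrM [X in X * _]ger0_norm ?indicE ?ler0n// mulrC ler_wpM2r ?ler0n.
- by apply: intbleZ; exact: intble_eball.
Qed.

Lemma intble_epow r a : intble leb (fun t => \1_(eball r) t * epow a t).
Proof.
have [M M0 aM] := epow_le a; apply: (@intble_ball r _ M).
  exact: measurable_epow.
by move=> t; rewrite ger0_norm ?epow_ge0.
Qed.

End sums.

(** The class to which a test function on the unit ball and its partial
    derivatives belong. *)
Definition bump (H : V -> R) := continuous H /\
  exists M, forall xi, `|H xi| <= M * \1_(eball 1) xi.

Lemma bump_compsupp H : bump H -> compsupp H.
Proof.
move=> [cH [M HM]]; split; first exact: continuous_measurable_rV.
exists M, 1; split => //; have := HM 0; rewrite indicE mem_set ?mulr1.
  exact: le_trans.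
by rewrite /eball/= enorm0.
Qed.

Lemma bump_out H xi : bump H -> ~ eball 1 xi -> H xi = 0.
Proof.
move=> [_ [M HM]] xi1; have := HM xi.
by rewrite indicE memNset// mulr0 normr_le0 => /eqP.
Qed.

(** Unit balls whose centers are at distance 2 are disjoint. *)
Lemma autocorr_out H w : bump H -> 2 <= enorm w -> autocorr H w = 0.
Proof.
move=> bH w2; rewrite /autocorr -[RHS](Rint_0 leb); apply: eq_Rintegral => xi _.
have [x1|x1] := pselect (eball 1 xi); last by rewrite (bump_out bH x1) mul0r.
have [x2|x2] := pselect (eball 1 (xi + w)); last by rewrite (bump_out bH x2) mulr0.
exfalso; move: x1 x2; rewrite /eball/= => x1 x2.
have := enormB (xi + w) xi; rewrite addrC addKr; lra.
Qed.

(** The limit of the weighted integrals divided by a lower bound of the weight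
    on the unit ball. *)
Definition upper_cst (H : V -> R) : R :=
  (kern_low R n * (cos 1 * \int[leb]_xi H xi) ^+ 2)^-1 *
  (kern_mass R n * autocorr H 0).

Section normalized.
Variables (I : finType) (om : I -> V) (a : I -> R).
Hypothesis sep : separated_on om 2 a.

Let X H k := \int[leb]_t (kern (k.+1%:R^-1 *: t) * (power H t * epow om a t)).

Let XE H k t : kern (k.+1%:R^-1 *: t) * (power H t * epow om a t) =
  \sum_i \sum_j (a i * a j) *
    (kern (k.+1%:R^-1 *: t) * (power H t * cos (dotr (om i - om j) t + 0))).
Proof.
rewrite epowE !mulr_sumr; apply: eq_bigr => i _.
rewrite !mulr_sumr; apply: eq_bigr => j _.
by rewrite addr0; ring.
Qed.

Let e0 k : k.+1%:R^-1 != 0 :> R. Proof. by rewrite invr_neq0. Qed.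

Lemma intble_kern_epow H k : bump H ->
  intble leb (fun t => kern (k.+1%:R^-1 *: t) * (power H t * epow om a t)).
Proof.
move=> bH; under eq_fun do rewrite XE.
apply: intble_sum => i _; apply: intble_sum => j _; apply: intbleZ.
exact: (intble_kern_power (bump_compsupp bH) _ _ (e0 k)).
Qed.

(** Only the diagonal terms survive: an off-diagonal one tends to a multiple of
    the autocorrelation of H at a point at distance at least 2 from 0. *)
Lemma cvg_kern_epow H : bump H ->
  X H @ \oo --> kern_mass R n * (autocorr H 0 * \sum_k a k ^+ 2).
Proof.
move=> bH; have cH := bump_compsupp bH.
have -> : X H = fun k => \sum_i \sum_j (a i * a j) *
    \int[leb]_t (kern (k.+1%:R^-1 *: t) * (power H t * cos (dotr (om i - om j) t + 0))).
  apply/funext => k; rewrite /X; under eq_Rintegral do rewrite XE.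
  rewrite Rint_sum => [|i _]; last first.
    apply: intble_sum => j _; apply: intbleZ.
    exact: (intble_kern_power cH _ _ (e0 k)).
  apply: eq_bigr => i _; rewrite Rint_sum => [|j _]; last first.
    apply: intbleZ; exact: (intble_kern_power cH _ _ (e0 k)).
  apply: eq_bigr => j _; rewrite Rint_Z//.
  exact: (intble_kern_power cH _ _ (e0 k)).
have -> : kern_mass R n * (autocorr H 0 * \sum_k a k ^+ 2) =
  \sum_i \sum_j (a i * a j) * (kern_mass R n * (autocorr H (- (om i - om j)) * cos 0)).
  rewrite mulrA mulr_sumr; apply: eq_bigr => i _.
  rewrite (bigD1 i)//= subrr oppr0 cos0 big1 ?addr0; first by ring.
  move=> j ji; have [->|ai] := eqVneq (a i) 0; first by rewrite !mul0r.
  have [->|aj] := eqVneq (a j) 0; first by rewrite mulr0 mul0r.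
  by rewrite autocorr_out// ?mul0r ?mulr0// enormN sep// eq_sym.
apply: cvg_sum_seq => i; apply: cvg_sum_seq => j; apply: cvgM; first exact: cvg_cst.
exact: (cvg_kern_power cH bH.1).
Qed.

(** Cauchy-Schwarz against the cosine and the sine on the unit ball. *)
Lemma power_le H t : bump H ->
  power H t <= 2 * (autocorr H 0 * \int[leb]_xi \1_(eball 1) xi).
Proof.
move=> bH; have cH := bump_compsupp bH; have Hi := intble_compsupp cH.
have H2i : intble leb (fun xi => H xi ^+ 2).
  have := compsupp_shift_intble cH 0.
  by apply: eq_integrable => // xi _ /=; rewrite addr0 expr2.
have i1 := @intble_eball R n 1.
have key (F : V -> R) : measurable_fun setT F -> (forall xi, `|F xi| <= 1) ->
    (\int[leb]_xi (H xi * F xi)) ^+ 2 <= autocorr H 0 * \int[leb]_xi \1_(eball 1) xi.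
  move=> mF F1.
  have F2 xi : F xi ^+ 2 <= 1.
    by rewrite -real_normK ?num_real// expr_le1.
  have iF2 : intble leb (fun xi => (\1_(eball 1) xi * F xi) ^+ 2).
    apply: (intble_dom _ _ i1).
      apply: measurable_funX; apply: measurable_funM => //.
      by apply: measurable_indic; exact: measurable_eball.
    move=> xi; rewrite ger0_norm ?sqr_ge0// exprMn.
    by rewrite indicE; case: (_ \in _); rewrite ?expr0n ?expr1n ?mul0r ?mul1r//.
  have HF xi : H xi * F xi = H xi * (\1_(eball 1) xi * F xi).
    rewrite indicE; case: (boolP (xi \in _)) => [_|]; first by rewrite mul1r.
    by rewrite notin_setE => /(bump_out bH) ->; rewrite !mul0r.
  under eq_Rintegral do rewrite HF.
  apply: (le_trans (Rint_CS H2i iF2 _)).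
    apply: (intble_dom _ _ (integrable_norm Hi)).
      under eq_fun do rewrite -HF.
      by apply: measurable_funM => //; exact: cH.1.
    by move=> xi; rewrite -HF /= normrM ler_piMr.
  rewrite autocorr0 ler_wpM2l//; first by apply: Rintegral_ge0 => xi _; exact: sqr_ge0.
  apply: Rint_le => // xi; rewrite exprMn.
  by rewrite indicE; case: (_ \in _); rewrite ?expr0n ?expr1n ?mul0r ?mul1r.
have k1 := key (fun xi => cos (dotr t xi))
  (measurableT_comp (@measurable_cos R) (measurable_dotrr t)) (fun xi => cos_max _).
have k2 := key (fun xi => sin (dotr t xi))
  (measurableT_comp (@measurable_sin R) (measurable_dotrr t)) (fun xi => sin_max _).
rewrite /power /fcos /fsin; lra.
Qed.

(** The weight r^2 - |t|^2 is nonpositive off the ball of radius r, while the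
    quadratic form that it defines is diagonal with entries
    r^2 |H|^2 - |grad H|^2. *)
Lemma lower_normalized r H (G : 'I_n -> V -> R) : 0 <= r -> bump H ->
  (forall i, bump (G i)) ->
  (forall i t, power (G i) t = t ord0 i ^+ 2 * power H t) ->
  kern_mass R n * (r ^+ 2 * autocorr H 0 - \sum_i autocorr (G i) 0) * \sum_k a k ^+ 2 <=
  2 * r ^+ 2 * (autocorr H 0 * \int[leb]_xi \1_(eball 1) xi) * qform om r a.
Proof.
move=> r0 bH bG pG; set S := \sum_k a k ^+ 2.
set M := autocorr H 0 * _.
have H0 : 0 <= autocorr H 0.
  by apply: Rintegral_ge0 => xi _; rewrite addr0 -expr2 sqr_ge0.
have M0 : 0 <= M.
  by rewrite mulr_ge0//; apply: Rintegral_ge0 => xi _; rewrite indicE ler0n.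
have cvL : (fun k => r ^+ 2 * X H k - \sum_i X (G i) k) @ \oo -->
   kern_mass R n * (r ^+ 2 * autocorr H 0 - \sum_i autocorr (G i) 0) * S.
  rewrite (_ : _ * S = r ^+ 2 * (kern_mass R n * (autocorr H 0 * S)) -
      \sum_i (kern_mass R n * (autocorr (G i) 0 * S))); last first.
    by rewrite -mulr_sumr -mulr_suml; ring.
  apply: cvgB; first by apply: cvgM; [exact: cvg_cst|exact: cvg_kern_epow].
  by apply: cvg_sum_seq => i; exact: cvg_kern_epow.
apply: (cvgr_to_le cvL); apply: nearW => k.
rewrite /X -Rint_Z; last exact: intble_kern_epow.
rewrite -Rint_sum => [|i _]; last exact: intble_kern_epow.
rewrite -Rint_B; last 2 first.
- by apply: intbleZ; exact: intble_kern_epow.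
- by apply: intble_sum => i _; exact: intble_kern_epow.
rewrite /qform -Rint_Z; last exact: intble_epow.
apply: Rint_le.
- apply: intbleB; first by apply: intbleZ; exact: intble_kern_epow.
  by apply: intble_sum => i _; exact: intble_kern_epow.
- by apply: intbleZ; exact: intble_epow.
move=> t; set K := kern _; set P := epow om a t.
have P0 : 0 <= P by exact: epow_ge0.
have K0 : 0 <= K by exact: kern_ge0.
have K1 : K <= 1 by exact: kern_le1.
rewrite (_ : _ - _ = (r ^+ 2 - enorm t ^+ 2) * (K * (power H t * P))); last first.
  rewrite sqr_enorm /dotr mulrBl mulr_suml; congr (_ - _).
  by apply: eq_bigr => i _; rewrite pG; ring.
have pw0 : 0 <= power H t by exact: power_ge0.
have pw : power H t <= 2 * M by exact: power_le.
have KP : K * (power H t * P) <= 2 * M * P.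
  rewrite mulrA ler_wpM2r// (le_trans _ pw)// ler_piMl//.
have KP0 : 0 <= K * (power H t * P) by rewrite !mulr_ge0.
rewrite indicE; case: (boolP (t \in _)) => [_|].
  rewrite mul1r (_ : 2 * _ * M * P = r ^+ 2 * (2 * M * P)); last by ring.
  apply: (le_trans (ler_wpM2r KP0 (_ : _ <= r ^+ 2))); first by rewrite lerBlDr lerDl sqr_ge0.
  by rewrite ler_wpM2l ?sqr_ge0.
rewrite notin_setE /eball/= => /negP; rewrite -leNgt => rt.
rewrite mul0r mulr0 mulr_le0_ge0// subr_le0 ler_sqr ?nnegrE//.
exact: enorm_ge0.
Qed.

(** On the unit ball the transform of a nonnegative bump stays away from 0. *)
Lemma upper_normalized H : bump H -> (forall xi, 0 <= H xi) ->
  0 < \int[leb]_xi H xi ->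
  qform om 1 a <= upper_cst H * \sum_k a k ^+ 2.
Proof.
move=> bH H0 JH; have cH := bump_compsupp bH; have Hi := intble_compsupp cH.
have c1 := @cos1_gt0 R.
have AH0 : 0 <= autocorr H 0 by apply: Rintegral_ge0 => xi _; rewrite mulr_ge0.
have m0 := @kern_mass_gt0 R n.
pose c := kern_low R n * (cos 1 * \int[leb]_xi H xi) ^+ 2.
have c0 : 0 < c by rewrite mulr_gt0 ?kern_low_gt0// exprn_gt0// mulr_gt0.
rewrite /upper_cst -/c -mulrA ler_pdivlMl// -mulrA.
have cv : X H @ \oo --> kern_mass R n * (autocorr H 0 * \sum_k a k ^+ 2).
  exact: cvg_kern_epow.
apply: (cvgr_to_ge cv); exists 3%N => // k /= k3.
rewrite /X /qform -Rint_Z; last exact: intble_epow.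
apply: Rint_le.
- by apply: intbleZ; exact: intble_epow.
- exact: intble_kern_epow.
move=> t; rewrite indicE; case: (boolP (t \in _)) => [|_]; last first.
  by rewrite mul0r mulr0 !mulr_ge0 ?kern_ge0 ?power_ge0 ?epow_ge0.
rewrite inE /eball/= => t1; rewrite mul1r mulrA ler_wpM2r ?epow_ge0// /c.
apply: ler_pM.
- exact/ltW/kern_low_gt0.
- exact: sqr_ge0.
- apply: kern_ge; rewrite enormZ ger0_norm ?invr_ge0//.
  rewrite -[leRHS]mulr1 ler_pM ?invr_ge0 ?enorm_ge0 ?(ltW t1)//.
  by rewrite lef_pV2 ?posrE// ler_nat.
apply: (@le_trans _ _ (fcos H t ^+ 2)); last by rewrite /power lerDl sqr_ge0.
suff F : cos 1 * \int[leb]_xi H xi <= fcos H t.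
  rewrite ler_sqr ?nnegrE//; first by rewrite mulr_ge0 ?ltW.
  by apply: le_trans F; rewrite mulr_ge0 ?ltW.
rewrite -Rint_Z//; apply: Rint_le.
- exact: intbleZ.
- by apply: intble_Mcos => //; exact: measurable_dotrr.
move=> xi; rewrite mulrC.
have [x1|x1] := pselect (eball 1 xi); last by rewrite (bump_out bH x1) !mul0r.
rewrite ler_wpM2l// cos_ge//; apply: (le_trans (dotr_le _ _)).
by rewrite -[leRHS]mulr1 ler_pM ?enorm_ge0// ltW.
Qed.

End normalized.
End exponential_sums.

(** * Test functions *)

Section test_functions.
Variables (R : realType) (n : nat).
Local Notation V := 'rV[R]_n.
Local Notation leb := (@lebesgue_rV R n).
Implicit Types (phi : V -> R).

Let e_ (i : 'I_n) : V := delta_mx ord0 i.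
Let s_ (k : nat) : R := k.+1%:R^-1.

Let s_gt0 k : 0 < s_ k. Proof. by rewrite invr_gt0. Qed.

Let s_le1 k : s_ k <= 1. Proof. by rewrite invf_le1// ler1n. Qed.

Let cvg_s : s_ @ \oo --> (0 : R). Proof. exact: cvg_harmonic. Qed.

Let cvg_s_dnbhs : s_ @ \oo --> (0 : R)^'.
Proof.
move=> A /= [e e0 eA].
have bn : nbhs (0 : R) (ball_ [eta Num.Def.normr] 0 e) by exists e.
have [N _ HN] := cvg_s bn; exists N => // k Nk.
by apply: (eA _ (HN _ Nk)); rewrite gt_eqF.
Qed.

Let cvg_uniq (u : nat -> R) (a b : R) : u @ \oo --> a -> u @ \oo --> b -> a = b.
Proof. by move=> ua ub; rewrite -(cvg_lim (@Rhausdorff R) ua) (cvg_lim (@Rhausdorff R) ub). Qed.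

(** Dominated convergence is about sequences, so difference quotients are taken
    along the steps 1 / (k + 1). *)
Lemma derivable_seq (W : normedModType R) (f : W -> R) (x v : W) : derivable f x v ->
  (fun k => (s_ k)^-1 * (f (s_ k *: v + x) - f x)) @ \oo --> 'D_v f x.
Proof.
move=> df.
apply: (@cvg_comp _ _ _ s_ (fun h => h^-1 *: ((f \o shift x) (h *: v) - f x)) _ _ _ cvg_s_dnbhs).
exact: df.
Qed.

Lemma enorm_delta i : enorm (e_ i) = 1.
Proof.
rewrite /enorm /dotr (bigD1 i)//= big1 ?addr0 => [|j ji].
  by rewrite /e_ mxE !eqxx mulr1 sqrtr1.
by rewrite /e_ mxE (negbTE ji) andbF mul0r.
Qed.

Lemma dotr_delta t i : dotr t (e_ i) = t ord0 i.
Proof.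
rewrite /dotr (bigD1 i)//= big1 ?addr0 => [|j ji]; first by rewrite mxE !eqxx mulr1.
by rewrite mxE (negbTE ji) andbF mulr0.
Qed.

Section fixed.
Variable phi : V -> R.
Hypothesis tphi : test_function (eball 1) phi.

Let S := closure [set x | phi x != 0].

Let phi_out x : ~ S x -> phi x = 0.
Proof. by move=> Sx; apply/eqP/negPn/negP => p0; apply: Sx; exact: subset_closure. Qed.

Let derivable_phi i x : derivable phi x (e_ i).
Proof. by have [sm _ _] := tphi; exact: (sm [::]).2. Qed.

Let partial_out i x : ~ S x -> partial i phi x = 0.
Proof.
move=> Sx; have H := derivable_seq (@derivable_phi i x).
apply: (cvg_uniq H).
apply: cvg_near_cst.
have oS : nbhs x (~` S).
  by apply: open_nbhs_nbhs; split => //; apply: closed_openC; exact: closed_closure.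
have cx : (fun k => s_ k *: e_ i + x) @ \oo --> x.
  rewrite -[X in _ --> X]add0r; apply: cvgD; last exact: cvg_cst.
  by rewrite -(scale0r (e_ i)); apply: cvgZr_tmp.
have [N _ HN] := cx _ oS; exists N => // k Nk.
by rewrite !phi_out// ?subrr ?mulr0//; exact: (HN _ Nk).
Qed.

Let bump_of (f : V -> R) : continuous f -> (forall x, ~ S x -> f x = 0) -> bump f.
Proof.
move=> cf f0; split => //; have [_ cS SU] := tphi.
have : compact (f @` S).
  by apply: continuous_compact => //; exact: continuous_subspaceT.
move=> /compact_bounded[N [_ HN]]; exists (`|N| + 1) => x.
have N1 : N < `|N| + 1 by rewrite ltr_pwDr// ler_norm.
have [Sx|Sx] := pselect (S x); last first.
  by rewrite f0// normr0 mulr_ge0 ?addr_ge0// indicE ler0n.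
rewrite indicE mem_set; last exact: SU.
by rewrite mulr1; apply: (HN _ N1); exists x.
Qed.

Lemma bump_test : bump phi.
Proof. by have [sm _ _] := tphi; apply: bump_of; [exact: (sm [::]).1|exact: phi_out]. Qed.

Lemma bump_partial i : bump (partial i phi).
Proof. by have [sm _ _] := tphi; apply: bump_of; [exact: (sm [:: i]).1|exact: partial_out]. Qed.

(** The difference quotients are bounded by the partial derivative, by the mean
    value theorem on a segment. *)
Let quotient_le i (M : R) : (forall x, `|partial i phi x| <= M) ->
  forall k x, `|(s_ k)^-1 * (phi (s_ k *: e_ i + x) - phi x)| <= M.
Proof.
move=> HM k x; pose g (h : R) := phi (h *: e_ i + x).
have gE (h : R) : (fun d : R => d^-1 *: ((g \o shift h) (d *: 1) - g h)) =
   (fun d : R => d^-1 *: ((phi \o shift (h *: e_ i + x)) (d *: e_ i) - phi (h *: e_ i + x))).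
  apply/funext => d; rewrite /g /= /shift /=; congr (_ *: (phi _ - _)).
  by rewrite [d *: 1]mulr1 scalerDl addrA.
have dg (h : R) : is_derive h 1 g (partial i phi (h *: e_ i + x)).
  apply: DeriveDef; first by rewrite /derivable gE; exact: derivable_phi.
  by rewrite /derive gE.
have [|c _] := @MVT R g (fun h => partial i phi (h *: e_ i + x)) 0 (s_ k) (s_gt0 k)
    (fun h _ => dg h).
  apply: continuous_subspaceT => h; apply: differentiable_continuous.
  by apply/derivable1_diffP; have [] := dg h.
rewrite /g scale0r add0r subr0 => ->.
by rewrite mulrCA mulVf ?gt_eqF// mulr1.
Qed.

(** Integration by parts: a translation moves the difference quotients of phi
    onto the cosine, and dominated convergence applies on both sides. *)
Lemma Rint_partial_cos i t theta :
  \int[leb]_xi (partial i phi xi * cos (dotr t xi + theta)) =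
  t ord0 i * \int[leb]_xi (phi xi * sin (dotr t xi + theta)).
Proof.
have [M HM] := (bump_partial i).2.
have phii := intble_compsupp (bump_compsupp bump_test).
have pM x : `|partial i phi x| <= `|M|.
  rewrite (le_trans (HM x))// (le_trans (ler_norm _))// normrM ler_piMr//.
  by rewrite indicE ger0_norm ?ler0n// lern1 leq_b1.
pose D k xi := (s_ k)^-1 * (phi (s_ k *: e_ i + xi) - phi xi).
pose co xi := cos (dotr t xi + theta).
pose si xi := sin (dotr t xi + theta).
have mph : measurable_fun setT (fun xi => dotr t xi + theta).
  by apply: measurable_funD => //; exact: measurable_dotrr.
have mco : measurable_fun setT co by exact: (measurableT_comp (@measurable_cos R) mph).
have mphi := intble_meas phii.
have mD k : measurable_fun setT (D k).
  apply: measurable_funM => //; apply: measurable_funB => //.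
  under eq_fun do rewrite addrC -[X in X + _]scale1r.
  exact: (measurableT_comp mphi (measurable_affine_rV 1 (s_ k *: e_ i))).
have D_le k xi : `|D k xi| <= `|M| * \1_(eball 2) xi.
  rewrite indicE; case: (boolP (xi \in eball 2)) => [_|].
    by rewrite mulr1; exact: quotient_le.
  rewrite notin_setE /eball/= => /negP; rewrite -leNgt => x2.
  rewrite mulr0 /D !(bump_out bump_test) ?subrr ?mulr0 ?normr0//.
    rewrite /eball/=; apply/negP; rewrite -leNgt; lra.
  rewrite /eball/=; apply/negP; rewrite -leNgt.
  have := enormB (s_ k *: e_ i + xi) (s_ k *: e_ i).
  rewrite addrC addKr enormZ enorm_delta mulr1 ger0_norm ?(ltW (s_gt0 k))//.
  by have := s_le1 k; lra.
have [_ _ cv1] := @Rint_cvg _ _ R leb (fun k xi => D k xi * co xi)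
  (fun xi => partial i phi xi * co xi) (fun xi => `|M| * \1_(eball 2) xi)
  (fun k => measurable_funM (mD k) mco)
  (fun xi => cvgM (derivable_seq (@derivable_phi i xi)) (@cvg_cst _ (co xi) _ _ _))
  (intbleZ `|M| (intble_eball n 2))
  ltac:(by move=> k xi; rewrite normrM (le_trans _ (D_le k xi))// ler_piMr ?cos_max).
apply: (cvg_uniq cv1).
pose Jc := \int[leb]_xi (phi xi * co xi).
pose Js := \int[leb]_xi (phi xi * si xi).
pose h k : R := s_ k * t ord0 i.
have E k : \int[leb]_xi (D k xi * co xi) =
    ((s_ k)^-1 * (cos (h k) - 1)) * Jc + ((s_ k)^-1 * sin (h k)) * Js.
  have ic : intble leb (fun xi => phi xi * co xi) by exact: intble_Mcos.
  have is_ : intble leb (fun xi => phi xi * si xi) by exact: intble_Msin.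
  pose F xi := phi xi * cos (dotr t xi - h k + theta).
  have iF : intble leb F.
    apply: intble_Mcos => //; apply: measurable_funD => //; apply: measurable_funB => //.
    exact: measurable_dotrr.
  have iF' := intble_affine_rV (s_ k *: e_ i) (oner_neq0 _) iF.
  have F'E xi : F (1 *: xi + s_ k *: e_ i) = phi (s_ k *: e_ i + xi) * co xi.
    rewrite /F scale1r (addrC xi) /co; congr (_ * cos _).
    by rewrite dotrDr dotrZr dotr_delta /h; ring.
  transitivity ((s_ k)^-1 * (\int[leb]_xi F xi - Jc)).
    rewrite (Rint_affine_rV (s_ k *: e_ i) (oner_neq0 _) iF) normr1 expr1n mul1r.
    rewrite -Rint_B// -Rint_Z; last exact: intbleB.
    by apply: eq_Rintegral => xi _; rewrite F'E /D; ring.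
  have -> : \int[leb]_xi F xi = cos (h k) * Jc + sin (h k) * Js.
    rewrite -!Rint_Z// -Rint_D; last 2 first.
    - exact: intbleZ.
    - exact: intbleZ.
    apply: eq_Rintegral => xi _; rewrite /F /co /si.
    have -> : dotr t xi - h k + theta = (dotr t xi + theta) - h k by ring.
    by rewrite cosB; ring.
  ring.
under eq_fun do rewrite E.
have dc : is_derive (0 : R) 1 (fun x : R => cos (x * t ord0 i)) 0.
  by apply: is_derive_eq; rewrite /GRing.scale/= mul0r sin0; ring.
have ds : is_derive (0 : R) 1 (fun x : R => sin (x * t ord0 i)) (t ord0 i).
  by apply: is_derive_eq; rewrite /GRing.scale/= mul0r cos0; ring.
have l1 : (fun k => (s_ k)^-1 * (cos (h k) - 1)) @ \oo --> (0 : R).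
  have := derivable_seq (@ex_derive _ _ _ _ _ _ _ dc); rewrite derive_val.
  under eq_fun do rewrite addr0 [_ *: 1]mulr1 mul0r cos0.
  exact.
have l2 : (fun k => (s_ k)^-1 * sin (h k)) @ \oo --> t ord0 i.
  have := derivable_seq (@ex_derive _ _ _ _ _ _ _ ds); rewrite derive_val.
  under eq_fun do rewrite addr0 [_ *: 1]mulr1 mul0r sin0 subr0.
  exact.
rewrite (_ : t ord0 i * _ = 0 * Jc + t ord0 i * Js); last by rewrite mul0r add0r.
by apply: cvgD; apply: cvgM => //; exact: cvg_cst.
Qed.

(** The Fourier transform turns a partial derivative into the multiplication by a
    coordinate. *)
Lemma power_partial i t : power (partial i phi) t = t ord0 i ^+ 2 * power phi t.
Proof.
have H1 : fcos (partial i phi) t = t ord0 i * fsin phi t.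
  transitivity (\int[leb]_xi (partial i phi xi * cos (dotr t xi + 0))).
    by apply: eq_Rintegral => xi _; rewrite addr0.
  rewrite Rint_partial_cos; congr (_ * _).
  by apply: eq_Rintegral => xi _; rewrite addr0.
have H2 : fsin (partial i phi) t = - (t ord0 i * fcos phi t).
  transitivity (\int[leb]_xi (partial i phi xi * cos (dotr t xi + - (pi / 2)))).
    by apply: eq_Rintegral => xi _; rewrite cosBpihalf.
  rewrite Rint_partial_cos -[RHS]mulrN; congr (_ * _).
  transitivity (\int[leb]_xi (-1 * (phi xi * cos (dotr t xi)))).
    by apply: eq_Rintegral => xi _; rewrite sinBpihalf mulrN mulN1r.
  rewrite Rint_Z ?mulN1r//; apply: intble_Mcos; last exact: measurable_dotrr.
  exact: intble_compsupp (bump_compsupp bump_test).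
by rewrite /power H1 H2; ring.
Qed.

End fixed.
End test_functions.

(** * Test functions close to an eigenfunction *)

Section eigenfunction.
Variables (R : realType) (n : nat).
Local Notation V := 'rV[R]_n.
Local Notation leb := (@lebesgue_rV R n).
Local Notation U := (@eball R n 1).

Lemma cvg_Rint_sqr d (T : measurableType d) (m : {measure set T -> \bar R})
    (F : nat -> T -> R) (f : T -> R) :
  (forall k, measurable_fun setT (F k)) -> measurable_fun setT f ->
  (forall k, intble m (fun x => F k x ^+ 2)) -> intble m (fun x => f x ^+ 2) ->
  (fun k => (\int[m]_x ((F k x - f x) ^+ 2)%:E)%E) @ \oo --> 0%E ->
  (fun k => \int[m]_x (F k x ^+ 2)) @ \oo --> \int[m]_x (f x ^+ 2).
Proof.
move=> mF mf Fi fi cv.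
pose D k := \int[m]_x ((F k x - f x) ^+ 2).
have Di k : intble m (fun x => (F k x - f x) ^+ 2).
  apply: (@intble_dom _ _ _ _ _ (fun x => 2 * F k x ^+ 2 + 2 * f x ^+ 2)).
  - by apply: measurable_funX; exact: measurable_funB.
  - by move=> x; rewrite ger0_norm ?sqr_ge0//; have := sqr_ge0 (F k x + f x); nra.
  - by apply: intbleD; exact: intbleZ.
have D0 : D @ \oo --> (0 : R) by have := fine_cvg cv; exact.
pose A := \int[m]_x (f x ^+ 2).
have A0 : 0 <= A by apply: Rintegral_ge0 => x _; exact: sqr_ge0.
(* |F^2 - f^2| <= (1 + 1/th) (F - f)^2 + th f^2, to be used with a small th. *)
have key (th : R) k : 0 < th -> `|A - \int[m]_x (F k x ^+ 2)| <= (1 + th^-1) * D k + th * A.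
  move=> th0; rewrite /A -Rint_B// -!Rint_Z// -Rint_D; last 2 first.
  - exact: intbleZ.
  - exact: intbleZ.
  apply: Rint_norm.
  - exact: intbleB.
  - by apply: intbleD; exact: intbleZ.
  move=> x; set a := F k x; set b := f x.
  have th1 : th * th^-1 = 1 by rewrite divff// gt_eqF.
  have ti0 : 0 < th^-1 by rewrite invr_gt0.
  have P1 := sqr_ge0 (a - b + th * b); have P2 := sqr_ge0 (a - b - th * b).
  have Q1 := mulr_ge0 (ltW ti0) P1; have Q2 := mulr_ge0 (ltW ti0) P2.
  have E1 : th^-1 * (a - b + th * b) ^+ 2 =
    th^-1 * (a - b) ^+ 2 + (th * th^-1) * (2 * (a - b) * b) + (th * th^-1) * (th * b ^+ 2) by ring.
  have E2 : th^-1 * (a - b - th * b) ^+ 2 =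
    th^-1 * (a - b) ^+ 2 - (th * th^-1) * (2 * (a - b) * b) + (th * th^-1) * (th * b ^+ 2) by ring.
  rewrite E1 th1 in Q1; rewrite E2 th1 in Q2.
  by rewrite ler_norml; apply/andP; split; nra.
apply/cvgrPdist_le => e e0.
pose th := e / (2 * (A + 1)).
have th0 : 0 < th by rewrite divr_gt0// mulr_gt0// ltr_wpDl.
have thA : th * A <= e / 2.
  rewrite /th mulrAC ler_pdivrMr; last by rewrite mulr_gt0// ltr_wpDl.
  by nra.
have c0 : 0 < 1 + th^-1 by rewrite addr_gt0// invr_gt0.
have e2 : 0 < e / 2 / (1 + th^-1) by rewrite !divr_gt0.
have /cvgrPdist_le/(_ _ e2) := D0; apply: filterS => k; rewrite sub0r normrN => Dk.
apply: (le_trans (key th k th0)).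
have : (1 + th^-1) * D k <= e / 2.
  by rewrite mulrC -ler_pdivlMr// (le_trans (ler_norm _)).
rewrite -/A; lra.
Qed.

Let L2_restrict u : L2 U u ->
  measurable_fun setT (u \_ U) /\ intble leb (fun xi => (u \_ U) xi ^+ 2).
Proof.
move=> [mu ui]; have mU := @measurable_eball R n 1; split.
  by apply/(measurable_restrictT _ mU).
have := (integrable_mkcond _ mU).1 ui.
apply: eq_integrable => // xi _ /=.
by rewrite !patchE; case: ifP => // _; rewrite expr0n.
Qed.

Let dist_restrict (H u : V -> R) : (forall xi, ~ U xi -> H xi = 0) ->
  L2_dist2 U H u = (\int[leb]_xi ((H xi - (u \_ U) xi) ^+ 2)%:E)%E.
Proof.
move=> H0; rewrite /L2_dist2 integral_mkcond; apply: eq_integral => xi _.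
rewrite !patchE; case: ifPn => //.
by rewrite notin_setE => /H0->; rewrite subrr expr0n.
Qed.

(** Testing the eigenvalue equation with the eigenfunction u itself shows that its
    Rayleigh quotient is mu, and test functions that converge to u in H^1 have
    Rayleigh quotients that converge to mu. The value at 0 of an autocorrelation
    is a squared norm. *)
Lemma exists_test_function mu : dirichlet_eigenvalue U mu -> forall delta, 0 < delta ->
  exists phi : V -> R, [/\ test_function U phi, 0 < autocorr phi 0 &
    \sum_i autocorr (partial i phi) 0 <= (mu + delta) * autocorr phi 0].
Proof.
move=> [u [g [Hug u_neq0 eig]]] delta delta0.
have [[Lu Lg _] [phi [tphi cphi cgphi]]] := Hug.
have mU := @measurable_eball R n 1.
have [mu_ iu] := L2_restrict Lu.
have bphi k := bump_test (tphi k).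
have bpphi k i := bump_partial (tphi k) i.
have sqi (H : V -> R) : bump H -> measurable_fun setT H /\ intble leb (fun xi => H xi ^+ 2).
  move=> bH; have cH := bump_compsupp bH; split; first exact: cH.1.
  have := compsupp_shift_intble cH 0.
  by apply: eq_integrable => // xi _ /=; rewrite addr0 expr2.
pose A := \int[leb]_xi ((u \_ U) xi ^+ 2).
pose B i := \int[leb]_xi ((g i \_ U) xi ^+ 2).
have cA : (fun k => autocorr (phi k) 0) @ \oo --> A.
  under eq_fun do rewrite autocorr0.
  apply: cvg_Rint_sqr => //; try (by move=> k; have [] := sqi _ (bphi k)).
  rewrite (_ : (fun k => _) = (fun k => L2_dist2 U (phi k) u)); first exact: cphi.
  by apply/funext => k; rewrite dist_restrict// => xi; exact: bump_out.
have cB i : (fun k => autocorr (partial i (phi k)) 0) @ \oo --> B i.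
  under eq_fun do rewrite autocorr0.
  have [mg ig] := L2_restrict (Lg i).
  apply: cvg_Rint_sqr => //; try (by move=> k; have [] := sqi _ (bpphi k i)).
  rewrite (_ : (fun k => _) = (fun k => L2_dist2 U (partial i (phi k)) (g i))).
    exact: cgphi.
  by apply/funext => k; rewrite dist_restrict// => xi; exact: bump_out.
have BA : \sum_i B i = mu * A.
  have := eig u g Hug; rewrite [in LHS]Rintegral_mkcond [in RHS]Rintegral_mkcond.
  rewrite /A /B -Rint_sum => [E|i _]; last by have [] := L2_restrict (Lg i).
  transitivity (\int[leb]_x ((fun x => \sum_i g i x * g i x) \_ U) x).
    apply: eq_Rintegral => xi _; rewrite patchE; case: ifPn => xU.
      by apply: eq_bigr => i _; rewrite patchE xU expr2.
    by rewrite big1// => i _; rewrite patchE (negbTE xU) expr0n.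
  rewrite E; congr (_ * _); apply: eq_Rintegral => xi _.
  by rewrite !patchE; case: ifP => _; rewrite ?expr2// mulr0.
have A0 : 0 < A.
  rewrite lt_def; apply/andP; split; last by apply: Rintegral_ge0 => xi _; exact: sqr_ge0.
  apply/negP => /eqP A0; apply: u_neq0.
  have : (\int[leb]_xi `|((u \_ U) xi ^+ 2)%:E| = 0)%E.
    under eq_integral do rewrite gee0_abs ?lee_fin ?sqr_ge0//.
    by rewrite -Rint_E// -/A A0.
  have mE : measurable_fun setT (fun xi => ((u \_ U) xi ^+ 2)%:E).
    by apply/measurable_EFinP; apply: measurable_funX.
  move=> /(ae_eq_integral_abs leb measurableT mE); apply: filterS => xi /(_ I) /= H Uxi.
  have := EFin_inj H; rewrite patchE mem_set// => /eqP.
  by rewrite sqrf_eq0 => /eqP.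
have cS : (fun k => \sum_i autocorr (partial i (phi k)) 0 - (mu + delta) * autocorr (phi k) 0)
    @ \oo --> \sum_i B i - (mu + delta) * A.
  apply: cvgB; first by apply: cvg_sum_seq.
  by apply: cvgM => //; exact: cvg_cst.
have neg : \sum_i B i - (mu + delta) * A < 0.
  by rewrite BA mulrDl opprD addrA subrr add0r oppr_lt0 mulr_gt0.
have [N1 _ H1] := cvgr_gt _ cA _ A0.
have [N2 _ H2] := cvgr_lt _ cS _ neg.
exists (phi (maxn N1 N2)); split; first exact: tphi.
  by apply: H1; exact: leq_maxl.
have := H2 (maxn N1 N2) (leq_maxr _ _); rewrite subr_lt0; exact: ltW.
Qed.

End eigenfunction.

(** * Inequalities for one uniformly separated family *)

Section one_family.
Variables (R : realType) (n : nat).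
Local Notation V := 'rV[R]_n.
Local Notation leb := (@lebesgue_rV R n).
Implicit Types (r : R).

Definition vol r : R := \int[leb]_t \1_(@eball R n r) t.

Lemma vol_ge0 r : 0 <= vol r.
Proof. by apply: Rintegral_ge0 => t _; rewrite indicE ler0n. Qed.

Lemma indic_eball_le r s (t : V) : r <= s -> \1_(eball r) t <= \1_(eball s) t :> R.
Proof.
move=> rs; rewrite !indicE; case: (boolP (t \in eball r)) => // /set_mem tr.
by rewrite mem_set//; exact: lt_le_trans rs.
Qed.

Lemma vol_le r s : r <= s -> vol r <= vol s.
Proof.
move=> rs; apply: Rint_le => [||t]; [exact: intble_eball|exact: intble_eball|].
exact: indic_eball_le.
Qed.

Lemma eball_scale c r (t : V) : 0 < c -> \1_(eball (c * r)) (c *: t) = \1_(eball r) t :> R.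
Proof.
move=> c0; rewrite !indicE; congr (nat_of_bool _)%:R.
by apply/idP/idP => /set_mem /= H; apply/mem_set => /=; move: H;
  rewrite /eball/= enormZ gtr0_norm// ltr_pM2l.
Qed.

Lemma vol_scale r : 0 < r -> vol r = r ^+ n * vol 1.
Proof.
move=> r0; have rn0 : r != 0 by rewrite gt_eqF.
rewrite /vol (Rint_affine_rV 0 rn0); last exact: intble_eball.
rewrite gtr0_norm//; congr (_ * _); apply: eq_Rintegral => t _.
by rewrite addr0 -[r in X in \1_X]mulr1 eball_scale.
Qed.

Section family.
Variables (I : finType) (om : I -> V).
Implicit Types (a : I -> R).

Lemma qform_le r s a : r <= s -> qform om r a <= qform om s a.
Proof.
move=> rs; apply: Rint_le => [||t]; [exact: intble_epow|exact: intble_epow|].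
by rewrite ler_wpM2r ?epow_ge0// indic_eball_le.
Qed.

Lemma qform_scale c r a : 0 < c ->
  qform (fun k => c^-1 *: om k) (c * r) a = c ^+ n * qform om r a.
Proof.
move=> c0; have cn0 : c != 0 by rewrite gt_eqF.
rewrite /qform (Rint_affine_rV 0 cn0); last exact: intble_epow.
rewrite gtr0_norm//; congr (_ * _); apply: eq_Rintegral => t _.
rewrite addr0 eball_scale//; congr (_ * _).
rewrite /epow /ecos /esin; congr (_ ^+ 2 + _ ^+ 2); apply: eq_bigr => k _;
  by rewrite dotrZl dotrZr mulrA mulVf// mul1r.
Qed.

Lemma separated_on_scale c d a : 0 < c -> separated_on om d a ->
  separated_on (fun k => c^-1 *: om k) (c^-1 * d) a.
Proof.
move=> c0 H k l kl ak al; rewrite -scalerBr enormZ gtr0_norm ?invr_gt0//.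
by rewrite ler_pM2l ?invr_gt0//; exact: H.
Qed.

Lemma separated_on_le d d' a : d' <= d -> separated_on om d a -> separated_on om d' a.
Proof. by move=> dd H k l kl ak al; rewrite (le_trans dd)// H. Qed.

End family.

Variable mu : R.
Hypothesis eig : dirichlet_eigenvalue (eball 1 : set V) mu.

(** A test function that is not 0 cannot live on a ball of measure 0. *)
Lemma vol1_gt0 : 0 < vol 1.
Proof.
have [phi [tphi p0 _]] := exists_test_function eig ltr01.
have bphi := bump_test tphi; have [M HM] := bphi.2.
have cphi := bump_compsupp bphi.
rewrite lt_def vol_ge0 andbT; apply/negP => /eqP v0.
have : autocorr phi 0 <= M * M * vol 1.
  rewrite -Rint_Z; last exact: intble_eball.
  apply: Rint_le; first exact: compsupp_shift_intble.
    by apply: intbleZ; exact: intble_eball.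
  move=> xi; rewrite addr0; apply: (le_trans (ler_norm _)); rewrite normrM.
  apply: (le_trans (ler_pM (normr_ge0 _) (normr_ge0 _) (HM xi) (HM xi))).
  by rewrite indicE; case: (_ \in _); rewrite ?mulr0 ?mulr1.
by rewrite v0 mulr0 leNgt p0.
Qed.

Lemma vol_gt0 r : 0 < r -> 0 < vol r.
Proof. by move=> r0; rewrite vol_scale// mulr_gt0 ?exprn_gt0 ?vol1_gt0. Qed.

(** The square of a test function is a nonnegative bump with a positive integral.
    Dilating the frequencies makes them 2-separated and the ball small. *)
Lemma upper_gap (gamma rho : R) : 0 < gamma -> 0 < rho ->
  exists2 D, 0 < D & forall (I : finType) (om : I -> V) (a : I -> R),
    separated_on om gamma a -> qform om rho a <= D * \sum_k a k ^+ 2.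
Proof.
move=> gamma0 rho0.
have [phi [tphi p0 _]] := exists_test_function eig ltr01.
have bphi := bump_test tphi.
pose H xi := phi xi ^+ 2.
have bH : bump H.
  have [cphi [M HM]] := bphi; split.
    move=> x; rewrite (_ : H = fun xi => phi xi * phi xi); first exact: (cvgM (cphi x) (cphi x)).
    by apply/funext => xi; rewrite /H expr2.
  exists (M ^+ 2) => xi; rewrite normrX.
  have := HM xi; rewrite indicE; case: (_ \in _); rewrite ?mulr1 ?mulr0.
    by move=> h; rewrite ler_pXn2r// nnegrE// (le_trans _ h).
  by rewrite normr_le0 => /eqP->; rewrite normr0 expr0n.
have H0 xi : 0 <= H xi by exact: sqr_ge0.
have JH : 0 < \int[leb]_xi H xi by rewrite -autocorr0.
pose eta := Num.min (gamma / 2) rho^-1.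
have eta0 : 0 < eta by rewrite lt_min divr_gt0//= invr_gt0.
have D0 : 0 <= upper_cst H.
  have k1 := ltW (@kern_low_gt0 R n); have k2 := ltW (@kern_mass_gt0 R n).
  have AH : 0 <= autocorr H 0 by apply: Rintegral_ge0 => xi _; rewrite mulr_ge0.
  by apply: mulr_ge0; [rewrite invr_ge0; apply: mulr_ge0 => //; exact: sqr_ge0|exact: mulr_ge0].
exists ((eta ^+ n)^-1 * (upper_cst H + 1)).
  by rewrite mulr_gt0 ?invr_gt0 ?exprn_gt0// ltr_wpDl.
move=> I om a sep.
rewrite -mulrA ler_pdivlMl ?exprn_gt0//.
have S0 : 0 <= \sum_k a k ^+ 2 by apply: sumr_ge0 => k _; exact: sqr_ge0.
apply: (@le_trans _ _ (upper_cst H * \sum_k a k ^+ 2)); last first.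
  by rewrite ler_wpM2r// lerDl.
rewrite -qform_scale//.
apply: (@le_trans _ _ (qform (fun k => eta^-1 *: om k) 1 a)).
  by apply: qform_le; rewrite -ler_pdivlMr// mul1r ge_min lexx orbT.
apply: upper_normalized => //.
apply: (separated_on_le _ (separated_on_scale eta0 sep)).
by rewrite ler_pdivlMl// -ler_pdivlMr// ge_min lexx.
Qed.

(** After a dilation that makes the frequencies 2-separated, the Rayleigh quotient
    of the test function only has to be less than the square of the radius. It is
    chosen according to the radius, so as to leave a factor proportional to
    r - 2 sqrt mu / gamma. *)
Lemma lower_gap (gamma rmax : R) : 0 < mu -> 0 < gamma -> 0 < rmax ->
  exists2 C, 0 < C & forall (I : finType) (om : I -> V) (a : I -> R) (r : R),
    separated_on om gamma a -> 2 * Num.sqrt mu / gamma < r <= rmax ->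
    (r - 2 * Num.sqrt mu / gamma) * \sum_k a k ^+ 2 <= C * qform om r a.
Proof.
move=> mu0 gamma0 rmax0; set sm := Num.sqrt mu.
have sm0 : 0 < sm by rewrite sqrtr_gt0.
have sm2 : sm ^+ 2 = mu by rewrite sqr_sqrtr// ltW.
pose eta := gamma / 2; have eta0 : 0 < eta by rewrite divr_gt0.
have m0 := @kern_mass_gt0 R n; have v0 := vol1_gt0.
exists (4 * rmax * vol 1 * eta ^+ n / kern_mass R n).
  by rewrite divr_gt0// !mulr_gt0// exprn_gt0.
move=> I om a r sep /andP[r1 r2].
set S := \sum_k a k ^+ 2; set q := qform om r a.
have S0 : 0 <= S by apply: sumr_ge0 => k _; exact: sqr_ge0.
have q0 : 0 <= q by exact: qform_ge0.
have E : 2 * sm / gamma = eta^-1 * sm by rewrite /eta; field; rewrite gt_eqF.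
rewrite E in r1 *.
have r0 : 0 < r by apply: lt_trans r1; rewrite mulr_gt0 ?invr_gt0.
have er : sm < eta * r by rewrite -ltr_pdivrMl.
have er2 : mu < (eta * r) ^+ 2 by rewrite -sm2 ltr_sqr ?nnegrE ?ltW// mulr_gt0.
(* Half of the available room, so that the Rayleigh quotient mu + delta still
   leaves a factor delta on the left of the normalized inequality. *)
pose delta := ((eta * r) ^+ 2 - mu) / 2.
have delta0 : 0 < delta by rewrite divr_gt0// subr_gt0.
have [phi [tphi p0 pmu]] := exists_test_function eig delta0.
have sep2 : separated_on (fun k => eta^-1 *: om k) 2 a.
  apply: (separated_on_le _ (separated_on_scale eta0 sep)).
  by rewrite /eta (_ : _ * gamma = 2)//; field; rewrite gt_eqF.
have := lower_normalized sep2 (ltW (mulr_gt0 eta0 r0)) (bump_test tphi)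
  (bump_partial tphi) (power_partial tphi).
rewrite qform_scale// -/q -/S -/(vol 1).
set A := autocorr phi 0 in p0 pmu *; set B := \sum_i _ in pmu *.
set x := eta * r in er er2 delta delta0 pmu *.
set W := eta ^+ n; have W0 : 0 < W by rewrite exprn_gt0.
set km := kern_mass R n in m0 *; set v := vol 1 in v0 * => H.
have x0 : 0 < x by rewrite mulr_gt0.
have h1 : km * delta * S <= 2 * x ^+ 2 * v * (W * q).
  rewrite -(ler_pM2l p0); rewrite [leRHS](_ : _ = 2 * x ^+ 2 * (A * v) * (W * q)); last by ring.
  apply: (le_trans _ H).
  rewrite [leLHS](_ : _ = km * S * (A * delta)); last by ring.
  rewrite [leRHS](_ : _ = km * S * (x ^+ 2 * A - B)); last by ring.
  rewrite ler_wpM2l//; first by rewrite mulr_ge0// ltW.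
  rewrite /delta; move: pmu; rewrite /delta; lra.
have h2 : x * (x - sm) <= 2 * delta.
  by rewrite /delta -sm2; nra.
have h3 : km * (x * (x - sm)) * S <= 4 * x ^+ 2 * v * (W * q).
  apply: (@le_trans _ _ (2 * (km * delta * S))); last by lra.
  rewrite [leRHS](_ : _ = km * (2 * delta) * S); last by ring.
  by rewrite ler_wpM2r// ler_wpM2l// ltW.
have h4 : km * (x - sm) * S <= 4 * x * v * (W * q).
  rewrite -(ler_pM2l x0) [leLHS](_ : _ = km * (x * (x - sm)) * S); last by ring.
  by rewrite [leRHS](_ : _ = 4 * x ^+ 2 * v * (W * q)); last by ring.
have h5 : km * (r - eta^-1 * sm) * S <= 4 * r * v * (W * q).
  rewrite -(ler_pM2l eta0).
  rewrite [leLHS](_ : _ = km * (x - sm) * S); last first.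
    by rewrite /x; field; rewrite gt_eqF.
  by rewrite [leRHS](_ : _ = 4 * x * v * (W * q)); last by rewrite /x; ring.
have h6 : km * (r - eta^-1 * sm) * S <= 4 * rmax * v * (W * q).
  apply: (le_trans h5); rewrite ler_wpM2r//; first by rewrite mulr_ge0// ltW.
  by rewrite (ler_wpM2r (ltW v0))// ler_wpM2l.
rewrite [leRHS](_ : _ = km^-1 * (4 * rmax * v * (W * q))); last by ring.
by rewrite ler_pdivlMl//; apply: (le_trans _ h6); rewrite mulrA.
Qed.

End one_family.

(** * The Gram form of a finite family of exponentials *)

Section gram.
Variables (R : realType) (n : nat).
Local Notation V := 'rV[R]_n.
Local Notation leb := (@lebesgue_rV R n).
Implicit Types (r : R) (s t w : V).

(** The Fourier transform of the indicator of a ball. *)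
Definition ball_fourier r w : R := \int[leb]_t (\1_(eball r) t * cos (dotr w t)).

Lemma intble_ball_cos r w theta :
  intble leb (fun t => \1_(eball r) t * cos (dotr w t + theta)).
Proof.
apply: intble_Mcos; first exact: intble_eball.
by apply: measurable_funD => //; exact: measurable_dotrr.
Qed.

Lemma ball_fourier0 r : ball_fourier r 0 = vol n r.
Proof. by apply: eq_Rintegral => t _; rewrite dotrC dotr0 cos0 mulr1. Qed.

Lemma ball_fourierN r w : ball_fourier r (- w) = ball_fourier r w.
Proof. by apply: eq_Rintegral => t _; rewrite dotrNl cosN. Qed.

(** The sine part vanishes because balls are symmetric. *)
Lemma ball_sin r w : \int[leb]_t (\1_(eball r) t * sin (dotr w t)) = 0.
Proof.
apply: Rint_odd => [|t]; last by rewrite indic_eballN dotrNr sinN mulrN.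
by apply: intble_Msin; [exact: intble_eball|exact: measurable_dotrr].
Qed.

Lemma ball_cos_phase r w theta :
  \int[leb]_t (\1_(eball r) t * cos (dotr w t + theta)) = ball_fourier r w * cos theta.
Proof.
rewrite Rint_cos_phase; last exact: intble_eball.
by rewrite /fsin ball_sin mulr0 subr0 mulrC.
Qed.

Section family.
Variables (I : finType) (om : I -> V).
Implicit Types (a b c : I -> R) (k l m : I) (P : pred I).

(** The symmetric bilinear form whose quadratic form is the integral of the
    squared modulus of the exponential sum over a ball. *)
Definition bform r a b : R := \sum_k \sum_l a k * b l * ball_fourier r (om k - om l).

Lemma ball_epow_shift r a s :
  \int[leb]_t (\1_(eball r) t * epow om a (t + s)) =
  \sum_k \sum_l a k * a l * (ball_fourier r (om k - om l) * cos (dotr (om k - om l) s)).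
Proof.
transitivity (\int[leb]_t (\sum_k \sum_l (a k * a l) *
    (\1_(eball r) t * cos (dotr (om k - om l) t + dotr (om k - om l) s)))).
  apply: eq_Rintegral => t _; rewrite epowE mulr_sumr; apply: eq_bigr => k _.
  by rewrite mulr_sumr; apply: eq_bigr => l _; rewrite dotrDr; ring.
rewrite Rint_sum => [|k _]; last first.
  by apply: intble_sum => l _; apply: intbleZ; exact: intble_ball_cos.
apply: eq_bigr => k _; rewrite Rint_sum => [|l _]; last first.
  by apply: intbleZ; exact: intble_ball_cos.
apply: eq_bigr => l _; rewrite Rint_Z; last exact: intble_ball_cos.
by rewrite ball_cos_phase.
Qed.

Lemma qformE r a : qform om r a = bform r a a.
Proof.
transitivity (\int[leb]_t (\1_(eball r) t * epow om a (t + 0))).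
  by apply: eq_Rintegral => t _; rewrite addr0.
rewrite ball_epow_shift; apply: eq_bigr => k _; apply: eq_bigr => l _.
by rewrite dotr0 cos0 mulr1.
Qed.

Lemma bformC r a b : bform r a b = bform r b a.
Proof.
rewrite /bform exchange_big; apply: eq_bigr => k _; apply: eq_bigr => l _ /=.
by rewrite -opprB ball_fourierN; ring.
Qed.

Lemma bform_comb r x y a b c :
  bform r (fun k => x * a k + y * b k) c = x * bform r a c + y * bform r b c.
Proof.
rewrite /bform !mulr_sumr -big_split; apply: eq_bigr => k _ /=.
rewrite !mulr_sumr -big_split; apply: eq_bigr => l _ /=; ring.
Qed.

Lemma qform_comb r x y a b : qform om r (fun k => x * a k + y * b k) =
  x ^+ 2 * qform om r a + 2 * (x * y) * bform r a b + y ^+ 2 * qform om r b.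
Proof.
rewrite !qformE bform_comb (bformC r a) (bformC r b) !bform_comb (bformC r b a); ring.
Qed.

Lemma bform_CS r a b : bform r a b ^+ 2 <= qform om r a * qform om r b.
Proof.
apply: discriminant_le; first exact: qform_ge0.
move=> t; have := qform_ge0 om r (fun k => 1 * a k + t * b k).
by rewrite qform_comb; lra.
Qed.

Definition delta m : I -> R := fun k => (k == m)%:R.

Lemma bform_delta r a m : bform r a (delta m) = \sum_k a k * ball_fourier r (om k - om m).
Proof.
apply: eq_bigr => k _; rewrite (bigD1 m)//= big1 ?addr0 => [|l lm].
  by rewrite /delta eqxx mulr1.
by rewrite /delta (negbTE lm) mulr0 mul0r.
Qed.

Lemma bform_sum_delta r a b : bform r a b = \sum_m b m * bform r a (delta m).
Proof.
rewrite {1}/bform exchange_big; apply: eq_bigr => m _ /=.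
by rewrite bform_delta mulr_sumr; apply: eq_bigr => k _; ring.
Qed.

Definition cos_rotation a s : I -> R := fun k => a k * cos (dotr (om k) s).
Definition sin_rotation a s : I -> R := fun k => a k * sin (dotr (om k) s).

(** Translating an exponential sum rotates its coefficients. *)
Lemma qform_translate_le r1 r2 a s : enorm s < r1 ->
  qform om r2 (cos_rotation a s) + qform om r2 (sin_rotation a s) <= qform om (r1 + r2) a.
Proof.
move=> sr.
have -> : qform om r2 (cos_rotation a s) + qform om r2 (sin_rotation a s) =
    \int[leb]_t (\1_(eball r2) t * epow om a (t + s)).
  rewrite ball_epow_shift !qformE /bform -big_split; apply: eq_bigr => k _ /=.
  rewrite -big_split; apply: eq_bigr => l _ /=.
  by rewrite /cos_rotation /sin_rotation dotrBl cosB; ring.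
pose F t := \1_(eball r2) (t - s) * epow om a t.
have iF : intble leb (fun t => \1_(eball r2) t * epow om a (t + s)).
  have [M M0 aM] := epow_le om a.
  apply: (@intble_ball _ _ _ _ M); last by move=> t; rewrite ger0_norm ?epow_ge0.
  under eq_fun do rewrite -[X in X + _]scale1r.
  exact: (measurableT_comp (measurable_epow om a) (measurable_affine_rV 1 s)).
have iF' : intble leb F.
  have := intble_affine_rV (- s) (oner_neq0 _) iF.
  by apply: eq_integrable => // t _ /=; rewrite scale1r subrK.
have -> : \int[leb]_t (\1_(eball r2) t * epow om a (t + s)) = \int[leb]_t F t.
  rewrite (Rint_affine_rV s (oner_neq0 _) iF') normr1 expr1n mul1r.
  by apply: eq_Rintegral => t _; rewrite /F scale1r addrK.
apply: Rint_le => //; first exact: intble_epow.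
move=> t; rewrite ler_wpM2r ?epow_ge0// !indicE.
case: (boolP (t - s \in _)) => // /set_mem /= H; rewrite mem_set//= /eball/=.
by rewrite -(subrK s t) (le_lt_trans (enormD _ _))// addrC ltrD.
Qed.

(** * Isolating one frequency *)

(** The frequency m may or may not belong to P; both cases occur. *)
Definition isolates m P r M := forall a,
  (forall k, a k != 0 -> P k || (k == m)) -> a m ^+ 2 <= M * qform om r a.

(** The functional which extracts the coefficient is bounded, hence represented
    by an element of the span (the Gram matrix may be singular: the functional
    vanishes on its kernel, so that it lies in its row space). *)
Lemma isolates_dual m P r M : 0 <= M -> isolates m P r M ->
  exists2 alpha, qform om r alpha <= M & forall k, P k || (k == m) ->
    bform r alpha (delta k) = (k == m)%:R.
Proof.
move=> M0 iso; pose P' k := P k || (k == m).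
pose E (i : 'I_#|I|) : I := enum_val i.
pose G : 'M[R]_#|I| := \matrix_(i, j)
  (if P' (E i) && P' (E j) then ball_fourier r (om (E i) - om (E j)) else 0).
have sumE (F : I -> R) : \sum_k F k = \sum_i F (E i).
  by rewrite (reindex E)//; exact/onW_bij/enum_val_bij.
have Gsym i j : G i j = G j i by rewrite !mxE andbC -opprB ball_fourierN.
pose im : 'I_#|I| := enum_rank m.
have GE (x : 'I_#|I| -> R) j :
    \sum_i x i * G i j = (if P' (E j) then
      bform r (fun k => if P' k then x (enum_rank k) else 0) (delta (E j)) else 0).
  case: ifP => Pj; last by rewrite big1// => i _; rewrite mxE Pj andbF mulr0.
  rewrite bform_delta sumE; apply: eq_bigr => i _; rewrite mxE Pj andbT.
  by case: ifP => _; rewrite ?mul0r ?mulr0// /E enum_valK.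
pose e : 'rV[R]_#|I| := delta_mx 0 im.
have : (e <= G)%MS.
  (* A column of the cokernel holds coefficients a of a sum with qform a = 0, and
     then isolates forces a m = 0. *)
  rewrite submxE; apply/eqP/rowP => j.
  have := mulmx_coker G; move: (cokermx G) => C GC.
  rewrite !mxE (bigD1 im)//= big1 => [|i ni]; last first.
    by rewrite mxE (negbTE ni) andbF mul0r.
  rewrite mxE !eqxx mul1r addr0.
  pose x i := C i j; pose a k := if P' k then x (enum_rank k) else 0.
  have suppa k : a k != 0 -> P' k by rewrite /a; case: ifP => //; rewrite eqxx.
  have qa : qform om r a = 0.
    rewrite qformE bform_sum_delta sumE big1// => i _.
    have := congr1 (fun A : 'M[R]_(#|I|) => A i j) GC; rewrite !mxE => Gi.
    have [Pi|Pi] := boolP (P' (E i)); last first.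
      have a0 : a (E i) = 0 by rewrite /a (negbTE Pi).
      by rewrite a0 mul0r.
    have S0 : \sum_l x l * G l i = 0.
      by rewrite -[RHS]Gi; apply: eq_bigr => l _; rewrite mulrC Gsym.
    by have := GE x i; rewrite Pi S0 => <-; rewrite mulr0.
  have := iso a suppa; rewrite qa mulr0 => am.
  have : a m ^+ 2 = 0 by apply/eqP; rewrite eq_le am sqr_ge0.
  by move=> /eqP; rewrite sqrf_eq0 /a /P' eqxx orbT => /eqP.
move=> /submxP[y yG].
pose alpha k := if P' k then y 0 (enum_rank k) else 0.
have aP k : P' k -> bform r alpha (delta k) = (k == m)%:R.
  move=> Pk; have := congr1 (fun A : 'rV[R]_(#|I|) => A 0 (enum_rank k)) yG.
  rewrite !mxE eqxx/= GE /E enum_rankK Pk => <-.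
  by rewrite (inj_eq (@enum_rank_inj I)).
have suppa k : alpha k != 0 -> P' k by rewrite /alpha; case: ifP => //; rewrite eqxx.
exists alpha => //.
(* By duality qform alpha = alpha m, while alpha m ^ 2 <= M qform alpha. *)
have qa : qform om r alpha = alpha m.
  rewrite qformE bform_sum_delta (bigD1 m)//= aP ?eqxx ?mulr1; last by rewrite /P' eqxx orbT.
  rewrite big1 ?addr0// => k km.
  have [Pk|Pk] := boolP (P' k); first by rewrite aP// (negbTE km) mulr0.
  have a0 : alpha k = 0 by rewrite /alpha (negbTE Pk).
  by rewrite a0 mul0r.
have := iso alpha suppa; have := qform_ge0 om r alpha; rewrite qa => am0.
have [->//|am] := eqVneq (alpha m) 0.
have amp : 0 < alpha m by rewrite lt_def am.
by rewrite expr2 ler_pM2r.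
Qed.

Lemma epow_bform r a alpha s : epow om (fun k => a k * bform r alpha (delta k)) s =
  bform r (cos_rotation a s) alpha ^+ 2 + bform r (sin_rotation a s) alpha ^+ 2.
Proof.
rewrite /epow /ecos /esin; congr (_ ^+ 2 + _ ^+ 2); rewrite bformC bform_sum_delta;
  by apply: eq_bigr => k _; rewrite /cos_rotation /sin_rotation; ring.
Qed.

(** Radii add up when families are joined: the multiplier that is dual to the
    frequency m in the first family removes that family from the sum, at the
    cost of evaluating the sum on translates of the ball. *)
Lemma isolates_union m P P2 r r2 M M2 : 0 <= M -> 0 <= M2 ->
  isolates m P r M -> isolates m P2 r2 M2 ->
  isolates m (fun k => P k || P2 k) (r + r2) (M2 * (M * vol n r2)).
Proof.
move=> M0 M20 iso iso2 a suppa.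
have [alpha qalpha dual] := isolates_dual M0 iso.
(* b keeps the coefficient of m and vanishes at the other points of P. *)
pose b k := a k * bform r alpha (delta k).
have bm : b m = a m by rewrite /b dual ?eqxx ?mulr1// orbT.
have suppb k : b k != 0 -> P2 k || (k == m).
  rewrite /b mulf_eq0 negb_or => /andP[ak bk].
  have := suppa k ak; case: (boolP (P k)) => [Pk _|_ /= //].
  by move: bk; rewrite dual ?Pk//; case: (k == m) => //; rewrite ?orbT// eqxx.
rewrite -bm; apply: (le_trans (iso2 b suppb)).
rewrite -mulrA ler_wpM2l// mulrAC -Rint_Z; last exact: intble_eball.
apply: Rint_le; first exact: intble_epow.
  by apply: intbleZ; exact: intble_eball.
move=> s; rewrite indicE; case: (boolP (s \in _)) => [/set_mem sr2|_]; last first.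
  by rewrite mul0r mulr0.
rewrite mul1r mulr1 epow_bform.
have h1 := bform_CS r (cos_rotation a s) alpha; have h2 := bform_CS r (sin_rotation a s) alpha.
have h3 := @qform_translate_le r2 r a s sr2; rewrite addrC in h3.
apply: (@le_trans _ _ ((qform om r (cos_rotation a s) + qform om r (sin_rotation a s)) * M)).
  rewrite mulrDl; apply: lerD.
    by apply: (le_trans h1); rewrite ler_wpM2l ?qform_ge0.
  by apply: (le_trans h2); rewrite ler_wpM2l ?qform_ge0.
by rewrite mulrC ler_wpM2l// addrC (addrC r).
Qed.

(** The upper estimate says that synthesis is bounded, hence so is its adjoint,
    which maps a sum to its inner products with the characters. *)
Lemma bessel D r c : 0 <= D -> (forall a, qform om r a <= D * \sum_k a k ^+ 2) ->
  \sum_m bform r c (delta m) ^+ 2 <= D * qform om r c.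
Proof.
move=> D0 HD; pose y m := bform r c (delta m).
have E : \sum_m y m ^+ 2 = bform r c y.
  by rewrite bform_sum_delta; apply: eq_bigr => m _; rewrite expr2.
rewrite -/(y _) E.
have Y0 : 0 <= bform r c y by rewrite -E; apply: sumr_ge0 => m _; exact: sqr_ge0.
have cs := bform_CS r c y; have := HD y; rewrite E => qy.
have q0 := qform_ge0 om r c.
have [->|yn0] := eqVneq (bform r c y) 0; first by rewrite mulr_ge0.
have yp : 0 < bform r c y by rewrite lt_def yn0.
rewrite -(ler_pM2r yp) -expr2 (le_trans cs)// -mulrA mulrCA ler_wpM2l//.
Qed.

(** Once every frequency can be isolated on one ball, all the coefficients are
    controlled at once on a slightly larger ball. *)
Lemma sum_isolates D M r eps : 0 <= M -> 0 <= D ->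
  (forall a, qform om eps a <= D * \sum_k a k ^+ 2) ->
  (forall m, isolates m predT r M) ->
  forall a, vol n eps ^+ 2 * \sum_m a m ^+ 2 <=
    M * D * vol n r * qform om (r + eps) a.
Proof.
move=> M0 D0 HD iso a.
(* The multiplier that smooths the sum by the ball of radius eps, centered at the
   frequency m. *)
pose b m k := a k * ball_fourier eps (om k - om m).
have bmm m : b m m = a m * vol n eps by rewrite /b subrr ball_fourier0.
apply: (@le_trans _ _ (\sum_m M * qform om r (b m))).
  rewrite mulr_sumr; apply: ler_sum => m _.
  by rewrite mulrC -exprMn -bmm; exact: iso.
rewrite -mulr_sumr -!mulrA ler_wpM2l// mulrA -Rint_sum => [|m _]; last exact: intble_epow.
rewrite mulrAC -Rint_Z; last exact: intble_eball.
apply: Rint_le.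
- by apply: intble_sum => m _; exact: intble_epow.
- by apply: intbleZ; exact: intble_eball.
move=> t; rewrite -mulr_sumr indicE; case: (boolP (t \in _)) => [/set_mem tr|_]; last first.
  by rewrite mul0r mulr0.
rewrite mul1r mulr1.
have eE m : epow om (b m) t = bform eps (cos_rotation a t) (delta m) ^+ 2 +
    bform eps (sin_rotation a t) (delta m) ^+ 2.
  rewrite /epow /ecos /esin !bform_delta; congr (_ ^+ 2 + _ ^+ 2);
    by apply: eq_bigr => k _; rewrite /cos_rotation /sin_rotation /b; ring.
under eq_bigr do rewrite eE.
rewrite big_split/=.
have h1 := bessel (cos_rotation a t) D0 HD; have h2 := bessel (sin_rotation a t) D0 HD.
apply: (le_trans (lerD h1 h2)); rewrite -mulrDr ler_wpM2l//.
exact: qform_translate_le.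
Qed.

End family.
End gram.

(** * Isolating a frequency from a family that does not contain it *)

Section sinc_gap.
Variable R : realType.
Local Notation leb1 := (@lebesgue_measure R).
Implicit Types y t : R.

Let intble_unit_box_cos y : intble leb1 (fun t : R => unit_box t * cos (y * t + 0)).
Proof.
apply: intble_Mcos; first exact: intble_unit_box.
by apply: measurable_funD => //; apply: measurable_funM.
Qed.

Let split_one_sub_cos y t : unit_box t * cos (0 * t + 0) - unit_box t * cos (y * t + 0) =
  unit_box t * (1 - cos (y * t)).
Proof. by rewrite mul0r !addr0 cos0; ring. Qed.

Lemma intble_one_sub_cos y : intble leb1 (fun t : R => unit_box t * (1 - cos (y * t))).
Proof.
have := intbleB (intble_unit_box_cos 0) (intble_unit_box_cos y).
by under eq_fun do rewrite split_one_sub_cos.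
Qed.

Lemma one_sub_sincE y : 1 - sinc y = \int[leb1]_t (unit_box t * (1 - cos (y * t))).
Proof.
under eq_Rintegral do rewrite -split_one_sub_cos.
rewrite Rint_B// !Rint_unit_box_cos cos0 !mulr1; congr (_ - _).
by rewrite /sinc eqxx.
Qed.

Lemma one_sub_sinc_ge0 y : 0 <= 1 - sinc y.
Proof.
rewrite one_sub_sincE; apply: Rintegral_ge0 => t _.
by rewrite mulr_ge0 ?unit_box_ge0// subr_ge0 cos_le1.
Qed.

Lemma one_sub_cos_ge y : `|y| <= 2 -> cos 1 ^+ 2 / 2 * y ^+ 2 <= 1 - cos y.
Proof.
rewrite -(cos_norm y) -(real_normK (num_real y)).
move: (normr_ge0 y); move: `|y| => a a0 a2.
have -> : 1 - cos a = 2 * sin (a / 2) ^+ 2.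
  have := cos2Dsin2 (a / 2); have -> : cos a = cos (a / 2 + a / 2) by congr cos; field.
  rewrite cosD -!expr2; lra.
have h : a / 2 * cos 1 <= sin (a / 2) by apply: sin_ge; apply/andP; split; lra.
have c0 : 0 <= cos 1 :> R.
  by have := @cos1_gt0 R; exact: ltW.
have h0 : 0 <= a / 2 * cos 1 by rewrite mulr_ge0// divr_ge0.
have : (a / 2 * cos 1) ^+ 2 <= sin (a / 2) ^+ 2.
  by rewrite ler_sqr// nnegrE// (le_trans h0).
rewrite exprMn; lra.
Qed.

Lemma one_sub_sinc_small y : `|y| <= 4 ->
  cos 1 ^+ 2 / 128 * y ^+ 2 <= 1 - sinc y.
Proof.
move=> y4; pose J : R -> R := \1_`[4^-1, 2^-1]%classic.
have iJ : intble leb1 J by exact: integrable_indic_itv.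
have -> : cos 1 ^+ 2 / 128 * y ^+ 2 =
    \int[leb1]_t (cos 1 ^+ 2 / 32 * y ^+ 2 * J t).
  rewrite Rint_Z//; have -> : \int[leb1]_t J t = 4^-1.
    transitivity (\int[leb1]_(t in `[4^-1, 2^-1]) (1 : R)).
      rewrite [RHS]Rintegral_mkcond; apply: eq_Rintegral => t _.
      by rewrite /J indicE patchE; case: ifP.
    rewrite [LHS](@Rintegral_cst _ _ _ leb1 `[4^-1, 2^-1]%classic)// mul1r.
    have := @lebesgue_measure_itv R `[4^-1, 2^-1]; rewrite /= lte_fin ifT; last by lra.
    by move=> ->/=; lra.
  by field.
rewrite one_sub_sincE; apply: Rint_le => [||t].
- exact: intbleZ.
- exact: intble_one_sub_cos.
rewrite /J !indicE; case: (boolP (t \in _)) => [/set_mem /=|_]; last first.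
  by rewrite mulr0 mulr_ge0 ?unit_box_ge0// subr_ge0 cos_le1.
rewrite in_itv/= => /andP[t4 t2]; rewrite mulr1 /unit_box indicE mem_set/=; last first.
  by rewrite in_itv/=; apply/andP; split; lra.
rewrite mul1r; have t0 : 0 <= t by lra.
apply: le_trans (one_sub_cos_ge _); last first.
  rewrite normrM (ger0_norm t0).
  have := ler_pM (normr_ge0 y) t0 y4 t2; lra.
rewrite exprMn [leRHS](_ : _ = cos 1 ^+ 2 / 2 * y ^+ 2 * t ^+ 2); last by ring.
have -> : cos 1 ^+ 2 / 32 * y ^+ 2 = cos 1 ^+ 2 / 2 * y ^+ 2 * (4^-1) ^+ 2 by field.
apply: ler_wpM2l; last by rewrite ler_sqr ?nnegrE.
by apply: mulr_ge0; [apply: divr_ge0 => //|]; exact: sqr_ge0.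
Qed.

Lemma one_sub_sinc_large y : 4 <= `|y| -> 2^-1 <= 1 - sinc y.
Proof.
move=> y4; have yn0 : y != 0 by rewrite -normr_gt0; lra.
suff : sinc y <= 2^-1 by lra.
rewrite /sinc (negbTE yn0); apply: (le_trans (ler_norm _)).
rewrite normrM normfV ler_pdivrMr ?normr_gt0// normrM.
have : `|sin (y / 2)| <= 1 by rewrite ler_norml sin_geN1 sin_le1.
by rewrite (ger0_norm (_ : 0 <= 2)) ?ler0n//; lra.
Qed.

(** Frequencies bounded away from 0 are seen at every scale s, with a loss that
    is quadratic in s. *)
Lemma one_sub_sinc_gap (g s0 : R) : 0 < g -> 0 < s0 ->
  exists2 kappa, 0 < kappa & forall s y, 0 < s <= s0 -> g * s <= `|y| ->
    kappa * s ^+ 2 <= 1 - sinc y.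
Proof.
move=> g0 s00; pose k1 := cos 1 ^+ 2 / 128 * g ^+ 2 : R; pose k2 := (2 * s0 ^+ 2)^-1.
have k10 : 0 < k1.
  by rewrite mulr_gt0 ?exprn_gt0// divr_gt0 ?exprn_gt0//; exact: cos1_gt0.
have k20 : 0 < k2 by rewrite invr_gt0 mulr_gt0// exprn_gt0.
exists (Num.min k1 k2); first by rewrite lt_min k10.
move=> s y /andP[s_gt0 ss0] gs; have s2 : 0 <= s ^+ 2 by exact: sqr_ge0.
have [y4|/ltW y4] := lerP `|y| 4.
  apply: le_trans (one_sub_sinc_small y4).
  apply: (@le_trans _ _ (k1 * s ^+ 2)); first by rewrite ler_wpM2r// ge_min lexx.
  rewrite /k1 -mulrA -exprMn; apply: ler_wpM2l; first by apply: divr_ge0 => //; exact: sqr_ge0.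
  rewrite -[y ^+ 2]real_normK ?num_real//.
  by rewrite ler_sqr ?nnegrE// mulr_ge0// ltW.
apply: le_trans (one_sub_sinc_large y4).
apply: (@le_trans _ _ (k2 * s0 ^+ 2)).
  apply: ler_pM => //; first by rewrite le_min !ltW.
    by rewrite ge_min lexx orbT.
  by rewrite ler_sqr ?nnegrE// ltW.
rewrite /k2 invfM mulrVK ?unitfE ?expf_neq0 ?gt_eqF//.
Qed.

End sinc_gap.

Section foreign.
Variables (R : realType) (n : nat).
Local Notation V := 'rV[R]_n.
Local Notation leb := (@lebesgue_rV R n).
Implicit Types (r : R).

Section family.
Variables (I : finType) (om : I -> V).
Implicit Types (a : I -> R) (m : I) (s : V).

Definition phase m s k : R := dotr (om k - om m) s.

(** Multiplying a_k by 1 - exp (i theta_k), where theta_k is the phase of k with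
    respect to m, subtracts from the sum a translate of it with a modulated phase.
    This removes the frequency m at the cost of a larger ball. *)
Lemma qform_difference_le r sigma a s m : enorm s < sigma ->
  qform om r (fun k => a k * (1 - cos (phase m s k))) +
  qform om r (fun k => a k * sin (phase m s k)) <= 4 * qform om (r + sigma) a.
Proof.
move=> ss; have s0 : 0 <= sigma by rewrite (le_trans (enorm_ge0 s))// ltW.
have h1 : qform om r a <= qform om (r + sigma) a by apply: qform_le; rewrite lerDl.
have h2 := @qform_translate_le R n I om sigma r a s ss; rewrite (addrC sigma) in h2.
set c := cos (dotr (om m) s); set d := sin (dotr (om m) s).
have cd : c ^+ 2 + d ^+ 2 = 1 by exact: cos2Dsin2.
pose ac k := c * cos_rotation om a s k + d * sin_rotation om a s k.
have uE : (fun k => a k * (1 - cos (phase m s k))) = (fun k => 1 * a k + (-1) * ac k).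
  apply/funext => k; rewrite /phase dotrBl cosB /ac /cos_rotation /sin_rotation -/c -/d; ring.
have vE : (fun k => a k * sin (phase m s k)) =
    (fun k => c * sin_rotation om a s k + (- d) * cos_rotation om a s k).
  apply/funext => k; rewrite /phase dotrBl sinB /cos_rotation /sin_rotation -/c -/d; ring.
have acE := qform_comb om r c d (cos_rotation om a s) (sin_rotation om a s).
have vE' := qform_comb om r c (- d) (sin_rotation om a s) (cos_rotation om a s).
rewrite (bformC om r (sin_rotation om a s)) in vE'.
have uE' := qform_comb om r 1 (-1) a ac.
have uE2 := qform_comb om r 1 1 a ac.
have p := qform_ge0 om r (fun k => 1 * a k + 1 * ac k).
have q := qform_ge0 om r (fun k => a k * sin (phase m s k)).
have rot : qform om r ac + qform om r (fun k => a k * sin (phase m s k)) =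
    qform om r (cos_rotation om a s) + qform om r (sin_rotation om a s).
  rewrite vE vE' acE.
  transitivity ((c ^+ 2 + d ^+ 2) *
      (qform om r (cos_rotation om a s) + qform om r (sin_rotation om a s))); first ring.
  by rewrite cd mul1r.
rewrite uE uE'; lra.
Qed.

End family.

Variable mu : R.
Hypothesis eig : dirichlet_eigenvalue (eball 1 : set V) mu.
Hypothesis mu0 : 0 < mu.

Lemma isolates_own (gj rmax : R) : 0 < gj -> 0 < rmax -> 
  exists2 C, 0 < C & forall (I : finType) (om : I -> V) (P : pred I) (m : I) (r : R),
    (forall k l, k != l -> P k -> P l -> gj <= enorm (om k - om l)) -> P m ->
    2 * Num.sqrt mu / gj < r <= rmax ->
    isolates om m P r (C * (r - 2 * Num.sqrt mu / gj)^-1).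
Proof.
move=> gj0 rmax0; have [C C0 HC] := lower_gap eig mu0 gj0 rmax0.
exists C => // I om P m r sep Pm rr a suppa.
have r0 : 0 < r - 2 * Num.sqrt mu / gj by rewrite subr_gt0; case/andP: rr.
have sa : separated_on om gj a.
  have suppP k : a k != 0 -> P k by move=> /suppa/orP[|/eqP->].
  by move=> k l kl /suppP Pk /suppP Pl; exact: sep.
rewrite mulrAC ler_pdivlMr// mulrC; apply: le_trans (HC I om a r sa rr).
rewrite ler_wpM2l ?(ltW r0)//.
by rewrite (bigD1 m)//= lerDl sumr_ge0// => k _; exact: sqr_ge0.
Qed.

Lemma coord_large (g : R) (z : V) : 0 < g -> g <= enorm z ->
  exists i, g / n.+1%:R <= `|z ord0 i|.
Proof.
move=> g0 gz; apply: contrapT => H.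
have h i : `|z ord0 i| <= g / n.+1%:R.
  by apply/ltW; rewrite ltNge; apply/negP => h; apply: H; exists i.
have : dotr z z <= n%:R * (g / n.+1%:R) ^+ 2.
  rewrite /dotr -[n in n%:R]card_ord mulr_natl -sumr_const.
  apply: ler_sum => i _; rewrite -expr2 -real_normK ?num_real//.
  by rewrite ler_sqr ?nnegrE// divr_ge0// ltW.
apply/negP; rewrite -ltNge.
have g2 : g ^+ 2 <= dotr z z by rewrite -sqr_enorm ler_sqr ?nnegrE ?enorm_ge0// ltW.
apply: lt_le_trans g2.
have n1 : 0 < n.+1%:R :> R by rewrite ltr0n.
rewrite exprMn mulrCA -[ltRHS]mulr1 ltr_pM2l ?exprn_gt0// exprVn.
rewrite ltr_pdivrMr ?exprn_gt0// mul1r -natrX ltr_nat.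
by rewrite (leq_trans (ltnSn n))// leq_pmulr.
Qed.

(** The coefficients u = a (1 - cos theta) and v = a sin theta, where theta is the
    phase for a shift s, vanish at m, so the estimate for P alone applies to them.
    They are small at the frequencies whose phase is close to 0 modulo 2 pi;
    averaging over the shifts of size e along the coordinate axes leaves none of these out, with a loss e^2 on top of the loss
    e of the estimate for P. *)
Lemma isolates_foreign_sum (g gj e0 : R) : 0 < g -> 0 < gj -> 0 < e0 ->
  exists2 K, 0 < K & forall (I : finType) (om : I -> V) (P : pred I) (m : I) (e : R) a,
    (forall k l, k != l -> g <= enorm (om k - om l)) ->
    (forall k l, k != l -> P k -> P l -> gj <= enorm (om k - om l)) ->
    0 < e <= e0 -> (forall k, a k != 0 -> P k || (k == m)) ->
    e ^+ 3 * (\sum_(k | k != m) a k ^+ 2) <=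
    K * qform om (2 * Num.sqrt mu / gj + e) a.
Proof.
move=> g0 gj0 e00; set Rj := 2 * Num.sqrt mu / gj.
have Rj0 : 0 < Rj by rewrite divr_gt0// mulr_gt0// sqrtr_gt0.
have [C C0 HC] := lower_gap eig mu0 gj0 (addr_gt0 Rj0 e00).
have gn0 : 0 < g / n.+1%:R by rewrite divr_gt0.
have [kap kap0 Hkap] := one_sub_sinc_gap gn0 e00.
exists (16 * C * n.+1%:R / kap); first by rewrite divr_gt0 ?mulr_gt0.
move=> I om P m e a sepg sepj /andP[e_gt0 ee0] suppa.
set Q := qform om (Rj + e) a; have Q0 : 0 <= Q by exact: qform_ge0.
have step1 s : enorm s < e / 2 ->
    e * \sum_k a k ^+ 2 * (1 - cos (phase om m s k)) <= 4 * C * Q.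
  move=> se; pose r' := Rj + e / 2.
  have r'r : Rj < r' <= Rj + e0 by rewrite /r'; apply/andP; split; lra.
  have supp0 (f : I -> R) : f m = 0 ->
      (forall k, f k != 0 -> a k != 0) -> separated_on om gj f.
    move=> fm fa; have fP k : f k != 0 -> P k.
      move=> fk; have := suppa k (fa k fk); case/orP => // /eqP km.
      by move: fk; rewrite km fm eqxx.
    by move=> k l kl fk fl; apply: sepj => //; exact: fP.
  pose u k := a k * (1 - cos (phase om m s k)).
  pose v k := a k * sin (phase om m s k).
  have pm : phase om m s m = 0 by rewrite /phase subrr dotrC dotr0.
  have su : separated_on om gj u.
    apply: supp0 => [|k]; first by rewrite /u pm cos0 subrr mulr0.
    by rewrite /u mulf_eq0 negb_or => /andP[].
  have sv : separated_on om gj v.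
    apply: supp0 => [|k]; first by rewrite /v pm sin0 mulr0.
    by rewrite /v mulf_eq0 negb_or => /andP[].
  have hu := HC I om u r' su r'r; have hv := HC I om v r' sv r'r.
  have huv := qform_difference_le om r' a m se.
  have rE : r' + e / 2 = Rj + e by rewrite /r'; field.
  rewrite rE in huv.
  have rB : r' - Rj = e / 2 by rewrite /r'; ring.
  rewrite rB in hu hv.
  have -> : e * \sum_k a k ^+ 2 * (1 - cos (phase om m s k)) =
      e / 2 * \sum_k u k ^+ 2 + e / 2 * \sum_k v k ^+ 2.
    rewrite -mulrDr -big_split/= !mulr_sumr; apply: eq_bigr => k _.
    have := cos2Dsin2 (phase om m s k); rewrite /u /v !exprMn.
    set x := cos _; set y := sin _ => xy.
    have -> : y ^+ 2 = 1 - x ^+ 2 by lra.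
    by field.
  have : C * (qform om r' u + qform om r' v) <= C * (4 * Q) by rewrite ler_pM2l.
  lra.
(* The shifts t h with |t| <= 1/2 stay within the ball of radius e / 2. *)
pose h := e / 2.
pose y k i := (om k - om m) ord0 i * h.
have step2 (i : 'I_n) : e * \sum_k a k ^+ 2 * (1 - sinc (y k i)) <= 4 * C * Q.
  pose F k (t : R) := unit_box t * (1 - cos (y k i * t)).
  have iF k : intble (@lebesgue_measure R) (F k) by exact: intble_one_sub_cos.
  have iS : intble (@lebesgue_measure R) (fun t => \sum_k a k ^+ 2 * F k t).
    by apply: intble_sum => k _; exact: intbleZ.
  have -> : \sum_k a k ^+ 2 * (1 - sinc (y k i)) =
      \int[@lebesgue_measure R]_t \sum_k a k ^+ 2 * F k t.
    rewrite Rint_sum => [|k _]; last exact: intbleZ.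
    by apply: eq_bigr => k _; rewrite one_sub_sincE Rint_Z.
  have := Rint_Z (4 * C * Q) (@intble_unit_box R); rewrite Rint_unit_box mulr1 => <-.
  rewrite -(Rint_Z e iS).
  apply: Rint_le => [||t]; first exact: intbleZ.
    by apply: intbleZ; exact: intble_unit_box.
  have [u0|] := eqVneq (unit_box t) 0.
    by rewrite u0 mulr0 /F u0 big1 ?mulr0// => k _; rewrite mul0r mulr0.
  rewrite /F /unit_box indicE; case: (boolP (t \in _)) => [/set_mem /=|_]; last by rewrite eqxx.
  rewrite in_itv/= => t2 _; rewrite mulr1 (_ : true%:R = 1)//.
  under eq_bigr do rewrite mul1r.
  have th : enorm ((t * h) *: (delta_mx ord0 i : V)) < e / 2.
    rewrite enormZ enorm_delta mulr1 normrM (gtr0_norm (_ : 0 < h)) ?divr_gt0//.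
    have t1 : `|t| <= 2^-1 by rewrite ler_norml.
    have := ler_wpM2r (ltW (divr_gt0 e_gt0 (ltr0n _ 2))) t1; rewrite /h; lra.
  apply: le_trans (step1 _ th); rewrite le_eqVlt; apply/orP; left; apply/eqP.
  congr (_ * _); apply: eq_bigr => k _; congr (_ * (1 - cos _)).
  by rewrite /phase dotrZr dotr_delta /y; ring.
have step3 k : k != m -> kap * h ^+ 2 <= \sum_i (1 - sinc (y k i)).
  move=> km; have [i gi] := coord_large g0 (sepg k m km).
  rewrite (bigD1 i)//= -[leLHS]addr0; apply: lerD; last first.
    by apply: sumr_ge0 => j _; exact: one_sub_sinc_ge0.
  have h0 : 0 < h by rewrite divr_gt0.
  apply: Hkap; first by rewrite h0/= /h; lra.
  by rewrite /y normrM (gtr0_norm h0) ler_wpM2r// ltW.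
have step4 : e * (\sum_(k | k != m) a k ^+ 2 * (kap * h ^+ 2)) <= n%:R * (4 * C * Q).
  apply: (@le_trans _ _ (\sum_(i < n) e * \sum_k a k ^+ 2 * (1 - sinc (y k i)))); last first.
    rewrite -[n in n%:R]card_ord mulr_natl -sumr_const; exact: ler_sum.
  rewrite -mulr_sumr ler_wpM2l ?(ltW e_gt0)// exchange_big/=.
  rewrite [leRHS](bigID (fun k => k != m))/= -[leLHS]addr0; apply: lerD.
    by apply: ler_sum => k km; rewrite -mulr_sumr ler_wpM2l ?sqr_ge0//; exact: step3.
  apply: sumr_ge0 => k _; apply: sumr_ge0 => i _.
  by rewrite mulr_ge0 ?sqr_ge0// one_sub_sinc_ge0.
have nn : n%:R * (4 * C * Q) <= n.+1%:R * (4 * C * Q).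
  by rewrite ler_wpM2r ?ler_nat// !mulr_ge0// ltW.
rewrite -mulr_suml in step4.
rewrite (mulrAC _ _ Q) ler_pdivlMr//.
have {}step4 := le_trans step4 nn.
have -> : e ^+ 3 * (\sum_(k | k != m) a k ^+ 2) * kap =
    4 * (e * ((\sum_(k | k != m) a k ^+ 2) * (kap * h ^+ 2))).
  by rewrite /h; field.
lra.
Qed.

(** The coefficient of m is what remains after the subtraction of the other terms,
    which the upper estimate controls. *)
Lemma isolates_foreign (g gj e0 : R) : 0 < g -> 0 < gj -> 0 < e0 ->
  exists2 K, 0 < K & forall (I : finType) (om : I -> V) (P : pred I) (m : I) (e : R),
    (forall k l, k != l -> g <= enorm (om k - om l)) ->
    (forall k l, k != l -> P k -> P l -> gj <= enorm (om k - om l)) ->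
    0 < e <= e0 -> isolates om m P (2 * Num.sqrt mu / gj + e) (K * (e ^+ 3)^-1).
Proof.
move=> g0 gj0 e00; have [K1 K10 HK] := isolates_foreign_sum g0 gj0 e00.
set Rj := 2 * Num.sqrt mu / gj in HK *.
have Rj0 : 0 < Rj by rewrite divr_gt0// mulr_gt0// sqrtr_gt0.
have [D D0 HD] := upper_gap eig g0 (addr_gt0 Rj0 e00).
have v0 : 0 < vol n Rj by exact: vol_gt0 eig _ Rj0.
exists ((2 * e0 ^+ 3 + 2 * D * K1) / vol n Rj).
  by rewrite divr_gt0// addr_gt0// !mulr_gt0// exprn_gt0.
move=> I om P m e sepg sepj ee a suppa.
have := HK I om P m e a sepg sepj ee suppa.
case/andP: ee => e_gt0 ee0.
set Q := qform om (Rj + e) a => QS; have Q0 : 0 <= Q by exact: qform_ge0.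
set S := \sum_(k | k != m) _ in QS.
have e3 : 0 < e ^+ 3 by rewrite exprn_gt0.
pose b k := if k == m then 0 else a k.
have qb : qform om (Rj + e) b <= D * S.
  apply: (@le_trans _ _ (qform om (Rj + e0) b)); first by apply: qform_le; rewrite lerD2l.
  apply: (le_trans (HD I om b _)).
    by move=> k l kl _ _; exact: sepg.
  rewrite ler_pM2l// (bigD1 m)//= {1}/b eqxx expr0n/= add0r.
  rewrite le_eqVlt; apply/orP; left; apply/eqP; apply: eq_bigr => k km.
  by rewrite /b (negbTE km).
have qd : qform om (Rj + e) (delta R m) = vol n (Rj + e).
  rewrite qformE bform_delta (bigD1 m)//= big1 ?addr0 => [|k km].
    by rewrite /delta eqxx mul1r subrr ball_fourier0.
  by rewrite /delta (negbTE km) mul0r.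
have am : a m ^+ 2 * vol n (Rj + e) <= 2 * Q + 2 * (D * S).
  have -> : a m ^+ 2 * vol n (Rj + e) = qform om (Rj + e) (fun k => 1 * a k + (-1) * b k).
    rewrite (_ : (fun k => 1 * a k + (-1) * b k) =
                 (fun k => a m * delta R m k + 0 * a k)).
      by rewrite qform_comb qd; ring.
    apply/funext => k; rewrite /b /delta; case: eqVneq => [->|_]/=; ring.
  have := qform_ge0 om (Rj + e) (fun k => 1 * a k + 1 * b k).
  rewrite !qform_comb -/Q; lra.
have vv : vol n Rj <= vol n (Rj + e) by apply: vol_le; rewrite lerDl ltW.
rewrite [leRHS]mulrAC ler_pdivlMr// [leRHS]mulrAC ler_pdivlMr//.
apply: (@le_trans _ _ (e ^+ 3 * (2 * Q + 2 * (D * S)))).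
  rewrite [leLHS](_ : _ = e ^+ 3 * (a m ^+ 2 * vol n Rj)); last by ring.
  rewrite ler_pM2l//; apply: le_trans am.
  by rewrite ler_wpM2l// sqr_ge0.
have h1 : e ^+ 3 * Q <= e0 ^+ 3 * Q.
  by rewrite ler_wpM2r// lerXn2r// nnegrE ltW// (lt_le_trans e_gt0).
have h2 : D * (e ^+ 3 * S) <= D * (K1 * Q) by rewrite ler_pM2l.
lra.
Qed.

End foreign.

(** * The lower estimate for finite families *)

Section finite.
Variables (R : realType) (n : nat).
Local Notation V := 'rV[R]_n.

Lemma isolates_leM (I : finType) (om : I -> V) m P (r M M' : R) : M <= M' ->
  isolates om m P r M -> isolates om m P r M'.
Proof.
by move=> MM iso a suppa; rewrite (le_trans (iso a suppa))// ler_wpM2r ?qform_ge0.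
Qed.

Lemma isolates_sub (I : finType) (om : I -> V) m (P P' : pred I) (r M : R) :
  (forall k, P' k -> P k) -> isolates om m P r M -> isolates om m P' r M.
Proof.
move=> PP iso a suppa; apply: iso => k /suppa /orP[/PP->//|->]; exact: orbT.
Qed.

Lemma uniform_const (J : finType) (Q : J -> R -> Prop) :
  (forall j C C', C <= C' -> Q j C -> Q j C') ->
  (forall j, exists2 C, 0 < C & Q j C) -> exists2 C, 0 < C & forall j, Q j C.
Proof.
move=> Qmono ex.
have {}ex j : exists C, 0 < C /\ Q j C by have [C ? ?] := ex j; exists C.
have [C HC] := choice ex; exists (1 + \sum_j C j).
  by rewrite ltr_wpDr// sumr_ge0// => j _; have [/ltW] := HC j.
move=> j; have [Cj QCj] := HC j; apply: Qmono QCj.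
rewrite (bigD1 j)//= addrCA lerDl addr_ge0//.
by apply: sumr_ge0 => i _; have [/ltW] := HC i.
Qed.

Variable mu : R.
Hypothesis eig : dirichlet_eigenvalue (eball 1 : set V) mu.

(** Start from the set that contains the frequency om m, at the cost of a factor
    1 / e, and join the others one by one, each at the cost of 1 / e ^ 3. *)
Lemma isolates_all (M : nat) (g : R) (gam : 'I_M -> R) (e0 : R) :
  0 < mu -> 0 < g -> (forall j, 0 < gam j) -> 0 < e0 ->
  exists2 C, 0 < C & forall (I : finType) (om : I -> V) (P : 'I_M -> pred I) (e : R),
    (forall k l, k != l -> g <= enorm (om k - om l)) ->
    (forall j k l, k != l -> P j k -> P j l -> gam j <= enorm (om k - om l)) ->
    (forall k, exists j, P j k) -> 0 < e <= e0 -> forall m,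
    isolates om m predT (\sum_j 2 * Num.sqrt mu / gam j + M%:R * e)
      (C / e ^+ (3 * M - 2)).
Proof.
move=> mu0 g0 gam0 e00; set Rj := fun j => 2 * Num.sqrt mu / gam j.
have Rj0 j : 0 < Rj j by rewrite divr_gt0// mulr_gt0// sqrtr_gt0.
pose own j C := forall (I : finType) (om : I -> V) (P : pred I) (m : I) (e : R),
  (forall k l, k != l -> P k -> P l -> gam j <= enorm (om k - om l)) -> P m ->
  0 < e <= e0 -> isolates om m P (Rj j + e) (C / e).
have [C C0 HC] : exists2 C, 0 < C & forall j, own j C.
  apply: uniform_const => [j C C' CC H I om P m e h1 h2 h3|j].
    apply: isolates_leM (H I om P m e h1 h2 h3).
    by rewrite ler_pM2r// invr_gt0; case/andP: h3.
  have [C C0 HC] := isolates_own eig mu0 (gam0 j) (addr_gt0 (Rj0 j) e00).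
  exists C => // I om P m e h1 h2 /andP[e1 e2].
  have := HC I om P m (Rj j + e) h1 h2.
  rewrite -/(Rj j) (_ : Rj j + e - Rj j = e); last by ring.
  by apply; apply/andP; split; lra.
pose foreign j K := forall (I : finType) (om : I -> V) (P : pred I) (m : I) (e : R),
  (forall k l, k != l -> g <= enorm (om k - om l)) ->
  (forall k l, k != l -> P k -> P l -> gam j <= enorm (om k - om l)) ->
  0 < e <= e0 -> isolates om m P (Rj j + e) (K / e ^+ 3).
have [K K0 HK] : exists2 K, 0 < K & forall j, foreign j K.
  apply: uniform_const => [j C1 C' CC H I om P m e h1 h2 h3|j].
    apply: isolates_leM (H I om P m e h1 h2 h3).
    by rewrite ler_pM2r// invr_gt0 exprn_gt0//; case/andP: h3.
  have H := isolates_foreign eig mu0 g0 (gam0 j) e00.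
  exact: H.
pose W := vol n (\sum_j Rj j + e0).
have W0 : 0 < W.
  by apply: (vol_gt0 eig); rewrite ltr_wpDl// sumr_ge0// => j _; exact: ltW.
exists (C * (K * W) ^+ M.-1); first by rewrite mulr_gt0// exprn_gt0// mulr_gt0.
move=> I om P e sepg sepj cov /[dup] ee /andP[e_gt0 ee0] m.
have [j0 Pj0] := cov m.
have fold (s : seq 'I_M) : isolates om m (fun k => P j0 k || has (P^~ k) s)
    (Rj j0 + e + \sum_(j <- s) (Rj j + e)) (C / e * (K * W / e ^+ 3) ^+ size s).
  elim: s => [|j s IHs].
    rewrite big_nil addr0 expr0 mulr1; apply: isolates_sub (HC j0 I om (P j0) m e (sepj j0) Pj0 ee).
    by move=> k; rewrite orbF.
  rewrite big_cons addrA addrAC.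
  apply: (@isolates_sub _ _ _ (fun k => (P j0 k || has (P^~ k) s) || P j k)).
    by move=> k /=; case: (P j0 k) => //=; case: (P j k) => //=; rewrite ?orbT ?orbF.
  have B0 : 0 <= C / e * (K * W / e ^+ 3) ^+ size s.
    by rewrite mulr_ge0 ?exprn_ge0 ?divr_ge0 ?mulr_ge0 ?exprn_ge0// ltW.
  have D0 : 0 <= K / e ^+ 3 by rewrite divr_ge0 ?exprn_ge0 ?ltW.
  apply: isolates_leM (isolates_union B0 D0 IHs (HK j I om (P j) m e sepg (sepj j) ee)).
  rewrite [leRHS](_ : _ = K / e ^+ 3 * (C / e * (K * W / e ^+ 3) ^+ size s * W)); last first.
    by rewrite [size _]/= [(K * W / _) ^+ _]exprS; move: (_ ^+ size s) => X; ring.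
  apply: ler_wpM2l => //; apply: ler_wpM2l => //; apply: vol_le; apply: lerD => //.
  by rewrite (bigD1 j)//= lerDl sumr_ge0// => i _; exact: ltW.
have szs : size [seq j <- index_enum 'I_M | j != j0] = M.-1.
  have := cardC1 j0; rewrite card_ord => <-.
  by rewrite cardE /enum_mem size_filter -!size_filter.
have M0 : (0 < M)%N by case: (M) j0 {Pj0 fold szs} => // -[].
have := fold [seq j <- index_enum 'I_M | j != j0].
rewrite szs big_filter.
have -> : Rj j0 + e + \sum_(j | j != j0) (Rj j + e) = \sum_j Rj j + M%:R * e.
  rewrite -(bigD1 (P := predT) (F := fun j => Rj j + e) j0)//= big_split/= sumr_const card_ord.
  by rewrite mulr_natl.
have -> : C / e * (K * W / e ^+ 3) ^+ M.-1 = C * (K * W) ^+ M.-1 / e ^+ (3 * M - 2).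
  rewrite exprMn exprVn -exprM mulrACA -invfM -exprS; congr (_ / e ^+ _).
  by clear -M0; lia.
apply: isolates_sub => k _; have [j Pjk] := cov k.
have [jj0|jj0] := eqVneq j j0; first by rewrite -jj0 Pjk.
by apply/orP; right; apply/hasP; exists j => //; rewrite mem_filter jj0 mem_index_enum.
Qed.

(** Each of the M sets and the final smoothing enlarge the radius by e, which gives
    e = (r - R0) / (M + 1). Isolation costs the power 3 M - 2 of e and smoothing,
    through the volume of the ball of radius e, the power 2 n. Their sum is at most
    5 M - 4 + 2 n, and r - R0 <= R0 absorbs the difference. *)
Lemma finite_lower (M : nat) (g : R) (gam : 'I_M -> R) :
  (0 < M)%N -> 0 < g -> (forall j, 0 < gam j) ->
  exists2 c, 0 < c & forall (I : finType) (om : I -> V) (P : 'I_M -> pred I) (r : R),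
    (forall k l, k != l -> g <= enorm (om k - om l)) ->
    (forall j k l, k != l -> P j k -> P j l -> gam j <= enorm (om k - om l)) ->
    (forall k, exists j, P j k) ->
    let R0 := \sum_j 2 * Num.sqrt mu / gam j in R0 < r <= 2 * R0 ->
    forall a, c * (r - R0) ^+ (5 * M - 4 + 2 * n) * \sum_k a k ^+ 2 <= qform om r a.
Proof.
move=> M0 g0 gam0; set R0 := \sum_j _.
have [mu0|mu0] := lerP mu 0.
  exists 1 => // I om P r _ _ _ /=; have -> : R0 = 0.
    by apply: big1 => j _; rewrite ler0_sqrtr// mulr0 mul0r.
  by rewrite mulr0 => /andP[r1 /(lt_le_trans r1)]; rewrite ltxx.
have R00 : 0 < R0.
  rewrite /R0 (bigD1 (Ordinal M0))//= ltr_wpDr ?sumr_ge0// => [j _|].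
    by rewrite divr_ge0 ?mulr_ge0 ?sqrtr_ge0// ltW.
  by rewrite divr_gt0// mulr_gt0// sqrtr_gt0.
have [C C0 HC] := isolates_all mu0 g0 gam0 R00.
have [D D0 HD] := upper_gap eig g0 R00.
have V0 := vol1_gt0 eig.
pose W := vol n (2 * R0).
have W0 : 0 < W by apply: (vol_gt0 eig); rewrite mulr_gt0.
have M1 : 0 < M.+1%:R :> R by rewrite ltr0n.
pose p := (2 * n + (3 * M - 2))%N.
pose c := vol n 1 ^+ 2 / (C * D * W) / M.+1%:R ^+ p / R0 ^+ (2 * M - 2).
have c0 : 0 < c.
  by rewrite !divr_gt0 ?exprn_gt0// !mulr_gt0.
exists c => // I om P r sepg sepj cov /= /andP[rR0 r2R0] a.
pose e := (r - R0) / M.+1%:R.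
have rR : 0 < r - R0 by rewrite subr_gt0.
have e_gt0 : 0 < e by rewrite divr_gt0.
have eR0 : e <= R0.
  rewrite /e ler_pdivrMr//; apply: (@le_trans _ _ R0); first lra.
  by rewrite ler_peMr ?(ltW R00)// ler1n.
have ee : 0 < e <= R0 by rewrite e_gt0.
have iso := HC I om P e sepg sepj cov ee.
have Me : 0 < e ^+ (3 * M - 2) by rewrite exprn_gt0.
have CM0 : 0 <= C / e ^+ (3 * M - 2) by apply/ltW/divr_gt0.
have up b : qform om e b <= D * \sum_k b k ^+ 2.
  apply: le_trans (HD I om b _); first exact: qform_le.
  by move=> k l kl _ _; exact: sepg.
have := sum_isolates CM0 (ltW D0) up iso a.
have -> : R0 + M%:R * e + e = r.
  have -> : R0 + M%:R * e + e = R0 + M.+1%:R * e by rewrite -natr1; ring.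
  by rewrite /e mulrC mulfVK ?gt_eqF// addrC subrK.
set Q := qform om r a; have Q0 : 0 <= Q by exact: qform_ge0.
set S := \sum_k _; have S0 : 0 <= S by apply: sumr_ge0 => k _; exact: sqr_ge0.
have Wle : vol n (R0 + M%:R * e) <= W.
  apply: vol_le; have : M%:R * e <= r - R0.
    rewrite /e mulrA ler_pdivrMr// mulrC ler_pM2l//.
    by rewrite ler_nat.
  lra.
rewrite (vol_scale _ e_gt0) => H.
have {}H : e ^+ p * (vol n 1 ^+ 2 * S) <= C * D * W * Q.
  have : (e ^+ n * vol n 1) ^+ 2 * S <= C / e ^+ (3 * M - 2) * D * W * Q.
    apply: (le_trans H); rewrite ler_wpM2r// ler_wpM2l// mulr_ge0// ltW//.
  rewrite [leRHS](_ : _ = C * D * W * Q / e ^+ (3 * M - 2)); last by ring.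
  rewrite ler_pdivlMr//; apply: le_trans; rewrite /p exprD mulnC exprM exprMn.
  by rewrite le_eqVlt; apply/orP; left; apply/eqP; ring.
have pE : (5 * M - 4 + 2 * n = p + (2 * M - 2))%N.
  by rewrite /p; clear -M0; lia.
rewrite pE exprD.
have h1 : (r - R0) ^+ (2 * M - 2) <= R0 ^+ (2 * M - 2).
  by rewrite lerXn2r ?nnegrE//; lra.
have h2 : (r - R0) ^+ p = e ^+ p * M.+1%:R ^+ p.
  by rewrite -exprMn /e mulfVK ?gt_eqF.
apply: (@le_trans _ _ (c * ((r - R0) ^+ p * R0 ^+ (2 * M - 2)) * S)).
  apply: ler_wpM2r => //; apply: ler_wpM2l; first exact: ltW.
  by apply: ler_wpM2l => //; rewrite exprn_ge0// ltW.
have Rp : R0 ^+ (2 * M - 2) != 0 by rewrite expf_neq0 ?gt_eqF.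
have Mp : M.+1%:R ^+ p != 0 :> R by rewrite expf_neq0 ?gt_eqF.
have CDW : 0 < C * D * W by rewrite !mulr_gt0.
have cE : c * (M.+1%:R ^+ p * R0 ^+ (2 * M - 2)) = vol n 1 ^+ 2 / (C * D * W).
  by rewrite /c (mulrC (_ ^+ p)) mulrA !mulfVK.
have -> : c * ((r - R0) ^+ p * R0 ^+ (2 * M - 2)) * S =
    c * (M.+1%:R ^+ p * R0 ^+ (2 * M - 2)) * (e ^+ p * S).
  have rearr (x y z w t : R) : x * (y * z * w) * t = x * (z * w) * (y * t) by ring.
  by rewrite h2 rearr.
rewrite cE mulrAC ler_pdivrMr// mulrCA [leRHS]mulrC.
exact: H.
Qed.

End finite.

(** * Complex coefficients *)

Section complex_sums.
Local Open Scope complex_scope.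
Variables (R : realType) (n : nat).
Local Notation V := 'rV[R]_n.
Local Notation leb := (@lebesgue_rV R n).

Lemma sqnormcE (a b : R) : sqnormc (a +i* b) = a ^+ 2 + b ^+ 2.
Proof. by rewrite /sqnormc /= sqr_sqrtr// addr_ge0 ?sqr_ge0. Qed.

Lemma sqnormc_ge0 (z : R[i]) : 0 <= sqnormc z.
Proof. exact: sqr_ge0. Qed.

Lemma sqnormc_split (z : R[i]) : sqnormc z = complex.Re z ^+ 2 + complex.Im z ^+ 2.
Proof. by case: z => a b; rewrite sqnormcE. Qed.

Lemma sqnormcD_le (z w : R[i]) : sqnormc (z + w) <= 2 * sqnormc z + 2 * sqnormc w.
Proof.
case: z w => a b [c d]; rewrite [X in sqnormc X](_ : _ = ((a + c) +i* (b + d))%C)//.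
rewrite !sqnormcE.
by have := sqr_ge0 (a - c); have := sqr_ge0 (b - d); lra.
Qed.

Lemma sqnormcN (z : R[i]) : sqnormc (- z) = sqnormc z.
Proof. by case: z => a b; rewrite [- _](_ : _ = (- a) +i* (- b))// !sqnormcE !sqrrN. Qed.

Section family.
Variables (K : choiceType) (omega : K -> V).
Implicit Types (x : K -> R[i]) (F : {fset K}) (r : R).

Definition freqs F (k : F) : V := omega (val k).
Definition re_coef x F (k : F) : R := complex.Re (x (val k)).
Definition im_coef x F (k : F) : R := complex.Im (x (val k)).
Arguments re_coef x F k : clear implicits.
Arguments im_coef x F k : clear implicits.

Lemma exp_sumE x F t : exp_sum omega x F t =
  (ecos (@freqs F) (re_coef x F) t - esin (@freqs F) (im_coef x F) t) +i*
  (esin (@freqs F) (re_coef x F) t + ecos (@freqs F) (im_coef x F) t).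
Proof.
have H (s : seq K) : \sum_(k <- s) x k * cexpi (dotr (omega k) t) =
    (\sum_(k <- s) (complex.Re (x k) * cos (dotr (omega k) t) -
      complex.Im (x k) * sin (dotr (omega k) t))) +i*
    (\sum_(k <- s) (complex.Re (x k) * sin (dotr (omega k) t) +
      complex.Im (x k) * cos (dotr (omega k) t))).
  elim: s => [|k s IHs]; first by rewrite !big_nil.
  by rewrite !big_cons IHs; case: (x k).
by rewrite /exp_sum H sumrB big_split/= !big_seq_fsetE.
Qed.

Lemma sq_sumE x F : \sum_(k <- F) sqnormc (x k) =
  \sum_k re_coef x F k ^+ 2 + \sum_k im_coef x F k ^+ 2.
Proof.
rewrite big_seq_fsetE/= -big_split; apply: eq_bigr => k _; exact: sqnormc_split.
Qed.

Lemma sq_intE r (f : V -> R[i]) :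
  sq_int r f = (\int[leb]_t (\1_(eball r) t * sqnormc (f t))%:E)%E.
Proof.
rewrite /sq_int integral_mkcond; apply: eq_integral => t _.
by rewrite patchE indicE; case: ifP; rewrite ?mul1r ?mul0r.
Qed.

(** The two families of real coefficients are orthogonal on a ball, since the
    mixed terms are odd. *)
Lemma sq_int_exp_sum r x F : sq_int r (exp_sum omega x F) =
  (qform (@freqs F) r (re_coef x F) + qform (@freqs F) r (im_coef x F))%:E.
Proof.
set om := @freqs F; set p := re_coef x F; set q := im_coef x F.
have m_ecos := measurable_ecos om; have m_esin := measurable_esin om.
pose g t := esin om p t * ecos om q t - ecos om p t * esin om q t.
have ig : intble leb (fun t => \1_(eball r) t * g t).
  pose C := (\sum_k `|p k|) * (\sum_k `|q k|).
  apply: (@intble_ball _ _ _ _ (C + C)).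
    by apply: measurable_funB; apply: measurable_funM.
  move=> t; rewrite (le_trans (ler_normB _ _))// !normrM.
  by apply: lerD; apply: ler_pM => //; rewrite ?ecos_le ?esin_le.
have odd t : \1_(eball r) (- t) * g (- t) = - (\1_(eball r) t * g t).
  have ec a : ecos om a (- t) = ecos om a t.
    by apply: eq_bigr => k _; rewrite dotrNr cosN.
  have es a : esin om a (- t) = - esin om a t.
    by rewrite /esin -sumrN; apply: eq_bigr => k _; rewrite dotrNr sinN mulrN.
  by rewrite indic_eballN /g !ec !es; ring.
rewrite sq_intE.
transitivity ((\int[leb]_t (\1_(eball r) t * epow om p t + \1_(eball r) t * epow om q t +
    2 * (\1_(eball r) t * g t))%:E)%E).
  apply: eq_integral => t _; rewrite exp_sumE sqnormcE -/om -/p -/q; congr EFin.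
  by rewrite /epow /g; ring.
have ip := intble_epow om r p; have iq := intble_epow om r q.
rewrite -Rint_E; last by apply: intbleD; [exact: intbleD|exact: intbleZ].
by rewrite !Rint_D ?Rint_Z ?(Rint_odd ig odd) ?mulr0 ?addr0//; [exact: intbleD|exact: intbleZ].
Qed.

End family.
End complex_sums.

(** * Infinite sums *)

Lemma sum_fsetD (K : choiceType) (W : nmodType) (F0 F : {fset K}) (G : K -> W) :
  (F0 `<=` F)%fset ->
  \sum_(k <- F) G k = \sum_(k <- F0) G k + \sum_(k <- (F `\` F0)%fset) G k.
Proof.
move=> /fsubsetP sub; rewrite -big_cat; apply: perm_big; apply: uniq_perm.
- exact: fset_uniq.
- rewrite cat_uniq !fset_uniq andbT/=; apply/hasPn => k.
  by rewrite in_fsetD => /andP[].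
- move=> k; rewrite mem_cat in_fsetD.
  by have [/sub ->//|] := boolP (k \in F0).
Qed.

(** Differences weighted by powers of 2 control a sequence by its steps, because
    of the inequality |z + w|^2 <= 2 |z|^2 + 2 |w|^2. *)
Lemma weighted_steps (R : realType) (z : nat -> R[i]) k n :
  sqnormc (z (n + k)%N - z n) <= 2 / 2 ^+ n *
    \sum_(n <= j < n + k) 2 ^+ j * sqnormc (z j.+1 - z j).
Proof.
elim: k n => [|k IHk] n.
  rewrite addn0 subrr big_geq// mulr0 (_ : 0 = (0 +i* 0)%C)// sqnormcE; lra.
have -> : z (n + k.+1)%N - z n = (z n.+1 - z n) + (z (n.+1 + k)%N - z n.+1).
  by rewrite addSnnS [RHS]addrC subrKA.
apply: (le_trans (sqnormcD_le _ _)); rewrite big_ltn ?addnS ?ltnS ?leq_addr//.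
rewrite -addSn mulrDr; apply: lerD.
  have p0 : 2 ^+ n != 0 :> R by rewrite expf_neq0// pnatr_eq0.
  by rewrite [leRHS]mulrA divfK.
have := IHk n.+1; set S := \sum_(_ <= _ < _) _.
rewrite [2 ^+ n.+1]exprS invfM mulrA mulfV ?pnatr_eq0// => h.
by rewrite div1r in h; rewrite -mulrA ler_pM2l.
Qed.

Section limits.
Local Open Scope complex_scope.
Variables (R : realType) (n : nat).
Local Notation V := 'rV[R]_n.
Local Notation leb := (@lebesgue_rV R n).
Implicit Types (f g : V -> R[i]).

Definition cmeasurable r f :=
  measurable_fun (eball r) (fun t => complex.Re (f t)) /\
  measurable_fun (eball r) (fun t => complex.Im (f t)).

Lemma cmeasurableB r f g : cmeasurable r f -> cmeasurable r g ->
  cmeasurable r (fun t => f t - g t).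
Proof.
have E1 t : complex.Re (f t - g t) = complex.Re (f t) - complex.Re (g t).
  by case: (f t) (g t) => a b [].
have E2 t : complex.Im (f t - g t) = complex.Im (f t) - complex.Im (g t).
  by case: (f t) (g t) => a b [].
move=> [f1 f2] [g1 g2]; split.
  by under eq_fun do rewrite E1; exact: measurable_funB.
by under eq_fun do rewrite E2; exact: measurable_funB.
Qed.

Lemma measurable_sqnormc r f : cmeasurable r f ->
  measurable_fun (eball r) (fun t => sqnormc (f t)).
Proof.
move=> [f1 f2]; under eq_fun do rewrite sqnormc_split.
by apply: measurable_funD; exact: measurable_funX.
Qed.

Lemma measurable_Esqnormc r f : cmeasurable r f ->
  measurable_fun (eball r) (fun t => (sqnormc (f t))%:E).
Proof. by move=> mf; apply/measurable_EFinP; exact: measurable_sqnormc. Qed.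

Lemma sq_int_le r f g h : cmeasurable r f -> cmeasurable r g -> cmeasurable r h ->
  (forall t, sqnormc (f t) <= 2 * sqnormc (g t) + 2 * sqnormc (h t)) ->
  (sq_int r f <= 2%:E * sq_int r g + 2%:E * sq_int r h)%E.
Proof.
move=> mf mg mh fgh; have mB := @measurable_eball R n r.
have mf' := measurable_Esqnormc mf; have mg' := measurable_Esqnormc mg.
have mh' := measurable_Esqnormc mh.
have m2 (u : V -> R) : measurable_fun (eball r) (fun t => (u t)%:E) ->
    measurable_fun (eball r) (fun t => (2%:E * (u t)%:E)%E).
  by move=> mu; apply: emeasurable_funM.
rewrite /sq_int -!ge0_integralZl//; try by move=> t _; rewrite lee_fin sqnormc_ge0.
rewrite -ge0_integralD//;
  try by [exact: m2|move=> t _; rewrite -EFinM lee_fin mulr_ge0// sqnormc_ge0].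
apply: ge0_le_integral => //.
- by move=> t _; rewrite lee_fin sqnormc_ge0.
- by apply: emeasurable_funD; exact: m2.
- by move=> t _; rewrite -!EFinM -EFinD lee_fin.
Qed.

Section family.
Variables (K : choiceType) (omega : K -> V) (x : K -> R[i]).
Implicit Types (F : {fset K}).

Lemma cmeasurable_exp_sum r F : cmeasurable r (exp_sum omega x F).
Proof.
split; apply: (@measurable_funTS) => /=; under eq_fun do rewrite exp_sumE/=.
  by apply: measurable_funB; [exact: measurable_ecos|exact: measurable_esin].
by apply: measurable_funD; [exact: measurable_esin|exact: measurable_ecos].
Qed.

Lemma exp_sum_sub F0 F t : (F0 `<=` F)%fset ->
  exp_sum omega x F t - exp_sum omega x F0 t = exp_sum omega x (F `\` F0)%fset t.
Proof. by move=> sub; rewrite /exp_sum (sum_fsetD _ sub) addrC addKr. Qed.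

Let S F : R := \sum_(k <- F) sqnormc (x k).

Lemma le_sq_sum F : ((S F)%:E <= sq_sum x)%E.
Proof.
apply: esum_ge; exists [set` F]; first by split; [exact: finite_fset|].
by rewrite -fsbig_seq ?fset_uniq// sumEFin.
Qed.

Lemma sq_sum_fset_mono F0 F : (F0 `<=` F)%fset -> S F0 <= S F.
Proof.
by move=> sub; rewrite /S (sum_fsetD _ sub) lerDl sumr_ge0// => k _; exact: sqnormc_ge0.
Qed.

Lemma sq_sum_ge0 : (0 <= sq_sum x)%E.
Proof. by apply: esum_ge0 => k _; rewrite lee_fin sqnormc_ge0. Qed.

Hypothesis sfin : (sq_sum x < +oo)%E.

Lemma sq_sum_fin : sq_sum x \is a fin_num.
Proof. by rewrite ge0_fin_numE// sq_sum_ge0. Qed.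

Lemma S_le F : S F <= fine (sq_sum x).
Proof. by rewrite -lee_fin fineK ?sq_sum_fin// le_sq_sum. Qed.

Lemma sq_sum_tail (e : R) : 0 < e -> exists F0, forall F, (F0 `<=` F)%fset ->
  fine (sq_sum x) - e <= S F.
Proof.
move=> e0; have [_ [A [finA _] <-] hA] := ub_ereal_sup_adherent e0 sq_sum_fin.
exists (fset_set A) => F sub; apply: le_trans (sq_sum_fset_mono sub).
rewrite -lee_fin EFinB fineK ?sq_sum_fin//; apply/ltW/(lt_le_trans hA).
by rewrite fsbig_finite//= sumEFin.
Qed.

(** The partial sums over the sets Gs j have squared steps of integral O(4^-j).
    The weights 2^j make the weighted sum G of the squared steps control the
    whole sequence at once: at a point where G is finite the partial sums form a
    Cauchy sequence, and everywhere the limit is within 2^(1-j) G of the j-th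
    partial sum. *)
Lemma exp_series_exists r D : 0 <= D ->
  (forall F, (sq_int r (exp_sum omega x F) <= (D * S F)%:E)%E) ->
  exists f, exp_series omega r x f.
Proof.
move=> D0 HD; have mB := @measurable_eball R n r.
have q0 j : 0 < (4^-1 : R) ^+ j by rewrite exprn_gt0.
have [T HT] := choice (fun j => sq_sum_tail (q0 j)).
pose Gs := fix Gs j := if j is i.+1 then (Gs i `|` T i.+1)%fset else T 0%N.
have GsS j : (Gs j `<=` Gs j.+1)%fset by exact: fsubsetUl.
have TGs j : (T j `<=` Gs j)%fset by case: j => //= j; exact: fsubsetUr.
have tail j F : (Gs j `<=` F)%fset -> S (F `\` Gs j)%fset <= 4^-1 ^+ j.
  move=> sub; have := HT j _ (TGs j); have := S_le F.
  rewrite /S (sum_fsetD _ sub); lra.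
pose f_ j := exp_sum omega x (Gs j).
have mf j : cmeasurable r (f_ j) by exact: cmeasurable_exp_sum.
pose d j t := sqnormc (f_ j.+1 t - f_ j t).
have d0 j t : 0 <= d j t by exact: sqnormc_ge0.
have md j : measurable_fun (eball r) (fun t => (2 ^+ j * d j t)%:E).
  apply/measurable_EFinP; apply: measurable_funM => //.
  by apply: measurable_sqnormc; exact: cmeasurableB.
pose G t : \bar R := (\sum_(0 <= j <oo) (2 ^+ j * d j t)%:E)%E.
have w0 j t : (0 <= (2 ^+ j * d j t)%:E)%E.
  by rewrite lee_fin; apply: mulr_ge0 => //; apply: exprn_ge0.
have mG : measurable_fun (eball r) G.
  by apply: ge0_emeasurable_sum => // j t _ _; exact: w0.
have G0 t : (0 <= G t)%E by apply: nneseries_ge0 => j _ _; exact: w0.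
have intG : (\int[leb]_(t in eball r) G t <= (D * 2)%:E)%E.
  rewrite integral_nneseries//.
  apply: lime_le; first by apply: is_cvg_nneseries => j _ _; exact: integral_ge0.
  apply: nearW => m.
  apply: (@le_trans _ _ (\sum_(0 <= j < m) (D * 2^-1 ^+ j)%:E)%E).
    apply: lee_sum => j _.
    rewrite (eq_integral (fun t => ((2 ^+ j)%:E * (d j t)%:E)%E)); last first.
      by move=> t _; rewrite EFinM.
    have mdj : measurable_fun (eball r) (fun t => (d j t)%:E).
      by apply: measurable_Esqnormc; exact: cmeasurableB.
    have d0' t : (0 <= (d j t)%:E)%E by rewrite lee_fin d0.
    rewrite ge0_integralZl//.
    have : (\int[leb]_(t in eball r) (d j t)%:E <= (D * 4^-1 ^+ j)%:E)%E.
      rewrite [leLHS](_ : _ = sq_int r (exp_sum omega x (Gs j.+1 `\` Gs j)%fset)).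
        by apply: (le_trans (HD _)); rewrite lee_fin ler_wpM2l// tail.
      by apply: eq_integral => t _; rewrite /d /f_ exp_sum_sub.
    move=> /(lee_wpmul2l (_ : (0 <= (2 ^+ j)%:E)%E)) => /(_ (exprn_ge0 _ (ler0n _ _))).
    move=> /le_trans; apply; rewrite -EFinM lee_fin mulrCA -exprMn.
    by rewrite (_ : 2 * 4^-1 = 2^-1)//; lra.
  rewrite sumEFin lee_fin -mulr_sumr ler_wpM2l//.
  have := subrX1 (2^-1 : R) m; rewrite big_mkord => h.
  have p0 : 0 <= 2^-1 ^+ m :> R by rewrite exprn_ge0.
  lra.
have key t (g : R) : G t = g%:E -> forall j k,
    sqnormc (f_ (j + k)%N t - f_ j t) <= 2 / 2 ^+ j * g.
  move=> Gg j k; apply: (le_trans (weighted_steps (f_^~ t) k j)).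
  rewrite ler_wpM2l ?divr_ge0 ?exprn_ge0// -lee_fin -Gg -sumEFin.
  apply: (@le_trans _ _ (\sum_(0 <= i < j + k) (2 ^+ i * d i t)%:E)%E).
    by rewrite [leRHS](@big_cat_nat _ _ _ j)/= ?leq_addr// leeDr// sume_ge0.
  exact: nneseries_lim_ge.
pose ure t j := complex.Re (f_ j t); pose uim t j := complex.Im (f_ j t).
have cauchy_cv (u : nat -> R) (g : R) :
    (forall j k, (u (j + k)%N - u j) ^+ 2 <= 2 / 2 ^+ j * g) ->
    exists l : R, u @ \oo --> l.
  move=> ug; suff : cvg (u @ \oo) by move=> cu; exists (lim (u @ \oo)).
  apply/cauchy_cvgP/cauchy_exP => e e0.
  have [N HN] : exists N, 2 / 2 ^+ N * g < e ^+ 2.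
    have := @cvg_geometric R (2 * g) 2^-1; rewrite ger0_norm ?invr_ge0//.
    rewrite invf_lt1 ?ltr1n// => /(_ isT) /cvgr_lt /(_ (e ^+ 2)).
    rewrite exprn_gt0// => /(_ isT) [N _ HN]; exists N.
    by have := HN N (leqnn N); rewrite /geometric/= exprVn mulrAC.
  exists (u N), N => // i /= Ni; rewrite /ball/= -ltr_sqr ?nnegrE// ?(ltW e0)//.
  rewrite real_normK ?num_real//; apply: le_lt_trans HN.
  by have := ug N (i - N)%N; rewrite subnKC// -sqrrN opprB.
(* An upper limit is always defined and measurable; where G is finite it is the
   limit. *)
pose lre t := fine (limn_esup (fun j => (ure t j)%:E)).
pose lim_ t := fine (limn_esup (fun j => (uim t j)%:E)).
pose f t := lre t +i* lim_ t.
have mf' : cmeasurable r f.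
  split; apply: (measurableT_comp (fine_measurable measurableT));
    apply: measurable_fun_limn_esup => j; apply/measurable_EFinP.
    exact: (mf j).1.
  exact: (mf j).2.
have limE (u : nat -> R) (l : R) : u @ \oo --> l -> fine (limn_esup (fun j => (u j)%:E)) = l.
  move=> ul; have ul' : (fun j => (u j)%:E) @ \oo --> l%:E.
    by apply/fine_cvgP; split => //; exact: nearW.
  rewrite is_cvg_limn_esupE; last by apply/cvg_ex; exists l%:E.
  by rewrite (cvg_lim _ ul').
have w20 j : 0 < 2 / 2 ^+ j :> R by rewrite divr_gt0 ?exprn_gt0.
have close t j : ((sqnormc (f t - f_ j t))%:E <= (2 / 2 ^+ j)%:E * G t)%E.
  have := G0 t; case Gg : (G t) => [g| |]; last 2 first.
  - by move=> _; rewrite gt0_muley ?lte_fin// leey.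
  - by rewrite leeNy_eq.
  move=> _; rewrite -EFinM lee_fin.
  have split_ i k : sqnormc (f_ (i + k)%N t - f_ i t) =
      (ure t (i + k)%N - ure t i) ^+ 2 + (uim t (i + k)%N - uim t i) ^+ 2.
    by rewrite /ure /uim; case: (f_ _ t) (f_ i t) => a b [a' b']; rewrite -sqnormcE.
  have [lr Hlr] : exists l : R, ure t @ \oo --> l.
    apply: (cauchy_cv _ g) => i k; apply: le_trans (key t g Gg i k).
    by rewrite split_ lerDl sqr_ge0.
  have [li Hli] : exists l : R, uim t @ \oo --> l.
    apply: (cauchy_cv _ g) => i k; apply: le_trans (key t g Gg i k).
    by rewrite split_ lerDr sqr_ge0.
  have -> : sqnormc (f t - f_ j t) = (lr - ure t j) ^+ 2 + (li - uim t j) ^+ 2.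
    rewrite /f /lre /lim_ (limE _ _ Hlr) (limE _ _ Hli) /ure /uim.
    by case: (f_ j t) => a b; rewrite -sqnormcE.
  have cv : (fun i => (ure t i - ure t j) ^+ 2 + (uim t i - uim t j) ^+ 2) @ \oo -->
      (lr - ure t j) ^+ 2 + (li - uim t j) ^+ 2.
    apply: cvgD; apply: cvgM; apply: cvgB => //; exact: cvg_cst.
  apply: (cvgr_to_le cv); exists j => // i /= ji.
  by have := key t g Gg j (i - j)%N; rewrite split_ subnKC.
have closeI j : (sq_int r (fun t => (f t - f_ j t)%R) <= (2 / 2 ^+ j * (D * 2))%:E)%E.
  rewrite EFinM; apply: (@le_trans _ _ ((2 / 2 ^+ j)%:E * \int[leb]_(t in eball r) G t)%E).
    rewrite -ge0_integralZl//.
    apply: ge0_le_integral => //.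
    - by move=> t _; rewrite lee_fin sqnormc_ge0.
    - by apply: measurable_Esqnormc; exact: cmeasurableB.
    - exact: emeasurable_funM.
  by apply: lee_wpmul2l => //; rewrite lee_fin ltW.
exists f; split; [exact: mf'.1|exact: mf'.2|move=> e e0].
pose c := 10 * D.
have [N HN] : exists N, c / 2 ^+ N < e.
  have := @cvg_geometric R c 2^-1; rewrite ger0_norm ?invr_ge0//.
  rewrite invf_lt1 ?ltr1n// => /(_ isT) /cvgr_lt /(_ e e0) [N _ HN].
  by exists N; have := HN N (leqnn N); rewrite /geometric/= exprVn.
exists (Gs N) => F sub.
have mF := cmeasurable_exp_sum r F.
have mFG := cmeasurable_exp_sum r (F `\` Gs N)%fset.
apply: (le_trans (sq_int_le (cmeasurableB mf' mF) (cmeasurableB mf' (mf N)) mFG _)).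
  move=> t; rewrite -exp_sum_sub// -(sqnormcN (exp_sum omega x F t - _)).
  rewrite [X in sqnormc X <= _](_ : _ = (f t - f_ N t) + - (exp_sum omega x F t - f_ N t)).
    exact: sqnormcD_le.
  by rewrite opprB subrKA.
apply: (@le_trans _ _ (2%:E * (2 / 2 ^+ N * (D * 2))%:E + 2%:E * (D * 4^-1 ^+ N)%:E)%E).
  apply: leeD; apply: lee_wpmul2l; rewrite ?lee_fin//.
  apply: (le_trans (HD _)); rewrite lee_fin ler_wpM2l//; exact: tail.
rewrite -!EFinM -EFinD lee_fin; apply: le_trans (ltW HN).
have h : 4^-1 ^+ N <= (2 ^+ N)^-1 :> R.
  by rewrite -exprVn lerXn2r ?nnegrE ?invr_ge0// lef_pV2 ?posrE// ler_nat.
have := ler_wpM2l D0 h; rewrite /c; set p := (2 ^+ N)^-1; lra.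
Qed.

End family.
End limits.

Lemma separation_le (R : realType) (n : nat) (K : choiceType) (omega : K -> 'rV[R]_n)
    (A : set K) k l : A k -> A l -> k != l ->
  separation omega A <= enorm (omega k - omega l).
Proof.
move=> Ak Al kl; apply: ge_inf; last by exists k, l; split => //; apply/eqP.
by exists 0 => _ [i [j [_ _ _ ->]]]; exact: enorm_ge0.
Qed.

(** Both estimates pass from the partial sums to the limit f through
    |z + w|^2 <= 2 |z|^2 + 2 |w|^2, which costs a factor 2 in the constants. *)
Section bounds.
Variables (R : realType) (n : nat) (K : choiceType).
Variables (omega : K -> 'rV[R]_n) (x : K -> R[i]) (r : R).
Local Notation S F := (\sum_(k <- F) sqnormc (x k)).
Hypothesis sfin : (sq_sum x < +oo)%E.

Lemma exp_series_upper (D : R) f : 0 <= D ->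
  (forall F : {fset K}, (sq_int r (exp_sum omega x F) <= (D * S F)%:E)%E) ->
  exp_series omega r x f -> (sq_int r f <= (2 * D)%:E * sq_sum x)%E.
Proof.
move=> D0 HD [mf1 mf2 Hf]; apply/lee_addgt0Pr => e e0.
have [F HF] := Hf (e / 2) (divr_gt0 e0 (ltr0n _ 2)).
have {HF} := HF F (fsubset_refl F) => HF.
have mF := cmeasurable_exp_sum omega x r F.
have mfF := cmeasurableB (conj mf1 mf2 : cmeasurable r f) mF.
have := sq_int_le (conj mf1 mf2 : cmeasurable r f) mF mfF.
move=> H; apply: (le_trans (H _)) => [t|].
  by rewrite -[f t in leLHS](subrK (exp_sum omega x F t)) addrC (le_trans (sqnormcD_le _ _)).
apply: leeD.
  rewrite EFinM -muleA; apply: lee_wpmul2l => //.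
  apply: (le_trans (HD F)); rewrite EFinM; apply: lee_wpmul2l; first by rewrite lee_fin.
  exact: le_sq_sum.
apply: (@le_trans _ _ (2%:E * (e / 2)%:E)%E); first exact: lee_wpmul2l.
by rewrite -EFinM lee_fin; lra.
Qed.

Lemma exp_series_lower (c : R) f : 0 <= c ->
  (forall F : {fset K}, ((c * S F)%:E <= sq_int r (exp_sum omega x F))%E) ->
  exp_series omega r x f -> ((c / 2)%:E * sq_sum x <= sq_int r f)%E.
Proof.
move=> c0 Hc [mf1 mf2 Hf]; have sq := sq_sum_fin sfin.
apply/lee_addgt0Pr => e e0.
have d0 : 0 < c + 2 by rewrite ltr_wpDl.
pose e' := 2 * e / (c + 2); have e'0 : 0 < e' by rewrite divr_gt0 ?mulr_gt0.
have [F1 HF1] := Hf e' e'0.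
have [F2 HF2] := sq_sum_tail sfin e'0.
pose F := (F1 `|` F2)%fset.
have {}HF1 := HF1 F (fsubsetUl _ _); have {}HF2 := HF2 F (fsubsetUr _ _).
have mF := cmeasurable_exp_sum omega x r F.
have mf : cmeasurable r f by split.
have H := sq_int_le mF mf (cmeasurableB mf mF).
have {}H : ((c * S F)%:E <= 2%:E * sq_int r f + (2 * e')%:E)%E.
  apply: (le_trans (Hc F)); apply: (le_trans (H _)) => [t|].
    rewrite -(sqnormcN (f t - _)) opprB -[exp_sum _ _ _ t in leLHS](subrK (f t)) addrC.
    exact: sqnormcD_le.
  by apply: leeD => //; rewrite EFinM; apply: lee_wpmul2l.
have f0 : (0 <= sq_int r f)%E.
  by apply: integral_ge0 => t _; rewrite lee_fin sqnormc_ge0.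
case: (sq_int r f) f0 H => [v| |]; last 2 first.
- by move=> _ _; rewrite addye// leey.
- by rewrite leeNy_eq.
rewrite -(fineK sq) => _; rewrite -!EFinM -!EFinD !lee_fin => H.
have h1 : c * fine (sq_sum x) - c * e' <= c * S F by rewrite -mulrBr ler_wpM2l.
have h2 : (c + 2) * e' = 2 * e by rewrite mulrC /e' mulfVK// gt_eqF.
lra.
Qed.

End bounds.

Theorem theorem1p1 (R : realType) (N m : nat) (N_ge1 : (1 <= N)%N)
    (m_ge1 : (1 <= m)%N) (gamma : R) (gamma_ : 'I_m -> R)
    (gamma_gt0 : 0 < gamma) (gamma__gt0 : forall j, 0 < gamma_ j) (mu : R)
    (mu_first : first_dirichlet_eigenvalue (eball 1 : set 'rV[R]_N) mu) :
  exists c1 c2 : R, [/\ 0 < c1, 0 < c2 &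
    forall (K : choiceType) (omega : K -> 'rV[R]_N) (K_ : 'I_m -> set K),
      separation omega [set: K] = gamma ->
      trivIset [set: 'I_m] K_ ->
      \bigcup_j K_ j = [set: K] ->
      (forall j, separation omega (K_ j) = gamma_ j) ->
    forall r : R,
      let R0 := \sum_(j < m) 2 * Num.sqrt mu / gamma_ j in
      R0 < r <= 2 * R0 ->
    forall x : K -> R[i], (sq_sum x < +oo)%E ->
      (exists f, exp_series omega r x f) /\
      forall f, exp_series omega r x f ->
        ((c1 * (r - R0) ^+ (5 * m - 4 + 2 * N))%:E * sq_sum x <= sq_int r f)%E
        /\ (sq_int r f <= c2%:E * sq_sum x)%E].
Proof.
have eig := mu_first.1.
have [c c_gt0 Hc] := finite_lower eig m_ge1 gamma_gt0 gamma__gt0.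
set R0 := \sum_(j < m) 2 * Num.sqrt mu / gamma_ j in Hc *.
have R0_ge0 : 0 <= R0.
  by apply: sumr_ge0 => j _; rewrite divr_ge0 ?mulr_ge0 ?sqrtr_ge0// ltW.
have rho0 : 0 < 2 * R0 + 1 by rewrite ltr_wpDl// mulr_ge0.
have [D D0 HD] := upper_gap eig gamma_gt0 rho0.
exists (c / 2), (2 * D); split => [||K omega K_ sepK _ cover sepj r R0' rR x sfin].
- exact: divr_gt0.
- exact: mulr_gt0.
rewrite {}/R0' -/R0 in rR *.
have sepg (F : {fset K}) (k l : F) : k != l -> gamma <= enorm (freqs omega k - freqs omega l).
  by move=> kl; rewrite -sepK; apply: separation_le.
have upF (F : {fset K}) : (sq_int r (exp_sum omega x F) <=
    (D * \sum_(k <- F) sqnormc (x k))%:E)%E.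
  have up a : qform (@freqs _ _ _ omega F) r a <= D * \sum_k a k ^+ 2.
    apply: le_trans (HD _ _ a _); last by move=> k l kl _ _; exact: (@sepg F k l kl).
    by apply: qform_le; case/andP: rR => _; lra.
  by rewrite sq_int_exp_sum lee_fin sq_sumE mulrDr; apply: lerD; exact: up.
have lowF (F : {fset K}) : ((c * (r - R0) ^+ (5 * m - 4 + 2 * N) *
    \sum_(k <- F) sqnormc (x k))%:E <= sq_int r (exp_sum omega x F))%E.
  have low a : c * (r - R0) ^+ (5 * m - 4 + 2 * N) * \sum_k a k ^+ 2 <=
      qform (@freqs _ _ _ omega F) r a.
    apply: (Hc _ _ (fun j k => `[< K_ j (val k) >]) r (@sepg F) _ _ rR).
      move=> j k l kl /asboolP Kk /asboolP Kl; rewrite -sepj.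
      exact: separation_le.
    move=> k; have : (\bigcup_j K_ j) (val k) by rewrite cover.
    by case=> j _ Kk; exists j; apply/asboolP.
  by rewrite sq_int_exp_sum lee_fin sq_sumE mulrDr; apply: lerD; exact: low.
have rR0 : 0 <= r - R0 by rewrite subr_ge0; case/andP: rR => /ltW.
split; first exact: exp_series_exists (ltW D0) upF.
move=> f Hf; split; last exact: exp_series_upper (ltW D0) upF Hf.
rewrite [X in X%:E](_ : _ = c * (r - R0) ^+ (5 * m - 4 + 2 * N) / 2); last by ring.
apply: exp_series_lower lowF Hf => //.
by rewrite mulr_ge0 ?exprn_ge0// ltW.
Qed.
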